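(* Let $N\ge 1$, $\alpha\in(0,1)$, and let $E\subset\mathbb{R}^N$ be a measurable set with $\mathbf 1_E\in BV^{\alpha,\infty}_{\rm loc}(\mathbb{R}^N)$. Then for $|D^\alpha\mathbf 1_E|$-a.e. $x\in\mathscr F^\alpha E$ it holds that $$\bigcup_{k=2}^\infty\mathrm{Tan}^k(E,x)\subset\mathrm{Tan}(E,x).$$
   Context: Fractional divergence: for $\varphi\in \mathrm{Lip}_c(\mathbb{R}^N;\mathbb{R}^N)$, $$\mathrm{div}^\alpha\varphi(x)=c_{N,\alpha}\int_{\mathbb{R}^N}\frac{(\varphi(y)-\varphi(x))\cdot(y-x)}{|y-x|^{N+\alpha+1}}\,dy,\quad x\in\mathbb{R}^N,$$ where $c_{N,\alpha}>0$ is a fixed normalization constant. Fractional variation: $u\in BV^{\alpha,\infty}_{\rm loc}(\mathbb{R}^N)$ means that $u\in L^\infty(\mathbb{R}^N)$ and, for every bounded open set $A\subset\mathbb{R}^N$, $$\sup\Big\{\int_{\mathbb{R}^N}u\,\mathrm{div}^\alpha\varphi\,dx:\varphi\in C^\infty_c(\mathbb{R}^N;\mathbb{R}^N),\ \|\varphi\|_{L^\infty}\le1,\ \mathrm{supp}\,\varphi\subset A\Big\}<\infty.$$ Equivalently, there is a (unique) locally finite $\mathbb{R}^N$-valued Radon measure $D^\alpha u$ on $\mathbb{R}^N$ with $\int u\,\mathrm{div}^\alpha\varphi\,dx=-\int\varphi\cdot dD^\alpha u$ for all $\varphi\in C^\infty_c(\mathbb{R}^N;\mathbb{R}^N)$;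 $|D^\alpha u|$ is its total variation measure. Fractional reduced boundary: if $\mathbf 1_E\in BV^{\alpha,\infty}_{\rm loc}(\mathbb{R}^N)$, then $\mathscr F^\alpha E$ is the set of $x\in\mathrm{supp}|D^\alpha\mathbf 1_E|$ such that the limit $$\nu^\alpha_E(x)=\lim_{r\to0^+}\frac{D^\alpha\mathbf 1_E(B_r(x))}{|D^\alpha\mathbf 1_E|(B_r(x))}$$ exists and belongs to the unit sphere $\mathbb{S}^{N-1}$. Tangent sets: $\mathrm{Tan}(E,x)$ is the set of all measurable $F\subset\mathbb{R}^N$ for which there is a sequence $r_k\to0^+$ with $\mathbf 1_{(E-x)/r_k}\to\mathbf 1_F$ in $L^1_{\rm loc}(\mathbb{R}^N)$. Sets are identified when they coincide up to Lebesgue-null sets. It is known that if $\mathbf 1_E\in BV^{\alpha,\infty}_{\rm loc}(\mathbb{R}^N)$ and $x\in\mathscr F^\alpha E$, then every $F\in\mathrm{Tan}(E,x)$ satisfies $\mathbf 1_F\in BV^{\alpha,\infty}_{\rm loc}(\mathbb{R}^N)$, so $\mathscr F^\alpha F$ is well defined. Iterated tangent sets: for $\mathbf 1_E\in BV^{\alpha,\infty}_{\rm loc}(\mathbb{R}^N)$ put $\mathrm{Tan}(E)=\bigcup\{\mathrm{Tan}(E,x):x\in\mathscr F^\alpha E\}$. For $x\in\mathscr F^\alpha E$, define $\mathrm{Tan}^1(E,x)=\mathrm{Tan}(E,x)$ and, for all integers $k\ge1$, $$\mathrm{Tan}^{k+1}(E,x)=\bigcup\{\mathrm{Tan}(F):F\in\mathrm{Tan}^k(E,x)\}.$$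 *)

(* Defs.v *)
From HB Require Import structures.
From mathcomp Require Import all_boot all_order all_algebra.
From mathcomp Require Import all_classical all_reals all_analysis.

Set Implicit Arguments.
Unset Strict Implicit.
Unset Printing Implicit Defensive.

Import Order.TTheory GRing.Theory Num.Theory.
Import numFieldNormedType.Exports.

Local Open Scope classical_set_scope.
Local Open Scope ring_scope.

(* The space R^N, N >= 1, is ['rV[R]_n.+1] with N = n.+1.  Its library norm is
   the maximum norm, which gives the right topology and bounded sets; wherever
   the Euclidean structure matters, [edot], [enorm] and [eball] are used. *)

Section Euclidean.
Context (R : realType) (n : nat).
Local Notation V := 'rV[R]_n.+1.

Definition edot (x y : V) : R := \sum_i x 0 i * y 0 i.
Definition enorm (x : V) : R := Num.sqrt (edot x x).
Definition eball (x : V) (r : R) : set V := [set y | enorm (y - x) < r].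

End Euclidean.

(* N-dimensional Lebesgue measure: the outer measure given by countable covers
   by half-open boxes, restricted to its Caratheodory-measurable sets, i.e., to
   the Lebesgue measurable subsets of R^N. *)
Section LebesgueMeasure.
Context (R : realType) (n : nat).
Local Notation V := 'rV[R]_n.+1.

Definition box (p : V * V) : set V :=
  [set x | forall i, p.1 0 i < x 0 i <= p.2 0 i].

(* The truncation at 0 makes empty boxes have volume 0. *)
Definition box_vol (p : V * V) : R :=
  \prod_i Num.max 0 (p.2 0 i - p.1 0 i).

Definition box_cover (X : set V) : set (V * V)^nat :=
  [set F | X `<=` \bigcup_k box (F k)].

Definition lebesgue_outer (X : set V) : \bar R :=
  ereal_inf [set (\sum_(k <oo) (box_vol (F k))%:E)%E | F in box_cover X].

Lemma box_vol_ge0 p : 0 <= box_vol p.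
Proof. by apply: prodr_ge0 => i _; rewrite le_max lexx. Qed.

Let vol_ge0 p : (0 <= (box_vol p)%:E)%E.
Proof. by rewrite lee_fin box_vol_ge0. Qed.

Lemma lebesgue_outer_ge0 X : (0 <= lebesgue_outer X)%E.
Proof. by apply: le_ereal_inf_tmp => _ [F _ <-]; exact: nneseries_ge0. Qed.

Lemma le_lebesgue_outer :
  {homo lebesgue_outer : A B / A `<=` B >-> (A <= B)%E}.
Proof.
move=> A B AB; apply/ereal_inf_le_tmp => x [F BF <-].
by exists F => //; exact: subset_trans BF.
Qed.

Lemma lebesgue_outer0 : lebesgue_outer set0 = 0%E.
Proof.
apply/eqP; rewrite eq_le lebesgue_outer_ge0 andbT.
apply: ereal_inf_lbound; exists (fun=> (0, 0)); first by [].
rewrite eseries0// => k _ _; rewrite /box_vol big_ord_recl/= !mxE subrr.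
by rewrite maxxx mul0r.
Qed.

Lemma lebesgue_outer_sigma_subadditive : sigma_subadditive lebesgue_outer.
Proof.
move=> A; have [[i ioo]|] := pselect (exists i, lebesgue_outer (A i) = +oo%E).
  rewrite (eseries_pinfty _ _ ioo) ?leey// => k _.
  by rewrite -ltNye (lt_le_trans _ (lebesgue_outer_ge0 _)).
rewrite -forallNE => Aoo.
suff add2e (e : {posnum R}) : (lebesgue_outer (\bigcup_n A n) <=
    \sum_(i <oo) lebesgue_outer (A i) + e%:num%:E)%E.
  by apply/lee_addgt0Pr => _/posnumP[].
rewrite (le_trans _ (epsilon_trick _ _ _))//; last first.
  by move=> k; exact: lebesgue_outer_ge0.
pose P k (B : (V * V)^nat) := box_cover (A k) B /\
  (\sum_(j <oo) (box_vol (B j))%:E <=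
   lebesgue_outer (A k) + (e%:num / (2 ^ k.+1)%:R)%:E)%E.
have [G PG] : {G : ((V * V)^nat)^nat & forall k, P k (G k)}.
  apply: (@choice _ _ P) => k; rewrite /P /lebesgue_outer.
  set S := (X in ereal_inf X); move infS : (ereal_inf S) => iS.
  case: iS infS => [r Sr|Soo|Soo].
  - have en1 : (0 < e%:num / (2 ^ k.+1)%:R)%R by [].
    have /(lb_ereal_inf_adherent en1) : ereal_inf S \is a fin_num by rewrite Sr.
    move=> [x [B AB muBx] xS].
    by exists B; split => //; rewrite muBx -Sr; exact/ltW.
  - by have := Aoo k; rewrite /lebesgue_outer Soo.
  - by have := lebesgue_outer_ge0 (A k); rewrite /lebesgue_outer -/S Soo.
pose vol := fun p : V * V => (box_vol p)%:E.
have volG_ge0 x : (0 <= (vol \o uncurry G) x)%E by exact: vol_ge0.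
apply: (@le_trans _ _ (\esum_(i in setT) (vol \o uncurry G) i)%E).
  apply: ereal_inf_lbound => /=.
  have /card_esym/ppcard_eqP[f] := card_nat2.
  exists (uncurry G \o f).
    apply: (@subset_trans _ (\bigcup_i \bigcup_k box (G i k))) => [t [i _]|].
      by move=> /(PG i).1 -[j _ ?]; exists i => //; exists j.
    move=> t [i _ [j _ Bijt]]; exists (f^-1%FUN (i, j)) => //=.
    by rewrite invK ?inE.
  rewrite -(esum_pred_image (vol \o uncurry G) _ xpredT) ?[fun=> _]set_true//.
  by rewrite image_eq.
rewrite (_ : esum _ _ = \sum_(i <oo) \sum_(j <oo) vol (G i j))%E; last first.
  pose J : nat -> set (nat * nat) := fun i => [set (i, j) | j in setT].
  rewrite (_ : setT = \bigcup_k J k); last first.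
    by rewrite predeqE => -[a b]; split => // _; exists a => //; exists b.
  rewrite esum_bigcupT /=; last 2 first.
    - apply/trivIsetP => i j _ _ ij.
      rewrite predeqE => -[k m] /=; split => //= -[] [_] _ [<-{k} _].
      by move=> [m' _] [] /esym/eqP; rewrite (negbTE ij).
    - by move=> /= [k m]; exact: vol_ge0.
  rewrite -(image_id [set: nat]) -fun_true esum_pred_image//; last first.
    by move=> k _; apply: esum_ge0 => x _; exact: vol_ge0.
  apply: eq_eseriesr => /= j _.
  rewrite -(esum_pred_image (vol \o uncurry G) (pair j) predT)//=; last first.
  - by move=> ? ? _ _; exact: (@can_inj _ _ _ snd).
  - by move=> k _; exact: vol_ge0.
  - congr esum; rewrite predeqE => -[a b].
    by split; move=> [i _ <-]; exists i.
apply: lee_lim.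
- apply: is_cvg_nneseries => k *.
  by apply: nneseries_ge0 => m *; exact: (volG_ge0 (k, m)).
- by apply: is_cvg_nneseries => k *; apply: adde_ge0 => //;
    exact: lebesgue_outer_ge0.
- by near=> k; apply: lee_sum => i _; exact: (PG i).2.
Unshelve. all: by end_near. Qed.

HB.instance Definition _ := isOuterMeasure.Build R V lebesgue_outer
  lebesgue_outer0 lebesgue_outer_ge0 le_lebesgue_outer
  lebesgue_outer_sigma_subadditive.

Definition lebesgueType : Type := caratheodory_type lebesgue_outer.
HB.instance Definition _ := Measurable.on lebesgueType.

Definition lebesgueN : set lebesgueType -> \bar R := lebesgue_outer.
HB.instance Definition _ :=
  isMeasure.Build _ lebesgueType R lebesgueN
    (@caratheodory_measure0 R V lebesgue_outer)
    (@caratheodory_measure_ge0 R V lebesgue_outer)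
    (@caratheodory_measure_sigma_additive R V lebesgue_outer).

Definition borelType : Type := g_sigma_algebraType (@open V).
HB.instance Definition _ := Measurable.on borelType.

End LebesgueMeasure.

Section TestFunctions.
Context (R : realType) (n : nat).
Local Notation V := 'rV[R]_n.+1.

(* C^k through continuity of all iterated partial derivatives of order <= k *)
Fixpoint is_Ck (k : nat) (f : V -> V) : Prop :=
  continuous f /\
  (if k is k'.+1 then
     forall i : 'I_n.+1,
       (forall x, derivable f x (delta_mx 0 i)) /\
       is_Ck k' (fun x => 'D_(delta_mx 0 i) f x)
   else True).

Definition fsupp (f : V -> V) : set V := closure [set x | f x != 0].

Definition test_field (f : V -> V) : Prop :=
  (forall k, is_Ck k f) /\ compact (fsupp f).

End TestFunctions.

(* R^N-valued Radon measures are countably additive set functions on the bounded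
   Borel sets; the values of [D] on other sets are irrelevant. *)
Section VectorMeasures.
Context (R : realType) (n : nat).
Local Notation V := 'rV[R]_n.+1.
Local Notation B := (borelType R n).
Implicit Types D : set B -> V.

Definition bounded_borel (A : set B) : Prop :=
  measurable A /\ bounded_set (A : set V).

Definition vector_radon D : Prop :=
  forall F : (set B)^nat,
    (forall k, measurable (F k)) -> trivIset setT F ->
    bounded_set (\bigcup_k F k : set V) ->
    (fun m => \sum_(k < m) D (F k)) @ \oo --> D (\bigcup_k F k).

(* For a Borel set A one may equivalently require that the F k form a partition
   of A. *)
Definition total_var D (A : set B) : \bar R :=
  ereal_sup [set (\sum_(k <oo) (enorm (D (F k)))%:E)%E | F in
    [set F : (set B)^nat | [/\ forall k, bounded_borel (F k),
                              trivIset setT F & \bigcup_k F k `<=` A]]].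

(* The Jordan decomposition of the i-th component of D; these are genuine
   positive measures, possibly infinite on unbounded sets. *)
Definition pos_variation D (i : 'I_n.+1) (A : set B) : \bar R :=
  ereal_sup [set (D C 0 i)%:E | C in
    [set C | bounded_borel C /\ C `<=` A]].
Definition neg_variation D (i : 'I_n.+1) (A : set B) : \bar R :=
  ereal_sup [set (- D C 0 i)%:E | C in
    [set C | bounded_borel C /\ C `<=` A]].

Definition vintegral (f : V -> V) D : R :=
  \sum_i (fine (\int[pos_variation D i]_x (f x 0 i)%:E)%E -
          fine (\int[neg_variation D i]_x (f x 0 i)%:E)%E).

Definition msupp (mu : set B -> \bar R) : set V :=
  [set x | forall r : R, 0 < r -> (0 < mu (eball x r))%E].

End VectorMeasures.

(* [c] stands for the normalization constant c_{N,alpha}. *)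
Section FractionalVariation.
Context (R : realType) (n : nat) (c alpha : R).
Local Notation V := 'rV[R]_n.+1.
Local Notation leb := (@lebesgueN R n).

Definition frac_div (f : V -> V) (x : V) : R :=
  c * \int[leb]_y (edot (f y - f x) (y - x)
                   / enorm (y - x) `^ (n.+1%:R + alpha + 1)).

Definition in_Linfty (u : V -> R) : Prop :=
  measurable_fun [set: lebesgueType R n] u /\
  finite_norm leb +oo%E u.

Definition BV_loc (u : V -> R) : Prop :=
  in_Linfty u /\
  forall A : set V, open A -> bounded_set A ->
    (ereal_sup [set \int[leb]_x (u x * frac_div f x)%:E | f in
       [set f | [/\ test_field f,
                    'N[leb]_+oo [EFin \o (@enorm R n \o f)] <= 1 &
                    (fsupp f `<=` A)%classic]]] < +oo)%E.

Definition is_frac_grad (u : V -> R) (D : set (borelType R n) -> V) : Prop :=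
  vector_radon D /\
  forall f, test_field f ->
    (\int[leb]_x (u x * frac_div f x)%:E = (- vintegral f D)%:E)%E.

(* The measure D^alpha u; for bounded measurable u it exists iff u is in BV_loc,
   and it is unique on bounded Borel sets.  It is 0 if it does not exist. *)
Definition frac_grad (u : V -> R) : set (borelType R n) -> V :=
  xget (fun=> 0) [set D | is_frac_grad u D].

Definition frac_boundary (E : set V) : set V :=
  let D := frac_grad \1_E in
  [set x | msupp (total_var D) x /\
    exists nu : V,
      (fun r : R => (fine (total_var D (eball x r)))^-1 *: D (eball x r))
        @ 0^'+ --> nu /\
      enorm nu = 1].

Definition lebesgue_measurable (E : set V) : Prop :=
  measurable (E : set (lebesgueType R n)).

Definition blow_up (E : set V) (x : V) (r : R) : set V :=
  [set r^-1 *: (z - x) | z in E].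

Definition cvg_L1loc (G : (set V)^nat) (F : set V) : Prop :=
  forall K : set V, compact K ->
    (\int[leb]_(y in K) `|\1_(G k) y - \1_F y|%:E)%E @[k --> \oo] --> 0%E.

Definition Tan (E : set V) (x : V) : set (set V) :=
  [set F | lebesgue_measurable F /\
    exists r : R^nat, [/\ forall k, 0 < r k, r @ \oo --> 0 &
                          cvg_L1loc (fun k => blow_up E x (r k)) F]].

Definition Tan_all (E : set V) : set (set V) :=
  \bigcup_(x in frac_boundary E) Tan E x.

(* [Tan_iter k] is Tan^k for k >= 1; the case k = 0 is a placeholder. *)
Fixpoint Tan_iter (k : nat) (E : set V) (x : V) : set (set V) :=
  match k with
  | 0 => set0
  | 1 => Tan E x
  | k'.+1 => \bigcup_(F in Tan_iter k' E x) Tan_all F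
  end.

End FractionalVariation.

(* Main.v *)
(* If F is tangent to E at x and y lies in the reduced boundary of F, then for
   almost every x the translate F - y is again tangent to E at x; since Tan(E, x)
   is stable under tangents at the origin, this gives Tan(F, y) \subset Tan(E, x),
   and induction on k yields the theorem.

   Otherwise, F - y stays at a distance 1/m from all small blow-ups of E at x.
   The measurable sets being separable for local convergence in measure, the
   exceptional x are covered by countably many sets A on which m is fixed and the
   sets F - y are moreover close to each other.  Such an A is porous for the
   measure: along r_k -> 0 the blow-ups of E at points near x + r_k y resemble
   F - y, so that A misses a ball of radius comparable to r_k centred at
   x + r_k y.  This hole has mass >= c r_k^(N-alpha), since a test field supported
   near y pairs nontrivially with D^alpha 1_F and the pairing is continuous along
   the blow-ups, whereas balls of radius comparable to r_k centred at x have mass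
   <= C r_k^(N-alpha), since x lies in the reduced boundary of E.  By Vitali's
   covering lemma a set which is porous in this sense is null: neighbourhoods of A
   of nearly minimal measure cannot lose a fixed proportion of their mass by the
   removal of disjoint holes. *)

(* The difficulty is nonlocality: [frac_div f] does not have compact support even when [f] has. It
   is however bounded, continuous and O(|x|^-(N+alpha)) at infinity, hence integrable; since
   indicators are bounded by 1, local convergence of blow-ups is then enough to pass to the limit in
   the pairings. The exponent N - alpha is the scaling of these pairings: r^N from the volume,
   r^-alpha from the divergence. It is the same in the upper bound for balls and in the lower bound
   for holes, so their ratio does not depend on the scale. No doubling property is proved for the
   measure, so the porosity criterion compares one ball with its own hole only. The constant of this
   comparison depends on the point, and the exceptional set is cut once more into pieces on which it
   is at most an integer. All estimates are made for [mvar], a true measure comparable with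
   [total_var]; null sets are transferred back at the end. *)
Require Import Defs.
From HB Require Import structures.
From mathcomp Require Import all_boot all_order all_algebra.
From mathcomp Require Import all_classical all_reals all_analysis.
From mathcomp Require Import measurable_realfun ring lra.

Set Implicit Arguments.
Unset Strict Implicit.
Unset Printing Implicit Defensive.

Import Order.TTheory GRing.Theory Num.Theory.
Import numFieldNormedType.Exports.

Local Open Scope classical_set_scope.
Local Open Scope ring_scope.

(** * Lebesgue measure on R^N *)

Section Lebesgue.
Context {R : realType} {n : nat}.
Local Notation V := 'rV[R]_n.+1.
Local Notation L := (lebesgueType R n).
Local Notation leb := (@lebesgueN R n).
Implicit Types (x y z : V) (A B U : set V).

Definition box_lo (i : 'I_n.+1) (t : R) (p : V * V) : V * V :=
  (p.1, \row_j if j == i then Num.min (p.2 0 j) t else p.2 0 j).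
Definition box_hi (i : 'I_n.+1) (t : R) (p : V * V) : V * V :=
  (\row_j (if j == i then Num.max (p.1 0 j) t else p.1 0 j), p.2).

Lemma max0_split (a b t : R) :
  Num.max 0 (Num.min b t - a) + Num.max 0 (b - Num.max a t) = Num.max 0 (b - a).
Proof.
have [bt|/ltW tb] := leP b t.
  have [|] := leP a t => ?; rewrite ?(max_l (_ : b - t <= 0)) ?addr0//; first lra.
  by rewrite !max_l ?addr0//; lra.
have [at_|/ltW ta] := leP a t; first by rewrite !max_r; lra.
by rewrite (@max_l _ _ _ (t - a)) ?add0r//; lra.
Qed.

Lemma box_vol_split i t p :
  box_vol (box_lo i t p) + box_vol (box_hi i t p) = box_vol p.
Proof.
rewrite /box_vol /= (bigD1 i)//= [X in _ + X](bigD1 i)//= [RHS](bigD1 i)//=.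
rewrite !mxE eqxx.
under eq_bigr => j /negbTE ji do rewrite mxE ji.
under [X in _ + _ * X]eq_bigr => j /negbTE ji do rewrite mxE ji.
rewrite -mulrDl; congr (_ * _).
exact: max0_split.
Qed.

(** Caratheodory's criterion: cutting along the hyperplane turns a cover of [X] into covers of its
    two parts with the same total volume. Half-open boxes split without overlap, and degenerate ones
    keep volume 0. *)
Lemma measurable_halfspace (i : 'I_n.+1) (t : R) :
  measurable ([set x | x 0 i <= t] : set L).
Proof.
apply: le_caratheodory_measurable => X.
apply: le_ereal_inf_tmp => _ [F XF <-].
under [leRHS]eq_eseriesr => k _ do rewrite -(box_vol_split i t) EFinD.
rewrite nneseriesD; try by move=> k _ _; rewrite lee_fin box_vol_ge0.
apply: leeD; apply: ereal_inf_lbound.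
- exists (box_lo i t \o F) => // x [/XF[k _ Fk] /= xt].
  exists k => // j; rewrite /= mxE; have := Fk j.
  by case: eqP => // ->; rewrite le_min xt andbT.
- exists (box_hi i t \o F) => // x [/XF[k _ Fk] /= xt].
  exists k => // j; rewrite /= mxE; have := Fk j.
  case: eqP => // -> /andP[Fx ->]; rewrite andbT gt_max Fx/=.
  by move/negP: xt; rewrite -ltNge.
Qed.

Lemma measurable_coord (i : 'I_n.+1) :
  measurable_fun [set: L] (fun x : L => (x : V) 0 i).
Proof.
apply: (measurability _ (RGenOInfty.measurableE R)).
move=> _ [_ [a ->] <-]; rewrite setTI.
rewrite (_ : _ @^-1` _ = ~` [set x : V | x 0 i <= a]); last first.
  apply/seteqP; split => x /=; rewrite in_itv/= andbT.
    by move=> /lt_geF ->.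
  by move/negP; rewrite -ltNge.
exact/measurableC/measurable_halfspace.
Qed.

Lemma ballE_rV x (e : R) : 0 < e -> ball x e = \bigcap_(i : 'I_n.+1)
   [set y : V | x 0 i - e < y 0 i < x 0 i + e].
Proof.
move=> e0; apply/seteqP; split => y.
  by move=> [_ h] i _; have := h 0 i; rewrite /ball/= ltr_distlC.
move=> h; split => // a i; rewrite (ord1 a).
by rewrite /ball/= ltr_distlC; exact: h.
Qed.

Lemma measurable_ball x (e : R) : measurable (ball x e : set L).
Proof.
have [e0|e0] := ltP 0 e; last first.
  rewrite (_ : ball x e = set0); first exact: measurable0.
  by apply/le0_ball0.
rewrite ballE_rV// -[X in measurable X]setIT.
rewrite setIT; apply: (@fin_bigcap_measurable _ L _ [set: 'I_n.+1]) => //.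
move=> i _.
rewrite (_ : [set y | _] = (fun y : L => (y : V) 0 i) @^-1` `]x 0 i - e, x 0 i + e[).
  by rewrite -[X in measurable X]setTI; exact: measurable_coord.
by apply/seteqP; split => y /=; rewrite in_itv.
Qed.

Definition ratV (q : 'rV[rat]_n.+1) : V := map_mx ratr q.

Lemma ratV_dense x (e : R) : 0 < e -> exists q, ball x e (ratV q).
Proof.
move=> e0.
have h i : exists q : rat, `|x 0 i - ratr q| < e.
  have /rat_in_itvoo[q] : x 0 i - e < x 0 i + e by lra.
  by rewrite in_itv/= => xq; exists q; rewrite ltr_distlC.
have [f hf] := choice h.
exists (\row_i f i); split => // a i; rewrite (ord1 a) !mxE/=.
exact: hf.
Qed.

(** Countability of the rational cubes makes open sets measurable; finite unions of these cubes are
    also the countable class of [separable_sets]. *)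
Lemma open_rat_balls U : open U -> U = \bigcup_(p in
  [set p : 'rV[rat]_n.+1 * nat | ball (ratV p.1) p.2.+1%:R^-1 `<=` U])
  ball (ratV p.1) (p.2.+1%:R^-1 : R).
Proof.
move=> oU; apply/seteqP; split => [x Ux|x [p /= pU] /pU//].
have /nbhs_ballP[e /= e0 xeU] := open_nbhs_nbhs (conj oU Ux).
pose k := Num.truncn (2 / e).
have ke : (k.+1%:R^-1 : R) < e / 2.
  rewrite -[ltRHS]invf_div ltf_pV2 ?posrE ?divr_gt0//.
  exact: truncnS_gt.
have k0 : (0 : R) < k.+1%:R^-1 by rewrite invr_gt0.
have [q xq] := ratV_dense x k0.
exists (q, k) => /=; last exact: ball_sym.
move=> y qy; apply: xeU; rewrite [e]splitr.
by apply: (ball_triangle (y := ratV q)); [apply: le_ball xq|apply: le_ball qy];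
  exact/ltW.
Qed.

Lemma open_lebesgue_measurable U : open U -> measurable (U : set L).
Proof.
move=> /open_rat_balls ->; rewrite bigcup_mkcond.
apply: (@countable_bigcupT_measurable _ L) => // p.
by case: ifP => _; [exact: measurable_ball|exact: measurable0].
Qed.

Lemma closed_lebesgue_measurable U : closed U -> measurable (U : set L).
Proof.
move=> cU; rewrite -(setCK U); apply: measurableC.
by apply: open_lebesgue_measurable; rewrite openC.
Qed.

Lemma continuous_lebesgue_measurable (f : V -> R) :
  continuous f -> measurable_fun [set: L] (f : L -> R).
Proof.
move=> /continuousP cf; apply: (measurability _ (RGenOpens.measurableE R)).
move=> _ [_ [a [b ->] <-]]; rewrite setTI.
exact/open_lebesgue_measurable/cf/interval_open.
Qed.

End Lebesgue.

(** * Affine changes of variables *)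

Section Affine.
Context {R : realType} {n : nat}.
Local Notation V := 'rV[R]_n.+1.
Local Notation L := (lebesgueType R n).
Local Notation leb := (@lebesgueN R n).
Implicit Types (x y z : V) (A B U : set V) (r : R).

(** The inverse of the zoom at [x] by the factor 1/r; blow-ups are preimages under it
    ([blow_upE]). *)
Definition aff x r y : V := x + r *: y.

Lemma aff_inv x r y : r != 0 -> aff x r (aff (- (r^-1 *: x)) r^-1 y) = y.
Proof.
by move=> r0; rewrite /aff scalerDr scalerN !scalerA mulfV// !scale1r addNKr.
Qed.

Lemma aff_invV x r y : r != 0 -> aff (- (r^-1 *: x)) r^-1 (aff x r y) = y.
Proof.
by move=> r0; rewrite /aff scalerDr scalerA mulVf// scale1r addKr.
Qed.

(** The inverse map carries boxes to boxes and multiplies volumes by [r ^- n.+1]. Applied to the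
    inverse map as well, this gives the equality [outer_aff]. *)
Lemma outer_aff_le x r A : 0 < r ->
  (lebesgue_outer (aff x r @^-1` A) <= (r ^- n.+1)%:E * lebesgue_outer A)%E.
Proof.
move=> r0; have rN0 : 0 < r ^- n.+1 by rewrite invr_gt0 exprn_gt0.
rewrite lee_pdivlMl ?exprn_gt0//.
apply: le_ereal_inf_tmp => _ [F AF <-].
rewrite -lee_pdivlMl ?exprn_gt0//.
pose m (p : V * V) := (aff (- (r^-1 *: x)) r^-1 p.1, aff (- (r^-1 *: x)) r^-1 p.2).
rewrite -nneseriesZl; last by move=> k _; rewrite lee_fin box_vol_ge0.
rewrite (eq_eseriesr (g := fun k => (box_vol (m (F k)))%:E)); last first.
  move=> k _; rewrite -EFinM /box_vol /=; congr (_%:E).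
  rewrite -exprVn -[in r^-1 ^+ _](card_ord n.+1) -prodr_const -big_split/=.
  apply: eq_bigr => i _; rewrite !mxE maxr_pMr ?invr_ge0 ?ltW// mulr0.
  by congr (Num.max _ _); ring.
apply: ereal_inf_lbound; exists (m \o F) => // y /= /AF[k _ Fk]; exists k => // i.
move: (Fk i); rewrite /= !mxE => /andP[h1 h2].
rewrite ![- _ + _]addrC -!mulrBr ltr_pdivrMl// ler_pdivlMl//.
by apply/andP; split; lra.
Qed.

Lemma outer_aff x r A : 0 < r ->
  lebesgue_outer (aff x r @^-1` A) = ((r ^- n.+1)%:E * lebesgue_outer A)%E.
Proof.
move=> r0; have rne := lt0r_neq0 r0.
apply/eqP; rewrite eq_le outer_aff_le//=.
have ri : 0 < r^-1 by rewrite invr_gt0.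
have := @outer_aff_le (- (r^-1 *: x)) r^-1 (aff x r @^-1` A) ri.
rewrite (_ : _ @^-1` (_ @^-1` A) = A).
  by rewrite exprVn invrK -lee_pdivrMl ?exprn_gt0.
by apply/seteqP; split => y /=; rewrite aff_inv.
Qed.

Lemma measurable_aff_preimage x r A : 0 < r ->
  measurable (A : set L) -> measurable (aff x r @^-1` A : set L).
Proof.
move=> r0 mA; have rne := lt0r_neq0 r0.
apply: le_caratheodory_measurable => X.
pose Y := aff (- (r^-1 *: x)) r^-1 @^-1` X.
have /= e : X = aff x r @^-1` Y.
  by apply/seteqP; split => y; rewrite /Y /= aff_invV.
rewrite [in leRHS]e outer_aff// (mA Y) ge0_muleDr ?lebesgue_outer_ge0//.
by rewrite -!(outer_aff x)// e.
Qed.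

Lemma measurable_fun_aff x r : 0 < r ->
  measurable_fun [set: L] (aff x r : L -> L).
Proof. by move=> r0 _ Y mY; rewrite setTI; exact: measurable_aff_preimage. Qed.

Local Open Scope ereal_scope.

Lemma ge0_integral_aff x r (f : V -> \bar R) : (0 < r)%R ->
  measurable_fun [set: L] (f : L -> \bar R) -> (forall y, 0 <= f y) ->
  \int[leb]_y f (aff x r y) = (r ^- n.+1)%:E * \int[leb]_y f y.
Proof.
move=> r0 mf f0.
have rN0 : (0 <= r ^- n.+1)%R by rewrite invr_ge0 exprn_ge0// ltW.
have := @ge0_integral_pushforward _ _ L L R _ (measurable_fun_aff x r0) leb setT f
  measurableT mf (fun y _ => f0 y).
rewrite preimage_setT => /= <-.
rewrite -(ge0_integral_mscale leb measurableT (NngNum rN0))//.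
apply: eq_measure_integral; first exact: measurable_fun_aff.
by move=> mp A _ _; exact: (outer_aff x A r0).
Qed.

(** For a positive finite factor distributivity survives +oo - +oo, so that [integral_aff] covers
    non-integrable functions. *)
Lemma muleB_ge0 (k : R) (a b : \bar R) : (0 < k)%R -> 0 <= a -> 0 <= b ->
  k%:E * (a - b) = k%:E * a - k%:E * b.
Proof.
move=> k0; case: a => [a| |]; case: b => [b| |]// _ _.
- by rewrite muleBr.
- by rewrite /= !(gt0_muley, gt0_muleNy) ?lte_fin.
- by rewrite /= !(gt0_muley, gt0_muleNy) ?lte_fin.
- by rewrite /= !(gt0_muley, gt0_muleNy) ?lte_fin.
Qed.

Lemma fineZ (k : R) (a : \bar R) : (0 < k)%R -> fine (k%:E * a) = (k * fine a)%R.
Proof.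
move=> k0; case: a => [a| |]//=;
  by rewrite ?(gt0_muley, gt0_muleNy) ?lte_fin //= mulr0.
Qed.

Lemma integral_aff x r (f : V -> \bar R) : (0 < r)%R ->
  measurable_fun [set: L] (f : L -> \bar R) ->
  \int[leb]_y f (aff x r y) = (r ^- n.+1)%:E * \int[leb]_y f y.
Proof.
move=> r0 mf.
have rN0 : (0 < r ^- n.+1)%R by rewrite invr_gt0 exprn_gt0.
rewrite integralE [in RHS]integralE.
have p := @ge0_integral_aff x r f^\+ r0 (measurable_funepos mf) (funepos_ge0 f).
have m := @ge0_integral_aff x r f^\- r0 (measurable_funeneg mf) (funeneg_ge0 f).
rewrite (muleB_ge0 rN0); [|exact: integral_ge0|exact: integral_ge0].
congr (_ - _); [rewrite -[RHS]p|rewrite -[RHS]m];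
  by apply: eq_integral => y _; rewrite ?funeposE ?funenegE.
Qed.

Lemma Rintegral_aff x r (f : V -> R) : (0 < r)%R ->
  measurable_fun [set: L] (f : L -> R) ->
  (\int[leb]_y f (aff x r y))%R = (r ^- n.+1 * \int[leb]_y f y)%R.
Proof.
move=> r0 mf; have /measurable_EFinP mEf := mf.
have /(congr1 fine) := integral_aff x r0 mEf.
by rewrite fineZ// invr_gt0 exprn_gt0.
Qed.

End Affine.

Section Regularity.
Context {R : realType} {n : nat}.
Local Notation V := 'rV[R]_n.+1.
Local Notation L := (lebesgueType R n).
Local Notation leb := (@lebesgueN R n).
Implicit Types (x y z : V) (A B C U : set V) (r : R).

Definition symdiff A B : set V := (A `\` B) `|` (B `\` A).

Lemma symdiff_triangle A B C : symdiff A C `<=` symdiff A B `|` symdiff B C.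
Proof.
by move=> x; rewrite /symdiff/=; have [] := pselect (B x); tauto.
Qed.

Lemma symdiffC A B : symdiff A B = symdiff B A.
Proof. by rewrite /symdiff setUC. Qed.

Lemma le_outerU A B C : A `<=` B `|` C ->
  (lebesgue_outer A <= lebesgue_outer B + lebesgue_outer C)%E.
Proof.
move=> ABC; apply: le_trans (outer_measureU2 _ _ _).
exact: le_lebesgue_outer.
Qed.

Lemma measurable_symdiff A B : measurable (A : set L) -> measurable (B : set L) ->
  measurable (symdiff A B : set L).
Proof. by move=> mA mB; apply: measurableU; exact: measurableD. Qed.

Lemma coord_le_norm x i : `|x 0 i| <= `|x|.
Proof.
have -> : `|x| = mx_norm x by [].
rewrite mx_normrE.
exact: (le_bigmax _ (fun j : 'I_1 * 'I_n.+1 => `|x j.1 j.2|) (0, i)).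
Qed.

(** Boxes are open on the left, so the lower corner is pushed out by 1. *)
Lemma cube_sub_box (m : R) : [set x : V | `|x| <= m] `<=` box (const_mx (- m - 1), const_mx m).
Proof.
move=> x /= xm i /=; rewrite !mxE.
have : `|x 0 i| <= m.
  exact: le_trans (coord_le_norm _ _) xm.
by rewrite ler_norml => /andP[? ?]; apply/andP; split; lra.
Qed.

Lemma outer_cube_le (m : R) : 0 <= m ->
  (lebesgue_outer [set x : V | (`|x| <= m)%R] <= ((m *+ 2 + 1) ^+ n.+1)%:E)%E.
Proof.
move=> m0; pose F (k : nat) : V * V := if k is 0%N then (const_mx (- m - 1), const_mx m) else (0, 0).
apply: (@le_trans _ _ (\sum_(k <oo) (box_vol (F k))%:E)%E).
  apply: ereal_inf_lbound; exists F => //= x xm; exists 0%N => //.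
  exact: cube_sub_box.
rewrite (@nneseries_split_cond _ _ 0 1)// ?eseries0//.
- rewrite big_nat_recr//= big_nil add0e adde0 lee_fin.
  rewrite /box_vol /=.
  under eq_bigr => i _ do rewrite !mxE.
  rewrite prodr_const card_ord max_r; last by lra.
  by rewrite lerXn2r ?nnegrE; lra.
- move=> k k1 _; case: k k1 => // k _; rewrite /box_vol big_ord_recl/= !mxE subrr.
  by rewrite maxxx mul0r.
- by move=> k _; rewrite lee_fin box_vol_ge0.
Qed.

End Regularity.

(** * Outer regularity and separability *)

Section SeparableSets.
Context {R : realType} {n : nat}.
Local Notation V := 'rV[R]_n.+1.
Local Notation L := (lebesgueType R n).
Local Notation leb := (@lebesgueN R n).
Implicit Types (x y z : V) (A B C U : set V) (r : R).

Lemma exprn_scale_ex (M e : R) (N : nat) : 0 < e ->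
  exists2 s : R, 1 < s & s ^+ N * M < M + e.
Proof.
move=> e0.
have : (fun s : R => s ^+ N * M) @ 1^'+ --> 1 ^+ N * M.
  apply: cvg_at_right_filter; apply: cvgM; last exact: cvg_cst.
  exact: exprn_continuous.
rewrite expr1n mul1r => c.
have h1 : \forall s \near (1 : R)^'+, s ^+ N * M < M + e.
  by apply: (cvgr_lt M) => //; rewrite ltrDl.
have h2 : \forall s \near (1 : R)^'+, 1 < s by exact: nbhs_right_gt.
by have [s [? ?]] := @filter_ex _ _ _ _ (filterI h1 h2); exists s.
Qed.

Definition open_box (p : V * V) : set V :=
  [set x | forall i, p.1 0 i < x 0 i < p.2 0 i].

Lemma open_open_box p : open (open_box p).
Proof.
rewrite openE => x /= px.
have : exists2 e : R, 0 < e & forall i, e <= x 0 i - p.1 0 i /\ e <= p.2 0 i - x 0 i.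
  pose f i := Num.min (x 0 i - p.1 0 i) (p.2 0 i - x 0 i).
  exists (\big[Num.min/1]_i f i).
    elim/big_ind : _ => // [a b a0 b0|i _]; first by rewrite lt_min a0.
    by rewrite lt_min !subr_gt0; exact: px.
  move=> i; suff : \big[Num.min/1]_i f i <= f i by rewrite /f le_min => /andP.
  exact: bigmin_le_cond.
move=> [e e0 he]; apply/nbhs_ballP; exists e => // y [_ xy] i.
have := xy 0 i; rewrite /ball/= ltr_distlC => /andP[h1 h2].
by have [? ?] := he i; apply/andP; split; lra.
Qed.

(** Stretching the box by [s] from its lower corner yields an open box, at the cost of a factor s^N
    that is later taken close to 1. A box with a nonpositive side is empty. *)
Lemma box_open_cover (s : R) p : 1 < s -> exists U,
  [/\ open U, box p `<=` U & (lebesgue_outer U <= (s ^+ n.+1 * box_vol p)%:E)%E].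
Proof.
move=> s1; have [h|/existsNP[i hi]] := pselect (forall i, p.1 0 i < p.2 0 i); last first.
  exists set0; split => //.
  - by move=> x /(_ i)/andP[h1 h2]; apply: hi; apply: lt_le_trans h2.
  - rewrite lebesgue_outer0 lee_fin mulr_ge0 ?box_vol_ge0// exprn_ge0//.
    by rewrite (le_trans _ (ltW s1)).
pose q : V * V := (p.1, p.1 + s *: (p.2 - p.1)).
exists (open_box q); split; first exact: open_open_box.
  move=> x px i; have /andP[h1 h2] := px i; rewrite /q/= !mxE h1/=.
  have := h i; nra.
have qs : open_box q `<=` box q.
  by move=> x qx i; have /andP[-> /ltW ->] := qx i.
apply: (le_trans (le_lebesgue_outer qs)).
pose F (k : nat) : V * V := if k is 0%N then q else (0, 0).
apply: (@le_trans _ _ (\sum_(k <oo) (box_vol (F k))%:E)%E).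
  by apply: ereal_inf_lbound; exists F => // x qx; exists 0%N.
rewrite (@nneseries_split_cond _ _ 0 1)// ?eseries0//.
- rewrite big_nat_recr//= big_nil add0e adde0 lee_fin.
  rewrite -[in leRHS](card_ord n.+1) -prodr_const /box_vol -big_split/=.
  apply: ler_prod => i _; rewrite le_max lexx/= !mxE.
  rewrite maxr_pMr ?mulr0; last by rewrite (le_trans _ (ltW s1)).
  by rewrite [p.1 0 i + _]addrC addrK.
- move=> k k1 _; case: k k1 => // k _; rewrite /box_vol big_ord_recl/= !mxE subrr.
  by rewrite maxxx mul0r.
- by move=> k _; rewrite lee_fin box_vol_ge0.
Qed.

Lemma outer_regular A (e : R) : 0 < e -> (lebesgue_outer A < +oo)%E ->
  exists U, [/\ open U, A `<=` U &
    (lebesgue_outer U <= lebesgue_outer A + e%:E)%E].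
Proof.
move=> e0 Afin; have e20 : 0 < e / 2 by rewrite divr_gt0.
have Af : lebesgue_outer A \is a fin_num by rewrite ge0_fin_numE ?lebesgue_outer_ge0.
have [_ [F AF <-] FA] := lb_ereal_inf_adherent e20 Af.
have [s s1 sM] := exprn_scale_ex (fine (lebesgue_outer A) + e / 2) n.+1 e20.
have /choice[U hU] k := box_open_cover (F k) s1.
exists (\bigcup_k U k); split.
- by apply: bigcup_open => k _; have [] := hU k.
- by move=> x /AF[k _ xk]; exists k => //; have [_ h _] := hU k; exact: h.
apply: (le_trans (outer_measure_sigma_subadditive _ _)).
apply: (@le_trans _ _ (\sum_(k <oo) ((s ^+ n.+1)%:E * (box_vol (F k))%:E))%E).
  apply: lee_nneseries => [k _ _|k _]; first exact: lebesgue_outer_ge0.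
  by have [_ _] := hU k; rewrite EFinM.
rewrite nneseriesZl; last by move=> k _; rewrite lee_fin box_vol_ge0.
apply: (@le_trans _ _ ((s ^+ n.+1)%:E * (lebesgue_outer A + (e / 2)%:E))%E).
  apply: lee_wpmul2l; last exact: ltW FA.
  by rewrite lee_fin exprn_ge0// (le_trans _ (ltW s1)).
rewrite -(fineK Af) -EFinD -EFinM lee_fin; lra.
Qed.

Lemma outer_regular_diff A (e : R) : 0 < e -> measurable (A : set L) ->
  (lebesgue_outer A < +oo)%E ->
  exists U, [/\ open U, A `<=` U, (lebesgue_outer U < +oo)%E &
    (lebesgue_outer (U `\` A) <= e%:E)%E].
Proof.
move=> e0 mA Afin; have [U [oU AU hU]] := outer_regular e0 Afin.
have Af : lebesgue_outer A \is a fin_num by rewrite ge0_fin_numE ?lebesgue_outer_ge0.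
exists U; split => //.
  by apply: (le_lt_trans hU); rewrite -(fineK Af) -EFinD ltry.
have := mA U; rewrite setIidr// -setDE => e1.
by move: hU; rewrite e1 leeD2lE.
Qed.

Definition rat_ball_set (s : seq ('rV[rat]_n.+1 * nat)) : set V :=
  \bigcup_(p in [set` s]) ball (ratV p.1) (p.2.+1%:R^-1 : R).

Lemma open_rat_ball_set s : open (rat_ball_set s).
Proof. by apply: bigcup_open => p _; exact: ball_open. Qed.

(** An open set [U] slightly larger than [A] is an increasing union of finite unions of rational
    cubes; continuity from above, applied to what is left of [U], shows that finitely many cubes
    suffice. *)
Lemma separable_sets A (e : R) : 0 < e -> measurable (A : set L) ->
  (lebesgue_outer A < +oo)%E ->
  exists s, (lebesgue_outer (symdiff A (rat_ball_set s)) <= e%:E)%E.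
Proof.
move=> e0 mA Afin.
have e20 : 0 < e / 2 by rewrite divr_gt0.
have [U [oU AU Ufin hU]] := outer_regular_diff e20 mA Afin.
pose good : pred ('rV[rat]_n.+1 * nat) := fun p => `[< ball (ratV p.1) (p.2.+1%:R^-1 : R) `<=` U >].
(* The pairs with code below [k], kept if their ball lies in [U]; the resulting sets increase with
   [k]. *)
pose s k : seq ('rV[rat]_n.+1 * nat) := [seq p <- pmap unpickle (iota 0 k) | good p].
have sU k : rat_ball_set (s k) `<=` U.
  by move=> x [p /=]; rewrite mem_filter => /andP[/asboolP pU _] /pU.
have Us : \bigcup_k (rat_ball_set (s k)) = U.
  apply/seteqP; split; first by move=> x [k _ /sU].
  rewrite [X in X `<=` _](open_rat_balls oU) => x [p /= pU px].
  exists (pickle p).+1 => //; exists p => //=.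
  rewrite mem_filter; apply/andP; split; first exact/asboolP.
  rewrite mem_pmap; apply/mapP; exists (pickle p); last by rewrite pickleK.
  by rewrite mem_iota /= add0n.
have cv := @nonincreasing_cvg_mu _ _ _ leb (fun k => U `\` rat_ball_set (s k)).
have mD k : measurable (U `\` rat_ball_set (s k) : set L).
  by apply: measurableD; apply: open_lebesgue_measurable => //; exact: open_rat_ball_set.
have {cv} : leb \o (fun k => U `\` rat_ball_set (s k)) @ \oo --> leb (\bigcap_k (U `\` rat_ball_set (s k))).
  apply: cv => //.
  - apply: le_lt_trans Ufin; apply: le_lebesgue_outer; exact: subDsetl.
  - by apply: bigcap_measurable => //; exists 0%N.
  - apply/nonincreasing_seqP => k; apply/subsetPset; apply: setDS.
    move=> x [p ps px]; exists p; last by [].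
    move: ps; rewrite /mkset /s !mem_filter => /andP[-> ps]; rewrite andTb.
    move: ps; rewrite !mem_pmap => /mapP[j jk ->]; apply: map_f.
    by move: jk; rewrite !mem_iota !add0n !leq0n !andTb => /ltnW.
have -> : \bigcap_k (U `\` rat_ball_set (s k)) = set0.
  rewrite -subset0 => x /= h; have [Ux _] := h 0%N I.
  by move: (Ux); rewrite -Us => -[k _]; have [_] := h k I.
rewrite measure0 => cv.
have h0 : ereal_nbhs (0 : \bar R)%E (fun u => (u < (e / 2)%:E)%E).
  by apply: open_ereal_lt'; rewrite lte_fin.
have [k _ hk] := cv _ h0.
exists (s k); rewrite [e]splitr EFinD.
apply: (le_trans (le_outerU (B := U `\` A) (C := U `\` rat_ball_set (s k)) _)).
  by move=> x [[Ax ns]|[sx nA]]; [right; split => //; exact: AU|left; split => //; exact: sU sx].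
by rewrite addeC leeD//; apply/ltW; apply: hk => /=.
Qed.

End SeparableSets.

(** * Local convergence in measure and tangent sets *)

Section Translation.
Context {R : realType} {n : nat}.
Local Notation V := 'rV[R]_n.+1.
Local Notation L := (lebesgueType R n).
Local Notation leb := (@lebesgueN R n).
Implicit Types (x y z h w : V) (A B C E F U : set V) (r : R).

(** This is A - h, which moves the point [h] to the origin: the set F - y of the overview is
    [tr y F]. *)
Definition tr h A : set V := [set y | A (h + y)].

Lemma trE h A : tr h A = aff h 1 @^-1` A.
Proof. by apply/seteqP; split => y; rewrite /tr/aff/= scale1r. Qed.

Lemma outer_tr h A : lebesgue_outer (tr h A) = lebesgue_outer A.
Proof. by rewrite trE outer_aff// expr1n invr1 mul1e. Qed.

Lemma measurable_tr h A : measurable (A : set L) -> measurable (tr h A : set L).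
Proof. by rewrite trE; exact: measurable_aff_preimage. Qed.

Lemma open_tr_cvg U (e : R) : 0 < e -> open U -> (lebesgue_outer U < +oo)%E ->
  exists2 d : R, 0 < d & forall h, `|h| < d ->
    (lebesgue_outer (U `\` tr h U) <= e%:E)%E.
Proof.
move=> e0 oU Ufin.
(* [W k] is the set of points at distance at least 1/(k+1) from the complement of [U]. The shells
   [U] minus [W k] decrease to the empty set, and a shift shorter than 1/(k+1) pushes only points of
   the shell out of [U]. *)
pose W (k : nat) : set V := ~` \bigcup_(y in ~` U) ball y (k.+1%:R^-1 : R).
have mUW k : measurable (U `\` W k : set L).
  apply: measurableD; first exact: open_lebesgue_measurable.
  apply: closed_lebesgue_measurable; apply: open_closedC.
  by apply: bigcup_open => y _; exact: ball_open.
have := @nonincreasing_cvg_mu _ _ _ leb (fun k => U `\` W k).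
have -> : \bigcap_k (U `\` W k) = set0.
  rewrite -subset0 => x /= H; have [Ux _] := H 0%N I.
  have /nbhs_ballP[d /= d0 xd] := open_nbhs_nbhs (conj oU Ux).
  pose k := Num.truncn d^-1.
  have kd : (k.+1%:R^-1 : R) < d.
    by rewrite -[ltRHS]invrK ltf_pV2 ?posrE ?invr_gt0//; exact: truncnS_gt.
  have [_ []] := H k I; move=> [y /= nUy yx]; apply: nUy; apply: xd.
  by apply: ball_sym; apply: le_ball yx; exact: ltW.
rewrite measure0 => cv.
have {}cv : leb \o (fun k => U `\` W k) @ \oo --> 0%E.
  apply: cv => //.
  - by apply: le_lt_trans Ufin; apply: le_lebesgue_outer; exact: subDsetl.
  - apply/nonincreasing_seqP => k; apply/subsetPset; apply: setDS.
    apply: subsetC => x [y Uy yx]; exists y => //.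
    by apply: le_ball yx; rewrite lef_pV2 ?posrE// ler_nat.
have h0 : ereal_nbhs (0 : \bar R)%E (fun u => (u < e%:E)%E).
  by apply: open_ereal_lt'; rewrite lte_fin.
have [k _ hk] := cv _ h0.
exists k.+1%:R^-1; first by rewrite invr_gt0.
move=> h hk'; apply/ltW/(le_lt_trans _ (hk k (leqnn k))).
apply: le_lebesgue_outer => x [Ux nU]; split => // Wx; apply: Wx.
exists (h + x) => //; rewrite -ball_normE/=.
by rewrite addrK.
Qed.

Lemma outer_tr_cvg A (e : R) : 0 < e -> measurable (A : set L) ->
  (lebesgue_outer A < +oo)%E ->
  exists2 d : R, 0 < d & forall h, `|h| < d ->
    (lebesgue_outer (symdiff A (tr h A)) <= e%:E)%E.
Proof.
move=> e0 mA Afin; have e40 : 0 < e / 4 by rewrite divr_gt0.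
have [U [oU AU Ufin hU]] := outer_regular_diff e40 mA Afin.
have [d d0 hd] := open_tr_cvg e40 oU Ufin.
exists d => // h hlt.
have -> : e%:E = ((e / 4)%:E + (e / 4)%:E + ((e / 4)%:E + (e / 4)%:E))%E.
  by rewrite -!EFinD; congr (_%:E); field.
(* Four errors of size [e / 4]: [U] minus [A], its translate, the points that leave [U], and those
   that enter it; the last set is a translate of the points leaving [U] under the opposite shift. *)
pose B1 := (U `\` A) `|` tr h (U `\` A).
pose B2 := (U `\` tr h U) `|` tr h (U `\` tr (- h) U).
apply: (le_trans (le_outerU (B := B1) (C := B2) _)); last first.
  apply: leeD.
    by apply: (le_trans (le_outerU (@subset_refl _ _))); apply: leeD => //; rewrite outer_tr.
  apply: (le_trans (le_outerU (@subset_refl _ _))); apply: leeD; first exact: hd.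
  by rewrite outer_tr; apply: hd; rewrite normrN.
move=> x; rewrite /B1 /B2 /symdiff /tr/=.
rewrite addKr.
have := AU x; have := AU (h + x).
by have [?|?] := pselect (U x); have [?|?] := pselect (U (h + x)); tauto.
Qed.

Definition cube (m : R) : set V := [set x | `|x| <= m].

(** Inside the cube this is the L^1 distance of the indicators ([integral_symdiff]), so these
    pseudometrics together describe [cvg_L1loc]. *)
Definition dm (m : R) A B := lebesgue_outer (symdiff A B `&` cube m).

Lemma cube_compact m : compact (cube m).
Proof.
apply: bounded_closed_compact.
  exists m; split; first exact: num_real.
  by move=> M mM x xm /=; rewrite (le_trans xm)// ltW.
rewrite (_ : cube m = (fun x : V => `|x|) @^-1` [set t | t <= m])//.
apply: preimage_closed; [move=> x _; exact: norm_continuous|exact: closed_le].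
Qed.

Lemma measurable_cube m : measurable (cube m : set L).
Proof.
apply: closed_lebesgue_measurable; apply: compact_closed (@cube_compact m).
exact: norm_hausdorff.
Qed.

Lemma cube_le (m m' : R) : m <= m' -> cube m `<=` cube m'.
Proof. by move=> mm x /= /le_trans; apply. Qed.

Lemma outer_cube_fin m A : A `<=` cube m -> (lebesgue_outer A < +oo)%E.
Proof.
move=> Am; have m0 : 0 <= `|m| by [].
apply: le_lt_trans (ltry _); first apply: le_trans (outer_cube_le m0).
apply: le_lebesgue_outer => x /Am /= xm.
by rewrite (le_trans xm)// ler_norm.
Qed.

Lemma dmC m A B : dm m A B = dm m B A.
Proof. by rewrite /dm symdiffC. Qed.

Lemma dm_triangle m A B C : (dm m A C <= dm m A B + dm m B C)%E.
Proof.
apply: le_outerU; rewrite -setIUl; apply: setSI; exact: symdiff_triangle.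
Qed.

Lemma dm_le m m' A B : m <= m' -> (dm m A B <= dm m' A B)%E.
Proof. by move=> mm; apply: le_lebesgue_outer; apply: setIS; exact: cube_le. Qed.

Lemma dm_tr m h A B : (dm m (tr h A) (tr h B) <= dm (m + `|h|) A B)%E.
Proof.
rewrite /dm -(outer_tr h (symdiff A B `&` _)).
apply: le_lebesgue_outer => x [/= AB xm]; split => //.
rewrite /cube/=.
by rewrite (le_trans (ler_normD _ _))// addrC lerD2r.
Qed.

Lemma dm_tr_cvg m F y (e : R) : 0 < e -> measurable (F : set L) ->
  exists2 d : R, 0 < d & forall w, `|w - y| < d -> (dm m (tr y F) (tr w F) <= e%:E)%E.
Proof.
(* [F] is cut to finite measure by a cube so large that the points of [cube m], translated by [y] or
   by any [w] within 1 of [y], never see the cut. *)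
move=> e0 mF; pose S := F `&` cube (m + `|y| + 1).
have mS : measurable (S : set L) by apply: measurableI => //; exact: measurable_cube.
have [d d0 hd] := outer_tr_cvg e0 mS (outer_cube_fin (@subIsetr _ _ _)).
exists (Num.min d 1); first by rewrite lt_min d0/=.
move=> w; rewrite lt_min => /andP[wd w1].
apply: le_trans (hd _ wd).
rewrite -(outer_tr y (symdiff _ _)); apply: le_lebesgue_outer => x [].
have e1 : y + (w - y) = w by rewrite addrCA subrr addr0.
rewrite /symdiff /tr /S /cube /= addrA [w - y + y]subrK => H xm.
have c1 : `|y + x| <= m + `|y| + 1.
  by rewrite (le_trans (ler_normD _ _))//; lra.
have c2 : `|w + x| <= m + `|y| + 1.
  rewrite -(subrK y w) -addrA (le_trans (ler_normD _ _))//.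
  have := ler_normD y x; lra.
tauto.
Qed.

Lemma integral_symdiff A B K : measurable (A : set L) -> measurable (B : set L) ->
  measurable (K : set L) ->
  (\int[leb]_(y in K) `|\1_A y - \1_B y|%:E)%E = lebesgue_outer (symdiff A B `&` K).
Proof.
move=> mA mB mK.
rewrite -[RHS](@integral_indic _ _ _ leb K mK (symdiff A B)); last exact: measurable_symdiff.
apply: eq_integral => x _; congr (_%:E).
rewrite /symdiff !indicE/= !in_setU !in_setD.
by case: (x \in A); case: (x \in B); rewrite /= ?subr0 ?sub0r ?subrr ?normrN ?normr0 ?normr1.
Qed.

Lemma blow_upE E x r : 0 < r -> blow_up E x r = aff x r @^-1` E.
Proof.
move=> r0; have rne := lt0r_neq0 r0; apply/seteqP; split => y.
  by move=> [z Ez <-]; rewrite /aff/= scalerA mulfV// scale1r addrC subrK.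
move=> /= Ey; exists (aff x r y) => //.
by rewrite /aff addrAC subrr add0r scalerA mulVf// scale1r.
Qed.

Lemma measurable_blow_up E x r : 0 < r -> measurable (E : set L) ->
  measurable (blow_up E x r : set L).
Proof. by move=> r0; rewrite blow_upE//; exact: measurable_aff_preimage. Qed.

Lemma cvg_L1loc_dm (G : (set V)^nat) F m (e : R) : 0 < e ->
  (forall k, measurable (G k : set L)) -> measurable (F : set L) ->
  cvg_L1loc G F -> \forall k \near \oo, (dm m (G k) F < e%:E)%E.
Proof.
move=> e0 mG mF /(_ _ (@cube_compact m)).
have -> : (fun k => \int[leb]_(y in cube m) `|\1_(G k) y - \1_F y|%:E)%E =
    fun k => dm m (G k) F.
  by apply/funext => k; rewrite integral_symdiff//; exact: measurable_cube.
have h0 : ereal_nbhs (0 : \bar R)%E (fun u => (u < e%:E)%E).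
  by apply: open_ereal_lt'; rewrite lte_fin.
by move=> /(_ _ h0).
Qed.

Lemma dm_cvg_L1loc (G : (set V)^nat) F :
  (forall k, measurable (G k : set L)) -> measurable (F : set L) ->
  (forall k, (dm k%:R (G k) F < k.+1%:R^-1%:E)%E) -> cvg_L1loc G F.
Proof.
move=> mG mF H K cK.
have mK : measurable (K : set L) 
  by apply: closed_lebesgue_measurable; apply: compact_closed cK; exact: norm_hausdorff.
have -> : (fun k => \int[leb]_(y in K) `|\1_(G k) y - \1_F y|%:E)%E =
    fun k => lebesgue_outer (symdiff (G k) F `&` K).
  by apply/funext => k; rewrite integral_symdiff.
have [M [_ KM]] := compact_bounded cK.
pose k0 := (Num.truncn (`|M| + 1)).+1.
have Kk k : (k0 <= k)%N -> K `<=` cube k%:R.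
  move=> k0k x Kx; apply: (KM k%:R) => //.
  have : `|M| + 1 < k0%:R by exact: truncnS_gt.
  have : (k0%:R : R) <= k%:R by rewrite ler_nat.
  have := ler_norm M; lra.
have cv0 : (fun k => (k.+1%:R^-1 : R)%:E) @ \oo --> 0%E.
  by apply: cvg_EFin; [exact: nearW|exact: cvg_harmonic].
apply: (squeeze_cvge _ (cvg_cst 0%E) cv0).
exists k0 => // k /= kk; rewrite lebesgue_outer_ge0/=.
apply/ltW/(le_lt_trans _ (H k)); apply: le_lebesgue_outer; apply: setIS; exact: Kk.
Qed.

(** Diagonal choice: a single index controls the window, the scale and the error. Failure at an
    index [m] is the condition [far m] below. *)
Lemma TanP E x F : measurable (E : set L) -> measurable (F : set L) ->
  (forall m : nat, exists r, [/\ 0 < r, r < m.+1%:R^-1 &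
     (dm m%:R (blow_up E x r) F < m.+1%:R^-1%:E)%E]) -> Tan E x F.
Proof.
move=> mE mF /choice[r hr]; split => //; exists r; split.
- by move=> k; have [] := hr k.
- apply: (squeeze_cvgr _ (cvg_cst 0) (@cvg_harmonic R)).
  by apply: nearW => k; have [? ? _] := hr k; rewrite !ltW.
- apply: dm_cvg_L1loc => // k; have [? _ ?] := hr k => //.
  exact: measurable_blow_up.
Qed.

Lemma Tan_dm E x F : measurable (E : set L) -> Tan E x F ->
  measurable (F : set L) /\ exists r : R^nat, [/\ forall k, 0 < r k,
    r @ \oo --> 0 & forall m (e : R), 0 < e ->
       \forall k \near \oo, (dm m (blow_up E x (r k)) F < e%:E)%E].
Proof.
move=> mE [mF [r [r0 rc cv]]]; split => //; exists r; split => // m e e0.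
by apply: cvg_L1loc_dm => // k; exact: measurable_blow_up.
Qed.

End Translation.

(** * The Euclidean norm *)

Section EuclideanNorm.
Context {R : realType} {n : nat}.
Local Notation V := 'rV[R]_n.+1.
Implicit Types (x y z : V) (r : R).

Lemma edotC x y : edot x y = edot y x.
Proof. by apply: eq_bigr => i _; rewrite mulrC. Qed.

Lemma edotDl x y z : edot (x + y) z = edot x z + edot y z.
Proof. by rewrite -big_split/=; apply: eq_bigr => i _; rewrite mxE mulrDl. Qed.

Lemma edotZl r x y : edot (r *: x) y = r * edot x y.
Proof. by rewrite /edot mulr_sumr; apply: eq_bigr => i _; rewrite mxE mulrA. Qed.

Lemma edotNl x y : edot (- x) y = - edot x y.
Proof. by rewrite -scaleN1r edotZl mulN1r. Qed.

Lemma edotBl x y z : edot (x - y) z = edot x z - edot y z.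
Proof. by rewrite edotDl edotNl. Qed.

Lemma edotDr x y z : edot z (x + y) = edot z x + edot z y.
Proof. by rewrite !(edotC z) edotDl. Qed.

Lemma edotZr r x y : edot x (r *: y) = r * edot x y.
Proof. by rewrite !(edotC x) edotZl. Qed.

Lemma edotBr x y z : edot z (x - y) = edot z x - edot z y.
Proof. by rewrite !(edotC z) edotBl. Qed.

Lemma edot0l x : edot 0 x = 0.
Proof. by apply: big1 => i _; rewrite mxE mul0r. Qed.

Lemma edot_ge0 x : 0 <= edot x x.
Proof. by apply: sumr_ge0 => i _; rewrite -expr2 sqr_ge0. Qed.

Lemma enorm_ge0 x : 0 <= enorm x.
Proof. exact: sqrtr_ge0. Qed.

Lemma enorm_sqr x : enorm x ^+ 2 = edot x x.
Proof. by rewrite sqr_sqrtr// edot_ge0. Qed.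

Lemma enorm0 : enorm (0 : V) = 0.
Proof. by rewrite /enorm edot0l sqrtr0. Qed.

Lemma enormZ r x : enorm (r *: x) = `|r| * enorm x.
Proof.
by rewrite /enorm edotZl edotZr mulrA -expr2 sqrtrM ?sqr_ge0// sqrtr_sqr.
Qed.

Lemma enormN x : enorm (- x) = enorm x.
Proof. by rewrite -scaleN1r enormZ normrN1 mul1r. Qed.

Lemma enorm_distC x y : enorm (x - y) = enorm (y - x).
Proof. by rewrite -enormN opprB. Qed.

Lemma coord_le_enorm x i : `|x 0 i| <= enorm x.
Proof.
rewrite -sqrtr_sqr ler_sqrt ?edot_ge0// /edot (bigD1 i)//= -expr2 lerDl.
by apply: sumr_ge0 => j _; rewrite -expr2 sqr_ge0.
Qed.

Lemma enorm_eq0 x : enorm x = 0 -> x = 0.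
Proof.
move=> x0; apply/rowP => i; apply/eqP; rewrite mxE -normr_le0 -x0.
exact: coord_le_enorm.
Qed.

(** Cauchy-Schwarz: the component of [x] orthogonal to [y] has nonnegative square. *)
Lemma edot_le x y : edot x y <= enorm x * enorm y.
Proof.
have [y0|y0] := eqVneq (enorm y) 0.
  by rewrite (enorm_eq0 y0) edotC edot0l enorm0 mulr0.
have yp : 0 < enorm y by rewrite lt_neqAle eq_sym y0 enorm_ge0.
have yy : edot y y != 0 by rewrite -enorm_sqr sqrf_eq0.
have yyp : 0 < edot y y by rewrite lt_neqAle eq_sym yy edot_ge0.
have := edot_ge0 (x - (edot x y / edot y y) *: y).
rewrite edotBl !edotBr edotZl !edotZr edotZl (edotC y x).
have -> : edot x x - edot x y / edot y y * edot x y -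
  (edot x y / edot y y * edot x y - edot x y / edot y y * (edot x y / edot y y * edot y y))
  = edot x x - edot x y ^+ 2 / edot y y by field.
rewrite subr_ge0 ler_pdivrMr// => h.
apply: (le_trans (ler_norm _)); rewrite -sqrtr_sqr.
rewrite -[leRHS]ger0_norm ?mulr_ge0 ?enorm_ge0// -[leRHS]sqrtr_sqr ler_sqrt ?sqr_ge0//.
by rewrite exprMn !enorm_sqr.
Qed.

Lemma edot_norm_le x y : `|edot x y| <= enorm x * enorm y.
Proof. by rewrite ler_norml edot_le andbT lerNl -edotNl -(enormN x) edot_le. Qed.

Lemma enormD x y : enorm (x + y) <= enorm x + enorm y.
Proof.
rewrite -[leLHS]ger0_norm ?enorm_ge0// -[leRHS]ger0_norm ?addr_ge0 ?enorm_ge0//.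
rewrite -ler_sqr ?nnegrE ?normr_ge0// !real_normK ?num_real// sqrrD !enorm_sqr.
rewrite edotDl !edotDr (edotC y x).
have := edot_le x y; lra.
Qed.

Lemma enormB_le x y : `|enorm x - enorm y| <= enorm (x - y).
Proof.
rewrite ler_norml; have := enormD (x - y) y; have := enormD (y - x) x.
by rewrite !subrK (enorm_distC y x) => ? ?; apply/andP; split; lra.
Qed.

Lemma enorm_le_sum x : enorm x <= \sum_i `|x 0 i|.
Proof.
have {1}-> : x = \sum_i x 0 i *: delta_mx 0 i by rewrite -row_sum_delta.
elim/big_ind2 : _ => [|a b c e h1 h2|i _]; first by rewrite enorm0.
  by apply: (le_trans (enormD _ _)); exact: lerD.
rewrite enormZ -[leRHS]mulr1 ler_wpM2l//.
rewrite -(sqrtr1 R) ler_sqrt// /edot (bigD1 i)//= !mxE !eqxx mulr1 big1 ?addr0//.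
by move=> j /negbTE ji; rewrite !mxE ji mulr0.
Qed.

Lemma norm_le_enorm x : `|x| <= enorm x.
Proof.
have -> : `|x| = mx_norm x by [].
rewrite mx_normrE; apply/bigmax_leP; split; first exact: enorm_ge0.
by move=> [a i] _ /=; rewrite (ord1 a); exact: coord_le_enorm.
Qed.

Lemma enorm_le_norm x : enorm x <= n.+1%:R * `|x|.
Proof.
apply: (le_trans (enorm_le_sum x)).
apply: (@le_trans _ _ (\sum_(i < n.+1) `|x|)).
  by apply: ler_sum => i _; exact: coord_le_norm.
by rewrite sumr_const card_ord mulr_natl.
Qed.

Lemma enorm_continuous : continuous (@enorm R n).
Proof.
move=> x A /nbhs_ballP[e /= e0 eA]; apply/nbhs_ballP.
exists (e / n.+1%:R); first by rewrite /= divr_gt0.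
move=> y; rewrite -ball_normE/= => xy; apply: eA; rewrite -ball_normE/=.
apply: (le_lt_trans (enormB_le _ _)).
by apply: (le_lt_trans (enorm_le_norm _)); rewrite mulrC -ltr_pdivlMr.
Qed.

Lemma eball_bounded x r : bounded_set (eball x r).
Proof.
exists (`|x| + r); split; first exact: num_real.
move=> M hM y /= yx; rewrite -(subrK x y) (le_trans (ler_normD _ _))//.
by move: yx; rewrite /eball/=; have := norm_le_enorm (y - x); lra.
Qed.

(** Library balls are cubes; passing to Euclidean balls costs the factor N seen in later
    constants. *)
Lemma ball_sub_eball x r : ball x (r / n.+1%:R) `<=` eball x r.
Proof.
move=> y; rewrite -ball_normE/= ltr_pdivlMr// mulrC => h.
by rewrite /eball/= enorm_distC (le_lt_trans (enorm_le_norm _)).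
Qed.

Lemma eball_open x r : open (eball x r).
Proof.
rewrite openE => y yx; apply/nbhs_ballP.
exists ((r - enorm (y - x)) / n.+1%:R) => /=; first by rewrite divr_gt0 ?subr_gt0.
move=> z /ball_sub_eball; rewrite /eball/=.
by have := enormD (z - y) (y - x); rewrite addrA subrK => ? ?; lra.
Qed.

Lemma eball_sub_ball x r : eball x r `<=` ball x r.
Proof.
move=> y; rewrite /eball/= -ball_normE/= enorm_distC.
exact: le_lt_trans (norm_le_enorm _).
Qed.

End EuclideanNorm.

(** * Jordan decomposition of vector-valued Radon measures *)

Section Variation.
Context {R : realType} {n : nat}.
Local Notation V := 'rV[R]_n.+1.
Local Notation B := (borelType R n).
Implicit Types (d : set B -> R) (A C : set B).

Lemma open_borel (U : set V) : open U -> measurable (U : set B).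
Proof. by move=> oU; apply: sub_sigma_algebra. Qed.

Lemma closed_borel (U : set V) : closed U -> measurable (U : set B).
Proof.
move=> cU; rewrite -(setCK U); apply: measurableC.
by apply: open_borel; rewrite openC.
Qed.

Lemma continuous_borel (f : V -> R) : continuous f ->
  measurable_fun [set: B] (f : B -> R).
Proof.
move=> /continuousP cf; apply: (measurability _ (RGenOpens.measurableE R)).
move=> _ [_ [a [b ->] <-]]; rewrite setTI.
by apply: open_borel; apply: cf; exact: interval_open.
Qed.

Definition scalar_radon d := forall F : (set B)^nat,
  (forall k, measurable (F k)) -> trivIset setT F ->
  bounded_set (\bigcup_k F k : set V) ->
  (fun m => \sum_(k < m) d (F k)) @ \oo --> d (\bigcup_k F k).

(* [pos_variation D i] is convertible to [svar (fun C => D C 0 i)]. *)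
Definition svar d A : \bar R :=
  ereal_sup [set (d C)%:E | C in [set C | bounded_borel C /\ C `<=` A]].

Lemma bounded_setE (A : set V) :
  bounded_set A <-> exists M : R, forall x, A x -> `|x| <= M.
Proof.
split=> [[M [_ h]]|[M h]].
  by exists (M + 1) => x Ax; apply: (h (M + 1)) => //; rewrite ltrDl.
exists M; split; first exact: num_real.
by move=> N MN x Ax; rewrite /= (le_trans (h x Ax))// ltW.
Qed.

Lemma bounded_setS (A C : set V) : C `<=` A -> bounded_set A -> bounded_set C.
Proof. by rewrite !bounded_setE => CA [M h]; exists M => x /CA/h. Qed.

Lemma bounded_setU (A C : set V) : bounded_set A -> bounded_set C ->
  bounded_set (A `|` C).
Proof.
rewrite !bounded_setE => -[M h] [M' h']; exists (Num.max M M') => x.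
by case=> [/h|/h'] le; rewrite le_max le ?orbT.
Qed.

Lemma bounded_set0 : bounded_set (set0 : set V).
Proof. by apply/bounded_setE; exists 0. Qed.

Lemma bounded_borelS A C : bounded_borel A -> measurable C -> C `<=` A ->
  bounded_borel C.
Proof. by move=> [mA bA] mC CA; split => //; exact: bounded_setS bA. Qed.

Lemma bounded_borel0 : bounded_borel (set0 : set B).
Proof. by split; [exact: measurable0|exact: bounded_set0]. Qed.

Lemma bounded_borelU A C : bounded_borel A -> bounded_borel C -> bounded_borel (A `|` C).
Proof. by move=> [mA bA] [mC bC]; split; [exact: measurableU|exact: bounded_setU]. Qed.

Section scalar.
Context (d : set B -> R) (hd : scalar_radon d).

(** Along the constant sequence of empty sets the partial sums converge, so their constant increment
    [d set0] tends to 0. *)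
Lemma sradon0 : d set0 = 0.
Proof.
have := hd (F := fun=> set0) (fun=> measurable0) (@trivIset_set0 _ _ _).
rewrite bigcup0// => /(_ bounded_set0) c.
pose u (m : nat) := \sum_(k < m) d (set0 : set B).
have c1 : [sequence u m.+1]_m @ \oo --> d set0 by rewrite cvg_shiftS.
have := cvgB c1 c; rewrite subrr.
have -> : [sequence u m.+1]_m - u = fun=> d set0.
  by apply/funext => m; rewrite /u !fctE /= big_ord_recr/= addrAC subrr add0r.
by move=> /(_ _)/(cvg_lim (@Rhausdorff R)) <-; rewrite lim_cst//; exact: Rhausdorff.
Qed.

Lemma sradonU A C : bounded_borel A -> bounded_borel C -> A `&` C = set0 ->
  d (A `|` C) = d A + d C.
Proof.
move=> bA bC AC; have [mAC bAC] := bounded_borelU bA bC.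
have := hd (F := bigcup2 A C).
rewrite bigcup2E => /(_ _ _ bAC).
case: bA bC => mA _ [mC _] c.
have {}c := c _ _.
have : (fun m => \sum_(k < m) d (bigcup2 A C k)) @ \oo --> d A + d C.
  apply: cvg_near_cst; exists 2%N => // m /= m2.
  rewrite -(subnKC m2) add2n big_ord_recl big_ord_recl /= addrA big1 ?addr0//.
  by move=> i _; rewrite sradon0.
move=> /(cvg_lim (@Rhausdorff R)) <-; apply/esym/(cvg_lim (@Rhausdorff R)).
apply: c; last by rewrite -trivIset_bigcup2.
by move=> [|[|k]] //=; exact: measurable0.
Qed.

Lemma sradonD A C : bounded_borel A -> measurable C -> C `<=` A ->
  d (A `\` C) = d A - d C.
Proof.
move=> bA mC CA.
have e : A = C `|` (A `\` C) by rewrite setDUK.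
have mA : measurable A by case: bA.
rewrite [in RHS]e sradonU; first by rewrite addrAC subrr add0r.
- exact: bounded_borelS CA.
- by apply: (bounded_borelS bA) => //; exact: measurableD.
- by rewrite setDIK.
Qed.

Lemma svar_ub A C : bounded_borel C -> C `<=` A -> ((d C)%:E <= svar d A)%E.
Proof. by move=> bC CA; apply: ereal_sup_ubound; exists C. Qed.

Lemma svar_ge0 A : (0 <= svar d A)%E.
Proof. by have := svar_ub bounded_borel0 (@sub0set _ A); rewrite sradon0. Qed.

Lemma svar0 : svar d set0 = 0%E.
Proof.
apply/eqP; rewrite eq_le svar_ge0 andbT; apply: ge_ereal_sup.
by move=> _ [C [_ C0] <-]; rewrite (subset0 C) in C0; rewrite C0 sradon0.
Qed.

Lemma svar_superadd A C : A `&` C = set0 ->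
  (svar d A + svar d C <= svar d (A `|` C))%E.
Proof.
move=> AC; case: (svar d (A `|` C)) (@svar_ub (A `|` C)) (svar_ge0 (A `|` C)) => [M| |] ub //= _; last by rewrite leey.
have h C1 C2 : bounded_borel C1 -> C1 `<=` A -> bounded_borel C2 -> C2 `<=` C -> d C1 + d C2 <= M.
  move=> b1 s1 b2 s2; rewrite -lee_fin -sradonU//.
    by apply: ub; [exact: bounded_borelU|exact: setUSS].
  by rewrite -subset0 -AC; exact: setISS.
have h2 C1 : bounded_borel C1 -> C1 `<=` A -> (svar d C <= (M - d C1)%:E)%E.
  move=> b1 s1; apply: ge_ereal_sup => _ [C2 [b2 s2] <-].
  by rewrite lee_fin lerBrDl h.
have := h2 _ bounded_borel0 (@sub0set _ _); rewrite sradon0 subr0 => CM.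
have Cf : svar d C \is a fin_num.
  by rewrite ge0_fin_numE ?svar_ge0//; apply: le_lt_trans CM (ltry _).
rewrite -leeBrDr//; apply: ge_ereal_sup => _ [C1 [b1 s1] <-].
rewrite -(fineK Cf) -EFinB lee_fin lerBrDr -lerBrDl -lee_fin fineK//.
exact: h2.
Qed.

(** One inequality is finite superadditivity. For the other, a competitor [C] is bounded, so [d C]
    is the sum of the values of [d] on the pieces of [C] in the [F k]. *)
Lemma svar_sigma_additive : semi_sigma_additive (svar d).
Proof.
move=> F mF tF mUF.
suff -> : svar d (\bigcup_k F k) = (\sum_(k <oo) svar d (F k))%E.
  by apply: is_cvg_nneseries => k _ _; exact: svar_ge0.
apply/eqP; rewrite eq_le; apply/andP; split; last first.
  apply: lime_le; first by apply: is_cvg_nneseries => k _ _; exact: svar_ge0.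
  apply: nearW => m; rewrite big_mkord.
  apply: (@le_trans _ _ (svar d (\big[setU/set0]_(k < m) F k))).
    elim: m => [|m IH]; first by rewrite !big_ord0 svar0.
    rewrite !big_ord_recr/=; apply: le_trans (svar_superadd _); first exact: leeD2r.
    by apply: (@trivIset_bigsetUI _ predT) => //; exact: sub_trivIset tF.
  apply: ge_ereal_sup => _ [C [bC CF] <-]; apply: svar_ub => //.
  by move=> x /CF; rewrite -bigcup_mkord => -[k _ Fx]; exists k.
apply: ge_ereal_sup => _ [C [[mC bC] CF] <-].
have CE : C = \bigcup_k (C `&` F k) by rewrite -setI_bigcupr; apply/esym/setIidl.
have mCF k : measurable (C `&` F k) by exact: measurableI.
have := hd mCF (@trivIset_setIl _ _ _ _ (fun=> C) tF).
rewrite -CE => /(_ bC) c.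
have cE : (fun m => (\sum_(k < m) d (C `&` F k))%:E) @ \oo --> (d C)%:E.
  by apply: cvg_EFin; [exact: nearW|exact: c].
apply: (cvge_to_le cE).
apply: nearW => m /=.
apply: (@le_trans _ _ (\sum_(0 <= k < m) svar d (F k))%E); last by apply: nneseries_lim_ge => k _ _; exact: svar_ge0.
rewrite big_mkord -sumEFin; apply: lee_sum => k _; apply: svar_ub; last exact: subIsetr.
by split; [exact: mCF|apply: bounded_setS bC; exact: subIsetl].
Qed.

End scalar.

End Variation.

Section Hahn.
Context {R : realType} {n : nat}.
Local Notation V := 'rV[R]_n.+1.
Local Notation B := (borelType R n).
Context (d : set B -> R) (hd : scalar_radon d).

(** The proof argument is a phantom: it provides a constant to which the measure instance, valid
    under [hd], can be attached. [rcharge] uses the same device. *)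
Definition svarm of scalar_radon d : set B -> \bar R := svar d.

HB.instance Definition _ := isMeasure.Build _ B R (svarm hd)
  (svar0 hd) (svar_ge0 hd) (svar_sigma_additive hd).

Lemma scalar_radonN : scalar_radon (fun C => - d C).
Proof.
move=> F mF tF bF; have c := hd mF tF bF.
have -> : (fun m => \sum_(k < m) - d (F k)) = - (fun m => \sum_(k < m) d (F k)).
  by apply/funext => m; rewrite fctE sumrN.
exact: cvgN.
Qed.

Section restrict.
Context (A : set B) (bA : bounded_borel A).

Definition rcharge of bounded_borel A : set B -> \bar R :=
  fun C => (if `[< measurable C >] then d (C `&` A) else 0)%:E.

Lemma rchargeE (C : set B) : measurable C -> rcharge bA C = (d (C `&` A))%:E.
Proof. by move=> mC; rewrite /rcharge; case: asboolP. Qed.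

Let rcharge0 : rcharge bA set0 = 0%E.
Proof. by rewrite rchargeE// set0I (sradon0 hd). Qed.

Let rcharge_fin : fin_num_fun (rcharge bA).
Proof. by []. Qed.

Let rcharge_sigma : semi_sigma_additive (rcharge bA).
Proof.
move=> F mF tF mUF; rewrite rchargeE// setI_bigcupl.
have mFA k : measurable (F k `&` A) by apply: measurableI => //; case: bA.
have c : (fun m => \sum_(k < m) d (F k `&` A)) @ \oo --> d (\bigcup_k (F k `&` A)).
  apply: hd => //; first exact: trivIset_setIr.
  by apply: bounded_setS bA.2; rewrite -setI_bigcupl; exact: subIsetr.
have -> : (fun m => (\sum_(0 <= i < m) rcharge bA (F i))%E) =
          (fun m => (\sum_(k < m) d (F k `&` A))%:E).
  apply/funext => m; rewrite big_mkord -sumEFin; apply: eq_bigr => i _.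
  by rewrite rchargeE.
by apply: cvg_EFin; [exact: nearW|exact: c].
Qed.

HB.instance Definition _ := isCharge.Build _ B R (rcharge bA)
  rcharge0 rcharge_fin rcharge_sigma.

(** Additivity of [d] is known on bounded sets only, so the Hahn theorem is applied to the
    restriction to [A]. The positive part maximises [d] among the measurable subsets of [A], and the
    rest of [A] minimises it. *)
Lemma hahn_piece : exists P : set B, [/\ measurable P, P `<=` A,
  (forall C, measurable C -> C `<=` A -> d C <= d P) &
  (forall C, measurable C -> C `<=` A -> d (A `\` P) <= d C)].
Proof.
have [P [N [[mP hP] [mN hN] PNT PN0]]] := Hahn_decomposition (rcharge bA).
have mA : measurable A by case: bA.
have bI C : measurable C -> bounded_borel (C `&` A).
  by move=> mC; apply: (bounded_borelS bA); [exact: measurableI|exact: subIsetr].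
have NE : N = ~` P.
  apply/seteqP; split => x; first by move=> Nx Px; have : (P `&` N) x by []; rewrite PN0.
  by move=> nPx; have [] : (P `|` N) x by rewrite PNT.
pose Q := A `\` (P `&` A).
have mQ : measurable Q by apply: measurableD => //; exact: measurableI.
have pos (E : set B) : measurable E -> E `<=` A -> E `<=` P -> 0 <= d E.
  move=> mE EA EP; have : (0 <= rcharge bA E)%E by exact: hP.
  by rewrite rchargeE// lee_fin (setIidl EA).
have neg (E : set B) : measurable E -> E `<=` A -> E `<=` ~` P -> d E <= 0.
  rewrite -NE => mE EA EN; have : (rcharge bA E <= 0)%E by exact: hN.
  by rewrite rchargeE// lee_fin (setIidl EA).
have le_diff (E F : set B) : measurable E -> measurable F -> E `<=` F -> F `<=` A ->
    d (F `\` E) = d F - d E.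
  by move=> mE mF EF FA; rewrite (sradonD hd)//; exact: bounded_borelS FA.
exists (P `&` A); split; [exact: measurableI|exact: subIsetr| |].
- move=> C mC CA.
  have mCP : measurable (C `&` P) by exact: measurableI.
  have mPA : measurable (P `&` A) by exact: measurableI.
  apply: (@le_trans _ _ (d (C `&` P))).
    rewrite -subr_le0 -le_diff => //.
    by apply: neg; [exact: measurableD|move=> x [/CA]|move=> x [Cx nCP] Px; apply: nCP].
  rewrite -subr_ge0 -le_diff => //; last by move=> x [/CA].
  by apply: pos; [exact: measurableD|move=> x [[]]|move=> x [[]]].
- move=> C mC CA.
  have mCQ : measurable (C `&` Q) by exact: measurableI.
  have QA : Q `<=` A by move=> x [].
  apply: (@le_trans _ _ (d (C `&` Q))).
    rewrite -subr_le0 -le_diff => //.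
    apply: neg; [exact: measurableD|by move=> x [/QA]|].
    by move=> x [[Ax nPA] _] Px; apply: nPA.
  rewrite -subr_ge0 -le_diff => //.
  apply: pos; [exact: measurableD|by move=> x [/CA]|].
  move=> x [Cx nCQ]; apply: contrapT => nPx; apply: nCQ; split => //.
  by split; [exact: CA|case].
Qed.
End restrict.

Lemma hahn_svar A : bounded_borel A -> exists P : set B,
  [/\ measurable P, P `<=` A, svar d A = (d P)%:E &
      svar (fun C => - d C) A = (- d (A `\` P))%:E].
Proof.
move=> bA; have [P [mP PA h1 h2]] := hahn_piece bA; exists P; split => //.
  apply/eqP; rewrite eq_le; apply/andP; split.
    by apply: ge_ereal_sup => _ [C [[mC _] CA] <-]; rewrite lee_fin h1.
  by apply: svar_ub => //; exact: bounded_borelS PA.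
have mA : measurable A by case: bA.
apply/eqP; rewrite eq_le; apply/andP; split.
  by apply: ge_ereal_sup => _ [C [[mC _] CA] <-]; rewrite lee_fin lerN2 h2.
apply: (@svar_ub _ _ (fun C => - d C)); last exact: subDsetl.
by apply: (bounded_borelS bA); [exact: measurableD|exact: subDsetl].
Qed.

Lemma svar_fin A : bounded_borel A -> svar d A \is a fin_num.
Proof. by move=> /hahn_svar[P [_ _ -> _]]. Qed.

Lemma svarN_fin A : bounded_borel A -> svar (fun C => - d C) A \is a fin_num.
Proof. by move=> /hahn_svar[P [_ _ _ ->]]. Qed.

Lemma jordan_sradon A : bounded_borel A ->
  d A = fine (svar d A) - fine (svar (fun C => - d C) A).
Proof.
move=> bA; have [P [mP PA -> ->]] := hahn_svar bA.
by rewrite /= opprK (sradonD hd)// addrC subrK.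
Qed.

End Hahn.

Section VectorVariation.
Context {R : realType} {n : nat}.
Local Notation V := 'rV[R]_n.+1.
Local Notation B := (borelType R n).
Context (D : set B -> V) (rD : vector_radon D).

Lemma comp_radon i : scalar_radon (fun C => D C 0 i).
Proof.
move=> F mF tF bF; have c := rD mF tF bF.
have -> : (fun m => \sum_(k < m) D (F k) 0 i) = (fun m => (\sum_(k < m) D (F k)) 0 i).
  by apply/funext => m; rewrite summxE.
exact: (cvg_comp _ (fun M : V => M 0 i) c (@coord_continuous _ _ _ 0 i _)).
Qed.

Arguments comp_radon : clear implicits.

Definition posm i : {measure set B -> \bar R} := svarm (comp_radon i).
Definition negm i : {measure set B -> \bar R} := svarm (@scalar_radonN _ _ _ (comp_radon i)).

(** A measure to be used in place of [total_var], whose additivity is not proved: it dominates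
    [total_var] and is at most N times as large on bounded Borel sets ([total_var_le], [mvar_le]).
    [msum] is indexed by naturals, hence [inord]. *)
Definition mvar : {measure set B -> \bar R} :=
  msum (fun k => measure_add (posm (inord k)) (negm (inord k))) n.+1.

Lemma mvarE A : mvar A = (\sum_i (posm i A + negm i A))%E.
Proof.
rewrite /mvar/= /msum; apply: eq_bigr => i _.
transitivity (measure_add (posm (inord i)) (negm (inord i)) A); first by [].
by rewrite measure_addE inord_val.
Qed.

Lemma posm_fin i A : bounded_borel A -> posm i A \is a fin_num.
Proof. exact: svar_fin (comp_radon i) _. Qed.

Lemma negm_fin i A : bounded_borel A -> negm i A \is a fin_num.
Proof. exact: svarN_fin (comp_radon i) _. Qed.

Lemma mvar_fin A : bounded_borel A -> mvar A \is a fin_num.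
Proof.
move=> bA; rewrite mvarE; apply/sum_fin_numP => i _ _.
by rewrite fin_numD posm_fin// negm_fin.
Qed.

Lemma jordan_coord i A : bounded_borel A ->
  D A 0 i = fine (posm i A) - fine (negm i A).
Proof. exact: jordan_sradon (comp_radon i) _. Qed.

Lemma coord_le_mvar i A : bounded_borel A ->
  (`|D A 0 i|%:E <= posm i A + negm i A)%E.
Proof.
move=> bA; rewrite jordan_coord//.
rewrite -(fineK (posm_fin i bA)) -(fineK (negm_fin i bA)) -EFinD lee_fin /=.
have : 0 <= fine (posm i A) by rewrite fine_ge0.
have : 0 <= fine (negm i A) by rewrite fine_ge0.
by move=> h1 h2; rewrite ler_norml; apply/andP; split; lra.
Qed.

Lemma enorm_le_mvar A : bounded_borel A -> ((enorm (D A))%:E <= mvar A)%E.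
Proof.
move=> bA; rewrite mvarE.
apply: (@le_trans _ _ (\sum_i `|D A 0 i|)%:E); first by rewrite lee_fin enorm_le_sum.
by rewrite -sumEFin; apply: lee_sum => i _; exact: coord_le_mvar.
Qed.

Lemma total_var_le A : measurable A -> (total_var D A <= mvar A)%E.
Proof.
move=> mA; apply: ge_ereal_sup => _ [F [bF tF FA] <-].
have mF k : measurable (F k) by have [] := bF k.
apply: (@le_trans _ _ (\sum_(k <oo) mvar (F k))%E).
  apply: lee_nneseries => [k _ _|k _]; first by rewrite lee_fin enorm_ge0.
  exact: enorm_le_mvar.
have := @measure_semi_bigcup _ _ _ mvar _ mF tF (bigcupT_measurable _ mF).
move=> <-; apply: le_measure => //; rewrite inE//.
exact: bigcupT_measurable.
Qed.

Lemma piece_le_total_var A P : bounded_borel A -> measurable P -> P `<=` A ->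
  ((enorm (D P) + enorm (D (A `\` P)))%:E <= total_var D A)%E.
Proof.
move=> bA mP PA.
have mA : measurable A by case: bA.
have bP : bounded_borel P by exact: bounded_borelS PA.
have bQ : bounded_borel (A `\` P).
  by apply: (bounded_borelS bA); [exact: measurableD|exact: subDsetl].
apply: (@le_trans _ _ (\sum_(k <oo) (enorm (D (bigcup2 P (A `\` P) k)))%:E)%E).
  apply: le_trans (nneseries_lim_ge 2 _); last by move=> k _ _; rewrite lee_fin enorm_ge0.
  by rewrite big_nat_recl// big_nat1.
apply: ereal_sup_ubound; exists (bigcup2 P (A `\` P)) => //; split.
- by move=> [|[|k]] //=; exact: bounded_borel0.
- by rewrite -trivIset_bigcup2 setDIK.
- by rewrite bigcup2E => x [/PA|[]].
Qed.

Lemma mvar_le A : bounded_borel A -> (mvar A <= n.+1%:R%:E * total_var D A)%E.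
Proof.
move=> bA; rewrite mvarE.
have h i : (posm i A + negm i A <= total_var D A)%E.
  (* On a Hahn partition of [A] for the i-th component, the two variations are the component of [D]
     on one piece and its opposite on the other; both are bounded by the norms of [D] on the
     pieces. *)
  have [P [mP PA h1 h2]] := hahn_svar (comp_radon i) bA.
  apply: le_trans (piece_le_total_var bA mP PA).
  rewrite [posm i A]h1 [negm i A]h2 -EFinD lee_fin.
  have := coord_le_enorm (D P) i; have := coord_le_enorm (D (A `\` P)) i.
  have := ler_norm (D P 0 i); have := ler_norm (- D (A `\` P) 0 i).
  rewrite normrN; lra.
apply: le_trans (lee_sum _ (fun i _ => h i)) _.
by rewrite mule_natl sumr_const card_ord.
Qed.

Lemma total_var_fin A : bounded_borel A -> total_var D A \is a fin_num.
Proof.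
move=> bA; rewrite ge0_fin_numE.
  apply: le_lt_trans (total_var_le _) _; first by case: bA.
  by rewrite -ge0_fin_numE ?mvar_fin.
apply: le_trans (piece_le_total_var bA measurable0 (@sub0set _ _)).
by rewrite lee_fin addr_ge0 ?enorm_ge0.
Qed.

End VectorVariation.

(** * The fractional divergence *)

Section Kernel.
Context {R : realType} {n : nat} (alpha : R).
Context (halpha : 0 < alpha < 1).
Local Notation V := 'rV[R]_n.+1.
Local Notation L := (lebesgueType R n).
Local Notation leb := (@lebesgueN R n).
Local Notation N := (n.+1%:R : R).

(* Up to a constant, [fkernel (y - x)] dominates the integrand of [frac_div f x]
   for [f] bounded and Lipschitz. *)
Definition fkernel (h : V) : R :=
  Num.min 1 (enorm h) * enorm h `^ (- (N + alpha)).

Let a0 : 0 < alpha. Proof. by case/andP: halpha. Qed.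
Let a1 : alpha < 1. Proof. by case/andP: halpha. Qed.
Let N1 : 1 <= N. Proof. by rewrite ler1n. Qed.

Lemma fkernel_ge0 h : 0 <= fkernel h.
Proof. by rewrite mulr_ge0 ?powR_ge0// le_min ler01 enorm_ge0. Qed.

Lemma measurable_enormB x : measurable_fun [set: L] (fun y : L => enorm ((y : V) - x)).
Proof.
apply: continuous_lebesgue_measurable => y.
apply: (@continuous_comp _ _ _ (fun y : V => y - x) (@enorm R n)); last exact: enorm_continuous.
by apply: continuousB; [exact: cvg_id|exact: cst_continuous].
Qed.

Lemma measurable_fkernel : measurable_fun [set: L] (fkernel : L -> R).
Proof.
have m := measurable_enormB 0.
have -> : fkernel = (fun y : L => Num.min 1 (enorm ((y : V) - 0)) * enorm ((y : V) - 0) `^ (- (N + alpha))).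
  by apply/funext => y; rewrite subr0.
apply: measurable_funM.
  by apply: measurable_minr => //; exact: measurable_cst.
by apply: measurableT_comp (measurable_powR _) m.
Qed.

Lemma dyadic_ex (u : R) : 1 <= u -> exists j : nat, 2 ^+ j <= u < 2 ^+ j.+1.
Proof.
move=> u1; have [k hk] : exists k, u < 2 ^+ k.
  exists (Num.truncn u).+1; apply: lt_le_trans (truncnS_gt u) _.
  by rewrite -natrX ler_nat ltnW// ltn_expl.
elim: k hk => [|k IH] hk; first by move: hk; rewrite expr0 ltNge u1.
have [/IH//|ku] := ltP u (2 ^+ k).
by exists k; rewrite ku.
Qed.

Let q1 : R := 2 `^ (N + alpha - 1).
Let q2 : R := 2 `^ (- (N + alpha)).

(** On 2^j <= |h| < 2^(j+1) the kernel |h|^-(N+alpha) is at most [q2 ^+ j]; on 2^-(j+1) < |h| <=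
    2^-j, where |h| < 1, the kernel |h|^(1-N-alpha) is at most [q1 ^+ j.+1]. *)
Lemma fkernel_dyadic h : fkernel h != 0 -> exists j : nat,
  fkernel h <= q1 ^+ j.+1 * \1_(cube (2 ^- j)) h + q2 ^+ j * \1_(cube (2 ^+ j.+1)) h.
Proof.
have [->|h0] := eqVneq h 0; first by rewrite /fkernel enorm0 min_r// mul0r eqxx.
have t0 : 0 < enorm h.
  rewrite lt_neqAle enorm_ge0 andbT eq_sym; apply/eqP => /enorm_eq0 e.
  by rewrite e eqxx in h0.
have q10 : 0 <= q1 by exact: powR_ge0.
have q20 : 0 <= q2 by exact: powR_ge0.
move=> _; rewrite /fkernel; have [t1|t1] := leP 1 (enorm h).
- have [j /andP[j1 j2]] := dyadic_ex t1; exists j; rewrite mul1r.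
  apply: (@le_trans _ _ (q2 ^+ j * \1_(cube (2 ^+ j.+1)) h)); last first.
    by rewrite lerDr mulr_ge0 ?exprn_ge0// indicE ler0n.
  rewrite indicE mem_set ?mulr1; last first.
    by apply: (le_trans (norm_le_enorm _)); exact: ltW.
  rewrite /q2 -powR_mulrn ?powR_ge0// -powRrM mulrC powRrM powR_mulrn//.
  rewrite !powRN lef_pV2 ?posrE ?powR_gt0 ?exprn_gt0//.
  by rewrite ge0_ler_powR ?nnegrE ?exprn_ge0 ?addr_ge0 ?enorm_ge0// ltW.
- have ti : 1 <= (enorm h)^-1 by rewrite invf_ge1// ltW.
  have [j /andP[j1 j2]] := dyadic_ex ti; exists j.
  apply: (@le_trans _ _ (q1 ^+ j.+1 * \1_(cube (2 ^- j)) h)); last first.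
    by rewrite lerDl mulr_ge0 ?exprn_ge0// indicE ler0n.
  rewrite indicE mem_set ?mulr1; last first.
    apply: (le_trans (norm_le_enorm _)).
    by rewrite -[enorm h]invrK lef_pV2 ?posrE ?invr_gt0 ?exprn_gt0.
  rewrite -{1}(powRr1 (enorm_ge0 h)) -powRD; last by apply/implyP => _; rewrite lt0r_neq0.
  rewrite /q1 -powR_mulrn ?powR_ge0// -powRrM mulrC powRrM powR_mulrn//.
  have -> : 1 + - (N + alpha) = - (N + alpha - 1) by ring.
  rewrite powRN -powR_inv1 ?powR_ge0// powRAC powR_inv1 ?enorm_ge0//.
  have p0 : 0 <= N + alpha - 1 by move: a0 N1; lra.
  by rewrite ge0_ler_powR ?nnegrE ?exprn_ge0 ?invr_ge0 ?enorm_ge0// ltW.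
Qed.

Lemma outer_cube_scale (m : R) : 0 < m ->
  lebesgue_outer (cube m : set V) = ((m ^+ n.+1)%:E * lebesgue_outer (cube 1 : set V))%E.
Proof.
move=> m0; have mi : 0 < m^-1 by rewrite invr_gt0.
have := outer_aff 0 (cube 1 : set V) mi; rewrite exprVn invrK => <-.
congr lebesgue_outer; apply/seteqP; split => x; rewrite /cube/aff/= add0r normrZ gtr0_norm//.
  by rewrite ler_pdivrMl// mulr1.
by rewrite ler_pdivrMl// mulr1.
Qed.

Lemma powR2_gt1 (s : R) : 0 < s -> 1 < (2 : R) `^ s.
Proof.
move=> s0; have := gt0_ltr_powR s0 (x := 1) (y := 2).
by rewrite powR1; apply; rewrite ?nnegrE ?ltr1n.
Qed.

Lemma geometric_bound (q C : R) (m : nat) : 0 <= q < 1 -> 0 <= C ->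
  \sum_(0 <= k < m) C * q ^+ k <= C / (1 - q).
Proof.
move=> /andP[q0 q11] C0; have d : 0 < 1 - q by lra.
rewrite -big_distrr/= ler_wpM2l// -div1r ler_pdivlMr//.
have -> : (\sum_(0 <= k < m) q ^+ k) * (1 - q) = 1 - q ^+ m.
  elim: m => [|m IH]; first by rewrite big_nil mul0r expr0 subrr.
  by rewrite big_nat_recr//= mulrDl IH exprS; ring.
by rewrite lerBlDr lerDl exprn_ge0.
Qed.

Lemma geometric_fin (q C : R) : 0 <= q < 1 -> 0 <= C ->
  (\sum_(k <oo) (C * q ^+ k)%:E < +oo)%E.
Proof.
move=> hq C0; apply: (@le_lt_trans _ _ (C / (1 - q))%:E); last exact: ltry.
have q0 : 0 <= q by case/andP: hq.
apply: lime_le.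
  by apply: is_cvg_nneseries => k _ _; rewrite lee_fin mulr_ge0// exprn_ge0.
by apply: nearW => m; rewrite sumEFin lee_fin geometric_bound.
Qed.

(** The dyadic bounds sum to geometric series of ratio 2^(alpha-1) near the origin and 2^-alpha at
    infinity; the bounds alpha < 1 and alpha > 0 make them converge. *)
Lemma integral_fkernel_fin : (\int[leb]_h (fkernel h)%:E < +oo)%E.
Proof.
pose a j (h : V) : \bar R := (q1 ^+ j.+1 * \1_(cube (2 ^- j)) h)%:E.
pose b j (h : V) : \bar R := (q2 ^+ j * \1_(cube (2 ^+ j.+1)) h)%:E.
have q10 : 0 <= q1 by exact: powR_ge0.
have q20 : 0 <= q2 by exact: powR_ge0.
have ca0 j h : (0 <= a j h)%E by rewrite lee_fin mulr_ge0 ?exprn_ge0// indicE ler0n.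
have cb0 j h : (0 <= b j h)%E by rewrite lee_fin mulr_ge0 ?exprn_ge0// indicE ler0n.
have mind (m : R) : measurable_fun [set: L] (\1_(cube m) : L -> R).
  by apply: measurable_indic; exact: measurable_cube.
have ma j : measurable_fun [set: L] (a j : L -> \bar R).
  by apply/measurable_EFinP; apply: measurable_funM => //; exact: measurable_cst.
have mb j : measurable_fun [set: L] (b j : L -> \bar R).
  by apply/measurable_EFinP; apply: measurable_funM => //; exact: measurable_cst.
have c1f : lebesgue_outer (cube 1 : set V) \is a fin_num.
  by rewrite ge0_fin_numE ?lebesgue_outer_ge0//; exact: (outer_cube_fin (@subset_refl _ _)).
pose c1 := fine (lebesgue_outer (cube 1 : set V)).
have c10 : 0 <= c1 by rewrite fine_ge0// lebesgue_outer_ge0.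
have Ind (C m : R) : 0 <= C -> 0 < m ->
    (\int[leb]_h (C * \1_(cube m) h)%:E = (C * m ^+ n.+1 * c1)%:E)%E.
  move=> C0 m0; under eq_integral => h _ do rewrite EFinM.
  rewrite ge0_integralZl; [|exact: measurableT|by apply/measurable_EFinP; exact: mind|by move=> h _; rewrite lee_fin indicE ler0n|by []].
  rewrite integral_indic//; last exact: measurable_cube.
  rewrite setIT; transitivity (C%:E * lebesgue_outer (cube m : set V))%E => //.
  by rewrite outer_cube_scale// -(fineK c1f) -!EFinM mulrA.
pose g (h : V) : \bar R := (\sum_(j <oo) (a j h + b j h)%E)%E.
have gfin : (\int[leb]_h g h < +oo)%E; last first.
  apply: (le_lt_trans _ gfin).
  apply: ge0_le_integral; [exact: measurableT|..].
  - by move=> h _; rewrite lee_fin fkernel_ge0.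
  - exact/measurable_EFinP/measurable_fkernel.
  - apply: (ge0_emeasurable_sum (P := xpredT)) => [j h _ _|j _]; first exact: adde_ge0.
    by apply: emeasurable_funD.
  - move=> h _; have [->|/fkernel_dyadic[j hj]] := eqVneq (fkernel h) 0.
      by apply: nneseries_ge0 => j _ _; exact: adde_ge0.
    apply: (@le_trans _ _ (a j h + b j h)%E); first by rewrite -EFinD lee_fin.
    apply: le_trans (nneseries_lim_ge j.+1 _); last by move=> k _ _; exact: adde_ge0.
    by rewrite big_nat_recr//= leeDr// sume_ge0// => i _; exact: adde_ge0.
have IE j : (\int[leb]_h (a j h + b j h) =
    (q1 ^+ j.+1 * 2 ^- j ^+ n.+1 * c1)%:E + (q2 ^+ j * 2 ^+ j.+1 ^+ n.+1 * c1)%:E)%E.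
  rewrite ge0_integralD; [|exact: measurableT|by move=> h _|exact: ma|by move=> h _|exact: mb].
  by rewrite Ind ?exprn_ge0 ?invr_gt0 ?exprn_gt0// Ind ?exprn_ge0 ?exprn_gt0.
have -> : (\int[leb]_h g h = \sum_(j <oo) ((q1 ^+ j.+1 * 2 ^- j ^+ n.+1 * c1)%:E
    + (q2 ^+ j * 2 ^+ j.+1 ^+ n.+1 * c1)%:E))%E.
  rewrite /g integral_nneseries; [|exact: measurableT|by move=> j; exact: emeasurable_funD|by move=> j h _; exact: adde_ge0].
  by apply: eq_eseriesr => j _; exact: IE.
rewrite nneseriesD; last 2 first.
- by move=> j _ _; rewrite lee_fin !mulr_ge0 ?exprn_ge0 ?invr_ge0 ?exprn_ge0.
- by move=> j _ _; rewrite lee_fin !mulr_ge0 ?exprn_ge0.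
apply: lte_add_pinfty.
  have e j : q1 ^+ j.+1 * 2 ^- j ^+ n.+1 * c1 = (q1 * c1) * (q1 / 2 ^+ n.+1) ^+ j.
    rewrite exprMn exprVn -!exprM -exprVn mulnC exprS -!exprVn exprM; ring.
  under eq_eseriesr => j _ do rewrite e.
  apply: geometric_fin; last exact: mulr_ge0.
  rewrite divr_ge0 ?exprn_ge0//= ltr_pdivrMr ?exprn_gt0// mul1r.
  have -> : (2 : R) ^+ n.+1 = q1 * 2 `^ (1 - alpha).
    rewrite /q1 -powRD; last by rewrite pnatr_eq0 implybT.
    by rewrite -powR_mulrn//; congr (_ `^ _); ring.
  rewrite ltr_pMr ?powR_gt0//; apply: powR2_gt1; move: a1; lra.
have e j : q2 ^+ j * 2 ^+ j.+1 ^+ n.+1 * c1 = (2 ^+ n.+1 * c1) * (q2 * 2 ^+ n.+1) ^+ j.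
  by rewrite exprMn -!exprM mulSn exprD mulnC; ring.
under eq_eseriesr => j _ do rewrite e.
apply: geometric_fin; last by rewrite mulr_ge0// exprn_ge0.
rewrite mulr_ge0 ?exprn_ge0//= /q2 powRN mulrC ltr_pdivrMr ?powR_gt0// mul1r.
rewrite powRD; last by rewrite pnatr_eq0 implybT.
by rewrite powR_mulrn// ltr_pMr ?exprn_gt0// powR2_gt1.
Qed.

End Kernel.

(** * Dominated integrals *)

Section Dominated.
Context d (T : measurableType d) (R : realType) (mu : {measure set T -> \bar R}).
Implicit Types (f g k : T -> R).

Lemma dominated_integrableT f k : measurable_fun setT f ->
  mu.-integrable setT (EFin \o k) -> (forall x, `|f x| <= k x) ->
  mu.-integrable setT (EFin \o f).
Proof.
move=> mf ik fk; apply: (le_integrable measurableT _ _ ik).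
  exact/measurable_EFinP.
by move=> x _ /=; rewrite lee_fin (le_trans (fk x))// ler_norm.
Qed.

Lemma Rintegral_dominated f k : measurable_fun setT f ->
  mu.-integrable setT (EFin \o k) -> (forall x, `|f x| <= k x) ->
  `|\int[mu]_x f x| <= \int[mu]_x k x.
Proof.
move=> mf ik fk; have if_ := dominated_integrableT mf ik fk.
apply: (le_trans (le_normr_Rintegral measurableT if_)).
apply: le_Rintegral => //.
by apply: (dominated_integrableT _ ik) => [|x]; [exact: measurableT_comp|rewrite normr_id].
Qed.

Lemma RintegralB_T f g : mu.-integrable setT (EFin \o f) ->
  mu.-integrable setT (EFin \o g) ->
  \int[mu]_x (f x - g x) = \int[mu]_x f x - \int[mu]_x g x.
Proof. by move=> fi gi; exact: RintegralB. Qed.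

Lemma integrableZT f (c : R) : mu.-integrable setT (EFin \o f) ->
  mu.-integrable setT (EFin \o (fun x => c * f x)).
Proof. by move=> fi; exact: (integrableZl measurableT c fi). Qed.

Lemma integrable_ge0 f : measurable_fun setT f -> (forall x, 0 <= f x) ->
  (\int[mu]_x (f x)%:E < +oo)%E -> mu.-integrable setT (EFin \o f).
Proof.
move=> mf f0 foo; apply/integrableP; split; first exact/measurable_EFinP.
by under eq_integral => x _ do rewrite /= ger0_norm//.
Qed.

Lemma dominated_cvg_Rintegral (f_ : nat -> T -> R) f k :
  (forall m, measurable_fun setT (f_ m)) -> measurable_fun setT f ->
  (forall x, (fun m => f_ m x) @ \oo --> f x) ->
  mu.-integrable setT (EFin \o k) -> (forall m x, `|f_ m x| <= k x) ->
  (fun m => \int[mu]_x f_ m x) @ \oo --> \int[mu]_x f x.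
Proof.
move=> mf_ mf cf ik fk.
have fk' x : `|f x| <= k x.
  apply: (cvgr_to_le (cvg_norm (cf x))).
  by apply: nearW => m; exact: fk.
have mE_ m : measurable_fun setT (EFin \o f_ m) by exact/measurable_EFinP.
have cE x : setT x -> (fun m => (EFin \o f_ m) x) @ \oo --> (EFin \o f) x.
  by move=> _; apply: cvg_EFin; [exact: nearW|exact: cf].
have finE x : setT x -> (EFin \o k) x \is a fin_num by [].
have leE m x : setT x -> (`|(EFin \o f_ m) x| <= (EFin \o k) x)%E.
  by move=> _ /=; rewrite lee_fin.
have h := @dominated_cvg _ _ _ mu setT measurableT (fun m => EFin \o f_ m) (EFin \o f)
  (EFin \o k) mE_ cE finE ik leE.
apply: fine_cvg; rewrite fineK; first exact: h.
exact: integrable_fin_num (dominated_integrableT mf ik fk').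
Qed.

(** Meant for the divergence of a field and growing cubes [S m]: this is how the nonlocal part of a
    pairing is made small. *)
Lemma integral_tail (S : nat -> set T) f : (forall m, measurable (S m)) ->
  (forall x, \forall m \near \oo, S m x) -> mu.-integrable setT (EFin \o f) ->
  (fun m => \int[mu]_x (\1_(~` S m) x * `|f x|)) @ \oo --> (0 : R).
Proof.
move=> mS Sx fi; have mf : measurable_fun setT f.
  by case/integrableP: fi => /measurable_EFinP.
have ni : mu.-integrable setT (EFin \o (fun x => `|f x|)).
  by apply: (dominated_integrableT _ (integrable_abse fi)) => [|x]; [exact: measurableT_comp|rewrite normr_id].
have := @dominated_cvg_Rintegral (fun m x => \1_(~` S m) x * `|f x|) (fun=> 0) (fun x => `|f x|).
rewrite Rintegral_cst// mul0r; apply => //.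
- move=> m; apply: measurable_funM; first exact/measurable_indic/measurableC.
  exact: measurableT_comp.
- move=> x; apply: cvg_near_cst; apply: filterS (Sx x) => m Smx.
  by rewrite indicE memNset ?mul0r//=; apply.
- move=> m x; rewrite indicE normrM normr_id ger0_norm ?ler0n//.
  by rewrite ler_piMl//; case: (_ \in _).
Qed.

End Dominated.

(** * Size, continuity and decay of the fractional divergence *)

Section FracDiv.
Context {R : realType} {n : nat} (c alpha : R).
Context (halpha : 0 < alpha < 1) (hc : 0 < c).
Local Notation V := 'rV[R]_n.+1.
Local Notation L := (lebesgueType R n).
Local Notation leb := (@lebesgueN R n).
Local Notation N := (n.+1%:R : R).
Local Notation fkernel := (@fkernel R n alpha).

Let a0 : 0 < alpha. Proof. by case/andP: halpha. Qed.
Let a1 : alpha < 1. Proof. by case/andP: halpha. Qed.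

Definition kint : R := \int[leb]_h fkernel h.

Lemma kint_ge0 : 0 <= kint.
Proof. by apply: Rintegral_ge0 => h _; exact: fkernel_ge0. Qed.

Lemma integrable_fkernel : leb.-integrable setT (EFin \o fkernel).
Proof.
apply: integrable_ge0; [exact: measurable_fkernel|exact: fkernel_ge0|].
exact: integral_fkernel_fin.
Qed.

Lemma integrable_aff (k : V -> R) x r : 0 < r ->
  leb.-integrable setT (EFin \o k) ->
  leb.-integrable setT (EFin \o (fun y => k (aff x r y))).
Proof.
move=> r0 /integrableP[mk kfin]; apply/integrableP; split.
  exact: measurableT_comp mk (measurable_fun_aff x r0).
have m : measurable_fun [set: L] (fun y : L => `|(k y)%:E|%E).
  exact: (measurableT_comp (@abse_measurable R setT) mk).
have e := @ge0_integral_aff _ _ x r (fun y => `|(k y)%:E|%E) r0 m (fun y => abse_ge0 _).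
apply: (eq_ind_r (fun z => (z < +oo)%E) _ e).
apply: lte_mul_pinfty; last exact: kfin.
- by rewrite lee_fin invr_ge0 exprn_ge0// ltW.
- by [].
Qed.

(** Quantitative Lip_c: Lipschitz constant, bound and radius of the support are explicit so that
    they can be followed through rescalings. *)
Definition lipf (f : V -> V) (l M rho : R) : Prop :=
  [/\ 0 <= l, 0 <= M & forall x y, [/\ enorm (f x - f y) <= l * enorm (x - y),
    enorm (f x) <= M & f x != 0 -> enorm x <= rho]].

Definition fd_integrand (f : V -> V) (x y : V) : R :=
  edot (f y - f x) (y - x) / enorm (y - x) `^ (N + alpha + 1).

Lemma lipf_continuous f l M rho : lipf f l M rho -> continuous f.
Proof.
move=> [l0 M0 hf] x A /nbhs_ballP[e /= e0 eA]; apply/nbhs_ballP.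
exists (e / ((l + 1) * N)) => /=; first by rewrite divr_gt0// mulr_gt0//; lra.
move=> y; rewrite -ball_normE/= ltr_pdivlMr ?mulr_gt0//; last by lra.
move=> xy; apply: eA; rewrite -ball_normE/=.
apply: (le_lt_trans (norm_le_enorm _)).
have [h _ _] := hf x y; apply: (le_lt_trans h).
apply: le_lt_trans xy; rewrite [leRHS]mulrC -mulrA.
apply: ler_pM => //; [exact: enorm_ge0|lra|exact: enorm_le_norm].
Qed.

Lemma continuous_edot (f g : V -> V) : continuous f -> continuous g ->
  continuous (fun y => edot (f y) (g y)).
Proof.
move=> cf cg.
rewrite (_ : (fun y => _) = \sum_i (fun y => f y 0 i * g y 0 i)).
  apply: (@big_ind _ (fun h : V -> R => continuous h)).
  - by move=> x; exact: cst_continuous.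
  - by move=> h1 h2 c1 c2 x; apply: continuousD; [exact: c1|exact: c2].
  - move=> i _ x; apply: continuousM.
      by apply: (@continuous_comp _ _ _ f (fun M : V => M 0 i)); [exact: cf|exact: coord_continuous].
    by apply: (@continuous_comp _ _ _ g (fun M : V => M 0 i)); [exact: cg|exact: coord_continuous].
by apply/funext => y; rewrite fct_sumE.
Qed.

Lemma measurable_fd_integrand f l M rho x : lipf f l M rho ->
  measurable_fun [set: L] (fd_integrand f x : L -> R).
Proof.
move=> /lipf_continuous cf.
rewrite (_ : fd_integrand f x = fun y => edot (f y - f x) (y - x) * (enorm (y - x) `^ (- (N + alpha + 1)))).
  apply: measurable_funM.
    apply: continuous_lebesgue_measurable; apply: continuous_edot => y.
      by apply: continuousB; [exact: cf|exact: cst_continuous].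
    by apply: continuousB; [exact: cvg_id|exact: cst_continuous].
  by apply: measurableT_comp (measurable_powR _) (measurable_enormB x).
by apply/funext => y; rewrite powRN.
Qed.

(** At [t = 0] both sides are 0, so the diagonal of the integrand needs no separate treatment. *)
Lemma powR_shift (t : R) : 0 <= t -> t / t `^ (N + alpha + 1) = t `^ (- (N + alpha)).
Proof.
move=> t0; have [->|tn] := eqVneq t 0.
  by rewrite mul0r powR0// oppr_eq0; apply/lt0r_neq0; rewrite addr_gt0.
rewrite -[X in X / _](powRr1 t0) -powRB; last by apply/implyP.
by congr (_ `^ _); ring.
Qed.

Lemma fd_integrand_le f x y : `|fd_integrand f x y| <=
  enorm (f y - f x) * enorm (y - x) `^ (- (N + alpha)).
Proof.
rewrite /fd_integrand normrM normfV [`|_ `^ _|]ger0_norm ?powR_ge0//.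
rewrite -powR_shift ?enorm_ge0// mulrA ler_wpM2r ?invr_ge0 ?powR_ge0//.
exact: edot_norm_le.
Qed.

Lemma lip_min f l M rho x y : lipf f l M rho ->
  enorm (f y - f x) <= (l + 2 * M) * Num.min 1 (enorm (y - x)).
Proof.
move=> [l0 M0 hf]; have [h1 h2 _] := hf y x; have [_ h3 _] := hf x y.
have h4 : enorm (f y - f x) <= 2 * M.
  by apply: (le_trans (enormD _ _)); rewrite enormN; lra.
have := enorm_ge0 (y - x).
by case: (leP 1 (enorm (y - x))) => h e0; nra.
Qed.

Lemma fd_integrand_fkernel f l M rho x y : lipf f l M rho ->
  `|fd_integrand f x y| <= (l + 2 * M) * fkernel (y - x).
Proof.
move=> lf; apply: (le_trans (fd_integrand_le _ _ _)).
by rewrite /fkernel mulrA ler_wpM2r ?powR_ge0// (lip_min _ _ lf).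
Qed.

Lemma affN1 x (y : V) : aff (- x) 1 y = y - x.
Proof. by rewrite /aff scale1r addrC. Qed.

Lemma integrable_fkernelB x : leb.-integrable setT (EFin \o (fun y => fkernel (y - x))).
Proof.
have -> : (fun y => fkernel (y - x)) = (fun y => fkernel (aff (- x) 1 y)).
  by apply/funext => y; rewrite affN1.
exact: integrable_aff ltr01 integrable_fkernel.
Qed.

Lemma Rintegral_shift x (k : V -> R) : measurable_fun [set: L] (k : L -> R) ->
  \int[leb]_y k (y - x) = \int[leb]_y k y.
Proof.
move=> mk; have := Rintegral_aff (- x) ltr01 mk; rewrite expr1n invr1 mul1r => <-.
by apply: eq_Rintegral => y _; rewrite affN1.
Qed.

Lemma integrable_fd f l M rho x : lipf f l M rho ->
  leb.-integrable setT (EFin \o fd_integrand f x).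
Proof.
move=> lf; exact: (dominated_integrableT (measurable_fd_integrand x lf)
  (integrableZT (l + 2 * M) (integrable_fkernelB x))
  (fun y => fd_integrand_fkernel x y lf)).
Qed.

Lemma frac_divE f x : frac_div c alpha f x = c * \int[leb]_y fd_integrand f x y.
Proof. by []. Qed.

Lemma frac_div_bound f l M rho x : lipf f l M rho ->
  `|frac_div c alpha f x| <= c * ((l + 2 * M) * kint).
Proof.
move=> lf; rewrite frac_divE normrM gtr0_norm// (ler_wpM2l (ltW hc))//.
have ik := integrable_fkernelB x.
have h := Rintegral_dominated (measurable_fd_integrand x lf)
  (integrableZT (l + 2 * M) ik) (fun y => fd_integrand_fkernel x y lf).
apply: (le_trans h).
rewrite RintegralZl; [|exact: measurableT|exact: ik].
by rewrite (Rintegral_shift x (measurable_fkernel alpha)).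
Qed.

(** The integrand in the variable h = y - x: at two different points the kernel is the same, and the
    integrands can be subtracted. *)
Definition fd_shift (f : V -> V) (x h : V) : R :=
  edot (f (x + h) - f x) h / enorm h `^ (N + alpha + 1).

Lemma fd_shiftE f x h : fd_shift f x h = fd_integrand f x (aff x 1 h).
Proof. by rewrite /fd_integrand /aff scale1r [x + h - x]addrAC subrr add0r. Qed.

Lemma integrable_fd_shift f l M rho x : lipf f l M rho ->
  leb.-integrable setT (EFin \o fd_shift f x).
Proof.
move=> lf; have -> : fd_shift f x = (fun h => fd_integrand f x (aff x 1 h)).
  by apply/funext => h; rewrite fd_shiftE.
exact: integrable_aff ltr01 (integrable_fd x lf).
Qed.

Lemma frac_div_shiftE f l M rho x : lipf f l M rho ->
  frac_div c alpha f x = c * \int[leb]_h fd_shift f x h.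
Proof.
move=> lf; rewrite frac_divE; apply: (congr1 (fun z => c * z)).
have e := Rintegral_aff x ltr01 (measurable_fd_integrand x lf).
rewrite expr1n invr1 mul1r in e; rewrite -e.
by apply: eq_Rintegral => h _; rewrite fd_shiftE.
Qed.

(** With delta = |x - x'|, the double difference of [f] is at most 2 l delta and at most 2 l |h|,
    hence at most 2 l delta min(1, |h|/delta), which is the numerator of a rescaled [fkernel]. *)
Lemma fd_shift_diff f l M rho x x' h : lipf f l M rho -> 0 < enorm (x - x') ->
  `|fd_shift f x h - fd_shift f x' h| <=
  2 * l * (enorm (x - x') * enorm (x - x') `^ (- (N + alpha))) *
  fkernel (aff 0 (enorm (x - x'))^-1 h).
Proof.
move=> lf d0; have [l0 M0 hf] := lf.
rewrite /fd_shift -mulrBl -edotBl normrM normfV [`|_ `^ _|]ger0_norm ?powR_ge0//.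
apply: (@le_trans _ _ (2 * l * Num.min (enorm (x - x')) (enorm h) * enorm h `^ (- (N + alpha)))).
  rewrite -powR_shift ?enorm_ge0// mulrA ler_wpM2r ?invr_ge0 ?powR_ge0//.
  apply: (le_trans (edot_norm_le _ _)); rewrite ler_wpM2r ?enorm_ge0//.
  have [h1 _ _] := hf (x + h) (x' + h); have [h2 _ _] := hf x x'.
  have [h3 _ _] := hf (x + h) x; have [h4 _ _] := hf (x' + h) x'.
  move: h1 h3 h4; rewrite opprD addrACA subrr addr0.
  rewrite [x + h - x]addrAC subrr add0r [x' + h - x']addrAC subrr add0r => h1 h3 h4.
  have e1 : f (x + h) - f x - (f (x' + h) - f x') = (f (x + h) - f (x' + h)) - (f x - f x').
    by rewrite !opprB addrACA [- f x + _]addrC addrACA.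
  case: (leP (enorm (x - x')) (enorm h)) => _.
    by rewrite e1; apply: (le_trans (enormD _ _)); rewrite enormN; lra.
  by apply: (le_trans (enormD _ _)); rewrite enormN; lra.
rewrite -!mulrA ler_pM2l// ler_wpM2l// /fkernel /aff add0r enormZ.
rewrite gtr0_norm ?invr_gt0// powRM ?invr_ge0 ?enorm_ge0//.
have dV : (enorm (x - x'))^-1 `^ (- (N + alpha)) * enorm (x - x') `^ (- (N + alpha)) = 1.
  by rewrite -powRM ?invr_ge0 ?enorm_ge0// mulVf ?lt0r_neq0// powR1.
set D := enorm (x - x'); set t := enorm h; set a := D `^ _; set b := t `^ _.
set e := D^-1 `^ _.
have -> : D * (a * (Num.min 1 (D^-1 * t) * (e * b))) = D * Num.min 1 (D^-1 * t) * b * (e * a) by ring.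
by rewrite dV mulr1 minr_pMr ?(ltW d0)// mulr1 mulrA mulfV ?lt0r_neq0// mul1r.
Qed.

(** Substituting h = delta h' in the previous bound gives delta delta^-(N+alpha) delta^N =
    delta^(1-alpha). The purpose is continuity, hence measurability, of the divergence. *)
Lemma frac_div_holder f l M rho x x' : lipf f l M rho ->
  `|frac_div c alpha f x - frac_div c alpha f x'| <=
  2 * c * l * kint * enorm (x - x') `^ (1 - alpha).
Proof.
move=> lf; have [l0 M0 hf] := lf.
have [e0|d0] := eqVneq (enorm (x - x')) 0.
  move/enorm_eq0/eqP : e0; rewrite subr_eq0 => /eqP ->.
  by rewrite subrr normr0 !mulr_ge0 ?powR_ge0 ?kint_ge0// ltW.
have dp : 0 < enorm (x - x') by rewrite lt_neqAle eq_sym d0 enorm_ge0.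
rewrite !(frac_div_shiftE _ lf) -mulrBr normrM gtr0_norm//.
have i1 := integrable_fd_shift x lf; have i2 := integrable_fd_shift x' lf.
rewrite -RintegralB_T//.
have dvp : 0 < (enorm (x - x'))^-1 by rewrite invr_gt0.
have ik := integrable_aff 0 dvp integrable_fkernel.
have mD : measurable_fun [set: L] ((fun h => fd_shift f x h - fd_shift f x' h) : L -> R).
  apply: measurable_funB.
    by have /integrableP[/measurable_EFinP] := i1.
  by have /integrableP[/measurable_EFinP] := i2.
have B := Rintegral_dominated mD (integrableZT (2 * l * (enorm (x - x') * enorm (x - x') `^ (- (N + alpha)))) ik)
  (fun h => fd_shift_diff h lf dp).
have -> : 2 * c * l * kint * enorm (x - x') `^ (1 - alpha) =
  c * (2 * l * kint * enorm (x - x') `^ (1 - alpha)) by ring.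
rewrite (ler_wpM2l (ltW hc))// (le_trans B)//.
rewrite RintegralZl; [|exact: measurableT|exact: ik].
rewrite (Rintegral_aff 0 dvp (measurable_fkernel alpha)) -/kint exprVn invrK.
set D := enorm (x - x') in dp *.
have -> : D `^ (1 - alpha) = D * D `^ (- (N + alpha)) * D ^+ n.+1.
  rewrite -{2}(powRr1 (ltW dp)) -powR_mulrn ?(ltW dp)// -!powRD; last 2 first.
  - by rewrite lt0r_neq0// implybT.
  - by rewrite lt0r_neq0// implybT.
  by congr (_ `^ _); ring.
by rewrite le_eqVlt; apply/orP; left; apply/eqP; ring.
Qed.

Lemma frac_div_continuous f l M rho : lipf f l M rho ->
  continuous (frac_div c alpha f).
Proof.
move=> lf; have [l0 M0 hf] := lf.
have K0 : 0 <= 2 * c * l * kint by rewrite !mulr_ge0 ?kint_ge0// ltW.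
have s0 : 0 < 1 - alpha by move: a1; lra.
move=> x A /nbhs_ballP[e /= e0 eA]; apply/nbhs_ballP.
pose d := (e / (2 * c * l * kint + 1)) `^ (1 - alpha)^-1.
have ek0 : 0 < e / (2 * c * l * kint + 1) by rewrite divr_gt0//; lra.
have d0 : 0 < d by rewrite powR_gt0.
exists (d / N) => /=; first by rewrite divr_gt0.
move=> y /ball_sub_eball; rewrite /eball/= enorm_distC => xy.
apply: eA; rewrite -ball_normE/=.
apply: (le_lt_trans (frac_div_holder _ _ lf)).
have h : enorm (x - y) `^ (1 - alpha) < e / (2 * c * l * kint + 1).
  have -> : e / (2 * c * l * kint + 1) = d `^ (1 - alpha).
    by rewrite /d -powRrM mulVf ?lt0r_neq0// powRr1// ltW.
  by apply: gt0_ltr_powR => //; rewrite nnegrE ?enorm_ge0// ltW.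
move: h; rewrite ltr_pdivlMr; last lra.
have := powR_ge0 (enorm (x - y)) (1 - alpha); nra.
Qed.

(** Here [f x = 0], and |y - x| >= |x|/2 on the support of [f]; so the kernel is at most 2^(N+alpha)
    |x|^-(N+alpha), integrated over a cube containing the support. Since |x| >= 1, [fkernel x] is
    exactly this power of |x|. *)
Lemma frac_div_decay f l M rho x : lipf f l M rho -> 1 <= rho ->
  2 * rho <= enorm x -> `|frac_div c alpha f x| <=
  c * (M * 2 `^ (N + alpha) * fine (leb (cube rho))) * fkernel x.
Proof.
move=> lf r1 xr; have [l0 M0 hf] := lf.
have fx0 : f x = 0.
  apply/eqP; apply: contrapT => /negP fx.
  by have [_ _ /(_ fx)] := hf x x; lra.
have s0 : 0 <= N + alpha by rewrite addr_ge0// ltW.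
have x1 : 1 <= enorm x by lra.
have kx : fkernel x = enorm x `^ (- (N + alpha)) by rewrite /fkernel min_l// mul1r.
rewrite frac_divE normrM gtr0_norm// -mulrA (ler_wpM2l (ltW hc))//.
pose k (y : V) : R := M * 2 `^ (N + alpha) * fkernel x * \1_(cube rho) y.
have mc : measurable (cube rho : set L) by exact: measurable_cube.
have cfin : (leb (cube rho) < +oo)%E by exact: (outer_cube_fin (@subset_refl _ _)).
have ii : leb.-integrable setT (EFin \o (\1_(cube rho) : L -> R)).
  apply: integrable_ge0; first exact: measurable_indic.
    by move=> y; rewrite indicE ler0n.
  by rewrite integral_indic ?setIT//; exact: measurableT.
have B := Rintegral_dominated (measurable_fd_integrand x lf)
  (integrableZT (M * 2 `^ (N + alpha) * fkernel x) ii).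
apply: (le_trans (B _)).
  move=> y; apply: (le_trans (fd_integrand_le _ _ _)); rewrite fx0 subr0.
  have [fy|fy] := eqVneq (f y) 0.
    rewrite fy enorm0 mul0r; apply: mulr_ge0; last by rewrite indicE ler0n.
    by apply: mulr_ge0 (fkernel_ge0 _ _); rewrite mulr_ge0 ?powR_ge0.
  have [_ fyM /(_ fy) yr] := hf y y.
  rewrite indicE mem_set ?mulr1; last exact: le_trans (norm_le_enorm _) yr.
  rewrite -mulrA; apply: ler_pM; rewrite ?enorm_ge0 ?powR_ge0//.
  have yx : enorm x / 2 <= enorm (y - x).
    have := enormB_le x y; rewrite enorm_distC ler_norml => /andP[_]; lra.
  rewrite kx -[2 `^ _]invrK -[(2 `^ _)^-1]powRN.
  rewrite -powRN -[2 `^ _]/(2 `^ _).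
  have -> : (2 : R) `^ (- - (N + alpha)) = 2^-1 `^ (- (N + alpha)).
    by rewrite -powR_inv1// -!powRrM; congr (_ `^ _); ring.
  rewrite -powRM ?invr_ge0 ?enorm_ge0// !powRN lef_pV2 ?posrE ?powR_gt0//; last 2 first.
  - by apply: lt_le_trans yx; lra.
  - by rewrite mulr_gt0; lra.
  by rewrite ge0_ler_powR ?nnegrE ?enorm_ge0 ?mulr_ge0 ?enorm_ge0// mulrC.
rewrite RintegralZl; [|exact: measurableT|exact: ii].
rewrite /Rintegral integral_indic ?setIT//.
by rewrite le_eqVlt; apply/orP; left; apply/eqP; ring.
Qed.

Lemma frac_div_integrable f l M rho : lipf f l M rho -> 1 <= rho ->
  leb.-integrable setT (EFin \o frac_div c alpha f).
Proof.
move=> lf r1; have [l0 M0 hf] := lf.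
pose C1 := c * ((l + 2 * M) * kint).
pose C2 := c * (M * 2 `^ (N + alpha) * fine (leb (cube rho))).
have C10 : 0 <= C1 by rewrite mulr_ge0 ?(ltW hc)// mulr_ge0 ?kint_ge0//; lra.
have C20 : 0 <= C2.
  by rewrite mulr_ge0 ?(ltW hc)// !mulr_ge0 ?powR_ge0 ?fine_ge0.
have mc : measurable (cube (2 * rho) : set L) by exact: measurable_cube.
have cfin : (leb (cube (2 * rho)) < +oo)%E by exact: (outer_cube_fin (@subset_refl _ _)).
have ii : leb.-integrable setT (EFin \o (\1_(cube (2 * rho)) : L -> R)).
  apply: integrable_ge0; first exact: measurable_indic.
    by move=> y; rewrite indicE ler0n.
  by rewrite integral_indic ?setIT//; exact: measurableT.
have ik := integrableD measurableT (integrableZT C1 ii) (integrableZT C2 integrable_fkernel).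
have mf := continuous_lebesgue_measurable (frac_div_continuous lf).
have le x : `|frac_div c alpha f x| <= C1 * \1_(cube (2 * rho)) x + C2 * fkernel x.
  have [xr|xr] := leP (2 * rho) (enorm x).
    apply: (le_trans (frac_div_decay lf r1 xr)).
    by rewrite lerDr mulr_ge0// indicE ler0n.
  apply: (le_trans (frac_div_bound _ lf)); rewrite indicE mem_set ?mulr1.
    by rewrite lerDl mulr_ge0// fkernel_ge0.
  by apply: (le_trans (norm_le_enorm _)); exact: ltW.
exact: (dominated_integrableT mf ik le).
Qed.

End FracDiv.

(** * Scaling and local continuity of the pairing *)

Section Scaling.
Context {R : realType} {n : nat} (c alpha : R).
Context (halpha : 0 < alpha < 1) (hc : 0 < c).
Local Notation V := 'rV[R]_n.+1.
Local Notation L := (lebesgueType R n).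
Local Notation leb := (@lebesgueN R n).
Local Notation N := (n.+1%:R : R).

Lemma Rintegral_affE x r (g : V -> R) : 0 < r ->
  measurable_fun [set: L] (g : L -> R) ->
  \int[leb]_y g y = r ^+ n.+1 * \int[leb]_y g (aff x r y).
Proof.
move=> r0 mg; rewrite (Rintegral_aff x r0 mg) mulrA mulfV ?mul1r//.
by rewrite expf_neq0// lt0r_neq0.
Qed.

Definition affV (x : V) (r : R) : V -> V := aff (- (r^-1 *: x)) r^-1.

Lemma affVB x r z y : affV x r z - affV x r y = r^-1 *: (z - y).
Proof. by rewrite /affV /aff opprD addrACA subrr add0r -scalerBr. Qed.

Lemma lipf_affV f l M rho x r : 0 < r -> lipf f l M rho ->
  lipf (fun z => f (affV x r z)) (l / r) M (enorm x + r * rho).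
Proof.
move=> r0 [l0 M0 hf]; split; [by rewrite divr_ge0 // ltW|by []|].
move=> z y; have [h1 h2 h3] := hf (affV x r z) (affV x r y); split.
- apply: (le_trans h1); rewrite affVB enormZ gtr0_norm ?invr_gt0//.
  by rewrite mulrA.
- exact: h2.
- move=> /h3 h.
  have -> : z = x + r *: affV x r z by rewrite -[in LHS](aff_inv x z (lt0r_neq0 r0)).
  apply: (le_trans (enormD _ _)); rewrite enormZ gtr0_norm//.
  by rewrite lerD2l ler_pM2l.
Qed.

Lemma fd_integrand_affV f x r z' y' : 0 < r ->
  fd_integrand alpha (fun z => f (affV x r z)) (aff x r z') (aff x r y') =
  r `^ (- (N + alpha)) * fd_integrand alpha f z' y'.
Proof.
move=> r0; have rn := lt0r_neq0 r0.
rewrite /fd_integrand /affV !aff_invV//.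
have -> : aff x r y' - aff x r z' = r *: (y' - z').
  by rewrite /aff opprD addrACA subrr add0r -scalerBr.
rewrite edotZr enormZ (gtr0_norm r0) powRM ?(ltW r0) ?enorm_ge0//.
by rewrite -powR_shift ?(ltW r0)// invfM; ring.
Qed.

(** The volume contributes r^N and the kernel r^-(N+alpha): a net factor r^-alpha. *)
Lemma frac_div_affV f l M rho x r z' : 0 < r -> lipf f l M rho ->
  frac_div c alpha (fun z => f (affV x r z)) (aff x r z') =
  r ^+ n.+1 * r `^ (- (N + alpha)) * frac_div c alpha f z'.
Proof.
move=> r0 lf; have lfr := lipf_affV x r0 lf.
have m := measurable_fd_integrand alpha (aff x r z') lfr.
have e := Rintegral_affE x r0 m.
have e2 : \int[leb]_y fd_integrand alpha (fun z => f (affV x r z)) (aff x r z') (aff x r y)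
    = r `^ (- (N + alpha)) * \int[leb]_y fd_integrand alpha f z' y.
  have e3 := RintegralZl (r `^ (- (N + alpha))) measurableT (integrable_fd halpha z' lf).
  apply: etrans e3; apply: eq_Rintegral => y _.
  exact: fd_integrand_affV.
rewrite !frac_divE.
apply: (etrans (congr1 (fun t => c * t) (etrans e (congr1 (fun t => r ^+ n.+1 * t) e2)))).
by ring.
Qed.

Lemma integrable_frac_div f l M rho : lipf f l M rho ->
  leb.-integrable setT (EFin \o frac_div c alpha f).
Proof.
move=> [l0 M0 hf].
apply: (@frac_div_integrable _ _ _ _ halpha hc f l M (Num.max 1 rho)); last first.
  by rewrite le_max lexx.
split=> // x y; have [h1 h2 h3] := hf x y; split=> // /h3 h.
by rewrite le_max h orbT.
Qed.

Definition fd_pairing (E : set V) (f : V -> V) : R :=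
  \int[leb]_z (\1_E z * frac_div c alpha f z).

Lemma measurable_pairing E f l M rho : lipf f l M rho -> measurable (E : set L) ->
  measurable_fun [set: L] ((fun z => \1_E z * frac_div c alpha f z) : L -> R).
Proof.
move=> lf mE; apply: measurable_funM; first exact: measurable_indic.
exact/continuous_lebesgue_measurable/(frac_div_continuous halpha hc lf).
Qed.

Lemma integrable_pairing E f l M rho : lipf f l M rho -> measurable (E : set L) ->
  leb.-integrable setT (EFin \o (fun z => \1_E z * frac_div c alpha f z)).
Proof.
move=> lf mE; have m := measurable_pairing lf mE.
have ig := integrable_frac_div lf.
have le x : `|\1_E x * frac_div c alpha f x| <= `|frac_div c alpha f x|.
  by rewrite normrM indicE ger0_norm ?ler0n// ler_piMl//; case: (_ \in _).
exact: (dominated_integrableT m (integrable_abse ig) le).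
Qed.

(** The outer integral adds a factor r^N to the r^-alpha of the divergence; this is the source of
    the exponent N - alpha in all mass estimates. *)
Lemma fd_pairing_affV E f l M rho x r : 0 < r -> lipf f l M rho ->
  measurable (E : set L) ->
  fd_pairing E (fun z => f (affV x r z)) =
  r ^+ n.+1 * r `^ (- alpha) * fd_pairing (blow_up E x r) f.
Proof.
move=> r0 lf mE; have lfr := lipf_affV x r0 lf.
have rn := lt0r_neq0 r0.
have e := Rintegral_affE x r0 (measurable_pairing lfr mE).
have e2 : \int[leb]_y (\1_E (aff x r y) * frac_div c alpha (fun z => f (affV x r z)) (aff x r y))
    = (r ^+ n.+1 * r `^ (- (N + alpha))) * fd_pairing (blow_up E x r) f.
  have -> : blow_up E x r = aff x r @^-1` E by exact: blow_upE.
  have ic := integrable_pairing lf (measurable_aff_preimage x r0 mE).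
  apply: etrans (RintegralZl _ measurableT ic).
  apply: eq_Rintegral => y _.
  have e3 : frac_div c alpha (fun z => f (affV x r z)) (aff x r y) = _ := frac_div_affV x y r0 lf.
  apply: (etrans (congr1 (fun t => \1_E (aff x r y) * t) e3)).
  exact: mulrCA.
apply: (etrans (etrans e (congr1 (fun t => r ^+ n.+1 * t) e2))).
have -> : r `^ (- alpha) = r ^+ n.+1 * r `^ (- (N + alpha)).
  rewrite -(powR_mulrn _ (ltW r0)) -powRD; last by rewrite rn implybT.
  by congr (_ `^ _); ring.
exact: mulrA.
Qed.

(** Local closeness controls a nonlocal pairing: outside a large cube the integral of |[frac_div f]|
    is below e/2 whatever the set [A], and inside it the integrand is bounded by a constant [K] on
    the symmetric difference. *)
Lemma fd_pairing_close f l M rho F (e : R) : lipf f l M rho ->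
  measurable (F : set L) -> 0 < e -> exists m : nat, exists2 d : R, 0 < d &
  forall A, measurable (A : set L) -> (dm m%:R A F < d%:E)%E ->
    `|fd_pairing A f - fd_pairing F f| < e.
Proof.
move=> lf mF e0; have ig := integrable_frac_div lf.
have [l0 M0 hf] := lf.
have t := integral_tail (S := fun m : nat => cube m%:R : set L)
  (fun m => measurable_cube m%:R) _ ig.
have {}t := t _.
have : (fun m => \int[leb]_x (\1_(~` (cube m%:R : set V)) x * `|frac_div c alpha f x|)) @ \oo --> (0 : R).
  apply: t => x; exists (Num.truncn `|x|).+1 => // m /= hm.
  rewrite /cube/= ltW// (lt_le_trans (truncnS_gt _))// ler_nat//.
have e20 : 0 < e / 2 by rewrite divr_gt0.
move/cvgrPdist_lt => /(_ _ e20)[m0 _ hm].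
have {hm} := hm m0 (leqnn m0); rewrite sub0r normrN => hm.
pose K := c * ((l + 2 * M) * @kint R n alpha).
have K0 : 0 <= K.
  by rewrite mulr_ge0 ?(ltW hc)// mulr_ge0 ?kint_ge0//; lra.
exists m0, (e / (2 * (K + 1))) => [|A mA hA]; first by rewrite divr_gt0//; lra.
have mS : measurable (symdiff A F `&` cube m0%:R : set L).
  by apply: measurableI; [exact: measurable_symdiff|exact: measurable_cube].
have Sfin : (leb (symdiff A F `&` cube m0%:R) < +oo)%E by apply: lt_trans hA (ltry _).
have iS : leb.-integrable setT (EFin \o (\1_(symdiff A F `&` cube m0%:R) : L -> R)).
  apply: integrable_ge0; first exact: measurable_indic.
    by move=> y; rewrite indicE ler0n.
  by rewrite integral_indic ?setIT//; exact: measurableT.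
have iT : leb.-integrable setT (EFin \o (fun x => \1_(~` (cube m0%:R : set V)) x * `|frac_div c alpha f x|)).
  have mT : measurable_fun [set: L] ((fun x => \1_(~` (cube m0%:R : set V)) x * `|frac_div c alpha f x|) : L -> R).
    apply: measurable_funM; first by apply: measurable_indic; apply: measurableC; exact: measurable_cube.
    have mg := continuous_lebesgue_measurable (frac_div_continuous halpha hc lf).
    exact: (measurableT_comp (@normr_measurable R setT) mg).
  have leT x : `|\1_(~` (cube m0%:R : set V)) x * `|frac_div c alpha f x| | <= `|frac_div c alpha f x|.
    by rewrite normrM normr_id indicE ger0_norm ?ler0n// ler_piMl//; case: (_ \in _).
  exact: (dominated_integrableT mT (integrable_abse ig) leT).
rewrite /fd_pairing -RintegralB_T; [|exact: integrable_pairing lf mA|exact: integrable_pairing lf mF].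
have mD : measurable_fun [set: L] ((fun z => \1_A z * frac_div c alpha f z - \1_F z * frac_div c alpha f z) : L -> R).
  by apply: measurable_funB; exact: measurable_pairing lf _.
have iK := integrableZT K iS.
have iKT := integrableD measurableT iK iT.
have le x : `|\1_A x * frac_div c alpha f x - \1_F x * frac_div c alpha f x| <=
  K * \1_(symdiff A F `&` cube m0%:R) x + \1_(~` (cube m0%:R : set V)) x * `|frac_div c alpha f x|.
  rewrite -mulrBl normrM.
  have fb := frac_div_bound halpha hc x lf.
  rewrite !indicE in_setI in_setC /symdiff in_setU !in_setD.
  have := normr_ge0 (frac_div c alpha f x).
  by case: (x \in A); case: (x \in F); case: (x \in cube m0%:R) => /=;
    rewrite ?subrr ?subr0 ?sub0r ?normrN ?normr0 ?normr1; rewrite -/K in fb *; lra.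
have B := Rintegral_dominated mD iKT le.
apply: (le_lt_trans B).
have -> : \int[leb]_x (K * \1_(symdiff A F `&` cube m0%:R) x + \1_(~` (cube m0%:R : set V)) x * `|frac_div c alpha f x|)
  = K * fine (leb (symdiff A F `&` cube m0%:R)) + \int[leb]_x (\1_(~` (cube m0%:R : set V)) x * `|frac_div c alpha f x|).
  rewrite RintegralD; [|exact: measurableT|exact: iK|exact: iT].
  rewrite RintegralZl; [|exact: measurableT|exact: iS].
  by rewrite {1}/Rintegral integral_indic ?setIT//; exact: measurableT.
have hS : K * fine (leb (symdiff A F `&` cube m0%:R)) <= e / 2.
  have h1 : fine (leb (symdiff A F `&` cube m0%:R)) <= e / (2 * (K + 1)).
    rewrite -lee_fin fineK; first exact: ltW.
    by rewrite ge0_fin_numE.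
  apply: (le_trans (ler_wpM2l K0 h1)).
  by rewrite mulrA ler_pdivrMr; [nra|lra].
have := ler_norm (\int[leb]_x (\1_(~` (cube m0%:R : set V)) x * `|frac_div c alpha f x|)).
lra.
Qed.

End Scaling.

(** * Smooth bump functions *)

Section FlatExponential.
Context {R : realType}.
Implicit Types (p : {poly R}) (x t : R).

(** p(1/x) exp(-1/x), extended by 0. In t = 1/x the derivative replaces p by t^2 (p - p'), which is
    [flat_diff p]; so the family is closed under differentiation. *)
Definition flat_exp p x : R := if 0 < x then p.[x^-1] * expR (- x^-1) else 0.

Definition flat_diff p : {poly R} := 'X^2 * (p - p^`()).

Lemma horner_bound p : exists2 K : R, 0 <= K &
  forall t, 1 <= t -> `|p.[t]| <= K * t ^+ size p.
Proof.
exists (\sum_(i < size p) `|p`_i|); first by apply: sumr_ge0.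
move=> t t1; rewrite horner_coef mulr_suml (le_trans (ler_norm_sum _ _ _))//.
apply: ler_sum => i _; rewrite normrM ler_wpM2l// normrX ger0_norm; last by lra.
by rewrite ler_weXn2l// ltnW.
Qed.

(** In t = 1/x, the bound exp(t) >= t^k/k! with k = size p + 2 beats the polynomial by two powers of
    x. Quadratic smallness yields the derivative 0 at the origin. *)
Lemma flat_exp_small p : exists2 K : R, 0 <= K &
  forall x, 0 < x -> x <= 1 -> `|flat_exp p x| <= K * x ^+ 2.
Proof.
have [K K0 hK] := horner_bound p.
exists (K * (size p).+2`!%:R); first by rewrite mulr_ge0.
move=> x x0 x1; have t1 : 1 <= x^-1 by rewrite invr_ge1// unitf_gt0.
have ti0 : 0 < x^-1 by rewrite invr_gt0.
rewrite /flat_exp x0 normrM expRN [X in _ * X]ger0_norm ?invr_ge0 ?expR_ge0//.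
apply: (le_trans (ler_wpM2r _ (hK _ t1))); first by rewrite invr_ge0 expR_ge0.
have h := expR_ge1Dxn (size p).+1 (ltW ti0).
have h2 : x^-1 ^+ (size p).+2 / (size p).+2`!%:R <= expR x^-1 by lra.
rewrite ler_pdivrMr ?expR_gt0//.
have -> : K * x^-1 ^+ size p = K * (size p).+2`!%:R * x ^+ 2 * (x^-1 ^+ (size p).+2 / (size p).+2`!%:R).
  rewrite -addn2 exprD; have : (size p + 2)`!%:R != 0 :> R by rewrite pnatr_eq0 -lt0n fact_gt0.
  by move=> f0; field; rewrite f0 lt0r_neq0.
by rewrite ler_wpM2l// ?mulr_ge0// ltW.
Qed.

Lemma is_derive_flat_exp p x :
  is_derive x 1 (flat_exp p) (flat_exp (flat_diff p) x).
Proof.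
have [x0|x0|<-] := ltgtP 0 x.
- apply: (@near_eq_is_derive R R^o R^o (fun y => p.[y^-1] * expR (- y^-1)) (flat_exp p) x 1).
    near=> y; rewrite /flat_exp.
    suff -> : 0 < y by [].
    by near: y; exact: lt_nbhsr.
  have xn : x != 0 by rewrite lt0r_neq0.
  have di : is_derive x 1 (fun y : R => y^-1) (- x ^- 2).
    by apply: is_derive_eq; first exact: is_deriveV; rewrite /GRing.scale/= mulr1.
  have dp := @is_derive1_comp _ (horner p) (fun y : R => y^-1) x _ _ (is_derive_poly p _) di.
  have de := @is_derive1_comp _ expR (fun y : R => - y^-1) x _ _ (is_derive_expR _) (is_deriveN di).
  apply: (is_derive_eq (is_deriveM dp de)).
  have sc (a b : R) : a *: (b : R^o) = a * b by [].
  rewrite /flat_exp x0 /flat_diff !sc !hornerE /= exprVn; ring.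
- apply: (@near_eq_is_derive R R^o R^o (cst 0) (flat_exp p) x 1).
    near=> y; rewrite /flat_exp.
    suff /lt_gtF -> : y < 0 by [].
    by near: y; exact: lt_nbhsl.
  by rewrite /flat_exp lt_gtF//; exact: is_derive_cst.
- have [K K0 hK] := flat_exp_small p.
  have F0 q : flat_exp q 0 = 0 by rewrite /flat_exp ltxx.
  have c : (fun h => h^-1 *: ((flat_exp p \o shift 0) (h *: (1 : R)) - flat_exp p 0)) @ 0^' --> (0 : R).
    apply/cvgr0Pnorm_le => e e0.
    have d0 : 0 < Num.min 1 (e / (K + 1)) by rewrite lt_min ltr01 divr_gt0//; lra.
    near=> h.
    have hn : h != 0 by near: h; exact: nbhs_dnbhs_neq.
    have : `|h| < Num.min 1 (e / (K + 1)) by near: h; exact: dnbhs0_lt.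
    rewrite lt_min => /andP[h1 he].
    have sc (a b : R) : a *: (b : R^o) = a * b by [].
    rewrite /= F0 subr0 addr0 !sc mulr1.
    have [hp|hp] := ltP 0 h; last by rewrite /flat_exp ltNge hp mulr0 normr0 ltW.
    move: h1 he; rewrite gtr0_norm// => h1 he.
    rewrite normrM normfV [`|h|]gtr0_norm// ler_pdivrMl//.
    apply: (le_trans (hK _ hp (ltW h1))).
    move: he; rewrite ltr_pdivlMr; last lra.
    by move=> he; rewrite expr2 mulrCA ler_pM2l//; nra.
  rewrite F0; apply: DeriveDef; first by apply/cvg_ex; exists 0; exact: c.
  by apply/cvg_lim => //.
Unshelve. all: end_near. Qed.

Lemma flat_exp_continuous p : continuous (flat_exp p).
Proof.
move=> x; apply/differentiable_continuous/derivable1_diffP.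
exact: (@ex_derive _ _ _ _ _ _ _ (is_derive_flat_exp p x)).
Qed.

Definition flat : R -> R := flat_exp 1.

Lemma flatE x : flat x = if 0 < x then expR (- x^-1) else 0.
Proof. by rewrite /flat /flat_exp hornerC mul1r. Qed.

Lemma flat_ge0 x : 0 <= flat x.
Proof. by rewrite flatE; case: ifP => // _; exact: expR_ge0. Qed.

Lemma flat_le1 x : flat x <= 1.
Proof.
rewrite flatE; case: ifP => // x0.
by rewrite -(expR0) ler_expR oppr_le0 invr_ge0 ltW.
Qed.

Lemma flat_gt0 x : (0 < flat x) = (0 < x).
Proof. by rewrite flatE; case: ifP => _; rewrite ?expR_gt0 ?ltxx. Qed.

Lemma flat0 x : x <= 0 -> flat x = 0.
Proof. by rewrite flatE ltNge => ->. Qed.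

(** The derivative of [flat] is t^2 exp(-t) at t = 1/x, and exp(t) >= t^2/2. The bound 2 becomes the
    Lipschitz constant of [flat]. *)
Lemma flat_diff_bound x : 0 <= flat_exp (flat_diff 1) x <= 2.
Proof.
rewrite /flat_exp; case: ifP => [x0|_]; last by rewrite lexx/=.
have -> : (flat_diff 1).[x^-1] = x^-1 ^+ 2.
  by rewrite /flat_diff derivC subr0 mulr1 hornerXn.
rewrite mulr_ge0 ?sqr_ge0 ?expR_ge0//= expRN ler_pdivrMr ?expR_gt0//.
have xi0 : 0 <= x^-1 by rewrite invr_ge0 ltW.
have := expR_ge1Dxn 1 xi0; rewrite -[2`!]/2%N; lra.
Qed.

Lemma flat_mvt (a b : R) : a <= b -> 0 <= flat b - flat a <= 2 * (b - a).
Proof.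
move=> ab.
have [c _ ->] := MVT_segment ab (fun x _ => is_derive_flat_exp 1 x)
  (continuous_subspaceT (@flat_exp_continuous 1)).
have /andP[h1 h2] := flat_diff_bound c.
by rewrite mulr_ge0 ?subr_ge0//= ler_wpM2r ?subr_ge0.
Qed.

Lemma flat_homo (a b : R) : a <= b -> flat a <= flat b.
Proof. by move=> /flat_mvt/andP[]; rewrite subr_ge0. Qed.

Lemma flat_lip (a b : R) : `|flat a - flat b| <= 2 * `|a - b|.
Proof.
wlog ab : a b / a <= b.
  by move=> W; have [/W//|/ltW/W] := leP a b; rewrite distrC (distrC b).
have /andP[h1 h2] := flat_mvt ab.
by rewrite distrC ger0_norm// distrC ger0_norm ?subr_ge0.
Qed.

Lemma flat_cvg1 t : 0 < t -> (fun k : nat => flat (k%:R * t)) @ \oo --> (1 : R).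
Proof.
move=> t0.
have c : (fun k : nat => 1 - t^-1 * (k.+1%:R)^-1) @ \oo --> (1 : R).
  rewrite -[X in _ --> X]subr0 -[X in _ --> _ - X](mulr0 t^-1).
  by apply: cvgB; [exact: cvg_cst|apply: cvgMr; exact: cvg_harmonic].
have H : \forall k \near \oo, 1 - t^-1 * (k.+1%:R)^-1 <= flat (k.+1%:R * t) <= 1.
  apply: nearW => k /=; rewrite flat_le1 andbT flatE mulr_gt0//.
  have := expR_ge1Dx (- (k.+1%:R * t)^-1).
  by rewrite invfM mulrC.
have H2 := squeeze_cvgr H c (cvg_cst (1 : R)).
by rewrite -(cvg_shiftS (fun k : nat => flat (k%:R * t))); exact: H2.
Qed.

End FlatExponential.

Section SmoothFunctions.
Context {R : realType} {n : nat}.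
Local Notation V := 'rV[R]_n.+1.
Implicit Types (x y z w v : V) (f g : V -> R) (r : R).

(* A class of functions closed under partial derivatives: the derivative of
   [flat_exp p] is [flat_exp (flat_diff p)]. *)
Inductive smooth : (V -> R) -> Prop :=
| smooth_cst c : smooth (fun=> c)
| smooth_coord i : smooth (fun x => x 0 i)
| smoothD f g : smooth f -> smooth g -> smooth (fun x => f x + g x)
| smoothM f g : smooth f -> smooth g -> smooth (fun x => f x * g x)
| smooth_flat_exp p f : smooth f -> smooth (fun x => flat_exp p (f x)).

Lemma smooth_sum (I : Type) (s : seq I) (F : I -> V -> R) :
  (forall i, smooth (F i)) -> smooth (fun x => \sum_(i <- s) F i x).
Proof.
move=> sF; elim: s => [|i s IH].
  rewrite (_ : (fun _ => _) = fun=> 0); first exact: smooth_cst.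
  by apply/funext => x; rewrite big_nil.
rewrite (_ : (fun _ => _) = fun x => F i x + \sum_(j <- s) F j x); first exact: smoothD.
by apply/funext => x; rewrite big_cons.
Qed.

Lemma smooth_aff f x r : smooth f -> smooth (fun y => f (aff x r y)).
Proof.
elim=> {f} [c|i|f g _ sf _ sg|f g _ sf _ sg|p f _ sf].
- exact: smooth_cst.
- rewrite (_ : (fun _ => _) = fun y => x 0 i + r * y 0 i).
    by apply: smoothD (smooth_cst _) _; apply: smoothM (smooth_cst _) (smooth_coord i).
  by apply/funext => y; rewrite !mxE.
- exact: smoothD.
- exact: smoothM.
- exact: smooth_flat_exp.
Qed.

Lemma smooth_continuous f : smooth f -> continuous f.
Proof.
elim=> {f} [c|i|f g _ sf _ sg|f g _ sf _ sg|p f _ sf] x.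
- exact: cst_continuous.
- exact: coord_continuous.
- by apply: continuousD; [exact: sf|exact: sg].
- by apply: continuousM; [exact: sf|exact: sg].
- by apply: continuous_comp; [exact: sf|exact: flat_exp_continuous].
Qed.

(* Along a line the directional derivative is an ordinary derivative, so the
   one-dimensional chain rule applies. *)
Lemma is_derive_line f x v d :
  is_derive x v f d <-> is_derive (0 : R) (1 : R) (fun h : R => f (x + h *: v)) d.
Proof.
have e : (fun h : R => h^-1 *: ((f \o shift x) (h *: v) - f x)) =
  (fun h : R => h^-1 *: (((fun h : R => f (x + h *: v)) \o shift 0) (h *: (1 : R)) - f (x + (0 : R) *: v))).
  apply/funext => h /=; rewrite scale0r !addr0 [h *: 1]mulr1.
  by rewrite [h *: v + x]addrC.
split=> -[d1 d2]; apply: DeriveDef.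
- by rewrite /derivable -e.
- by rewrite /derive -e.
- by rewrite /derivable e.
- by rewrite /derive e.
Qed.

Lemma smooth_derive f (j : 'I_n.+1) : smooth f -> exists2 g, smooth g &
  forall x, is_derive x (delta_mx 0 j) f (g x).
Proof.
elim=> {f} [c|i|f g sf [df sdf hf] sg [dg sdg hg]|f g sf [df sdf hf] sg [dg sdg hg]|p f sf [df sdf hf]].
- exists (fun=> 0); [exact: smooth_cst|move=> x; exact: is_derive_cst].
- exists (fun=> (delta_mx 0 j : V) 0 i); first exact: smooth_cst.
  move=> x; have [h1 h2] := is_derive_id x (delta_mx 0 j : V).
  apply: DeriveDef; first by move/derivable_mxP : h1 => /(_ 0 i).
  by move: h2; rewrite (derive_mx h1) => /rowP/(_ i); rewrite mxE.
- exists (fun x => df x + dg x); first exact: smoothD.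
  by move=> x; apply: is_deriveD.
- exists (fun x => f x * dg x + g x * df x); first by apply: smoothD; exact: smoothM.
  by move=> x; apply: is_deriveM.
- exists (fun x => flat_exp (flat_diff p) (f x) * df x).
    by apply: smoothM => //; exact: smooth_flat_exp.
  move=> x; apply/is_derive_line.
  have := hf x; move/is_derive_line => h.
  have h2 := @is_derive1_comp _ (flat_exp p) (fun h : R => f (x + h *: delta_mx 0 j)) 0
    _ _ (is_derive_flat_exp p _) h.
  by apply: (is_derive_eq h2); rewrite scale0r addr0.
Qed.

Lemma smoothZ_continuous f v : smooth f -> continuous (fun x => f x *: v).
Proof.
by move=> sf x; have c := smooth_continuous sf (x := x); have := cvgZr_tmp (a := v) c; exact.
Qed.

Lemma smooth_is_Ck k f v : smooth f -> is_Ck k (fun x => f x *: v).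
Proof.
elim: k f => [|k IH] f sf.
  by split=> //; exact: smoothZ_continuous.
split; first exact: smoothZ_continuous.
move=> j; have [g sg hg] := smooth_derive j sf.
have dx x : is_derive x (delta_mx 0 j) (fun x => f x *: v) (g x *: v).
  have d1 : derivable (fun x => f x *: v) x (delta_mx 0 j).
    apply/derivable_mxP => a i.
    rewrite (_ : (fun _ => _) = (fun y => f y * v a i)).
      by apply: derivableM; [exact: (@ex_derive _ _ _ _ _ _ _ (hg x))|exact: derivable_cst].
    by apply/funext => y; rewrite mxE.
  apply: DeriveDef => //; rewrite derive_mx//; apply/matrixP => a i; rewrite !mxE.
  have h : is_derive x (delta_mx 0 j) (fun y => f y * v a i) (g x * v a i).
    apply: (is_derive_eq (is_deriveM (hg x) (is_derive_cst (v a i) x (delta_mx 0 j)))).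
    by rewrite scaler0 add0r mulrC.
  rewrite (_ : (fun _ => _) = (fun y => f y * v a i)); first exact: (@derive_val _ _ _ _ _ _ _ h).
  by apply/funext => y; rewrite mxE.
split; first by move=> x; exact: (@ex_derive _ _ _ _ _ _ _ (dx x)).
rewrite (_ : (fun _ => _) = (fun x => g x *: v)); first exact: IH.
by apply/funext => x; exact: (@derive_val _ _ _ _ _ _ _ (dx x)).
Qed.

Lemma fsupp_sub (h : V -> V) (m : R) : (forall x, h x != 0 -> `|x| <= m) ->
  compact (fsupp h).
Proof.
move=> hm; apply: subclosed_compact (@cube_compact _ _ m) _; first exact: closed_closure.
have ccl : closed (cube m : set V).
  by apply: compact_closed (@cube_compact _ _ m); exact: norm_hausdorff.
have /closure_id -> := ccl.
by apply: closure_subset => x /hm.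
Qed.

Lemma smooth_test_field f v (m : R) : smooth f ->
  (forall x, f x != 0 -> `|x| <= m) -> test_field (fun x => f x *: v).
Proof.
move=> sf fm; split; first by move=> k; exact: smooth_is_Ck.
by apply: (@fsupp_sub _ m) => x; rewrite scaler_eq0 negb_or => /andP[/fm].
Qed.

(** Squaring the norm makes the argument of [flat] a polynomial in the coordinates. *)
Definition ebump w r x : R := flat (r ^+ 2 - enorm (x - w) ^+ 2).

Lemma smooth_bump w r : smooth (ebump w r).
Proof.
apply: smooth_flat_exp.
rewrite (_ : (fun _ => _) = fun x => r ^+ 2 + (-1) * \sum_i (x 0 i + (- w 0 i)) * (x 0 i + (- w 0 i))).
  apply: smoothD (smooth_cst _) _; apply: smoothM (smooth_cst _) _.
  apply: smooth_sum => i.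
  by apply: smoothM; apply: smoothD (smooth_coord i) (smooth_cst _).
apply/funext => x; rewrite enorm_sqr mulN1r; congr (_ - _).
by apply: eq_bigr => i _; rewrite !mxE.
Qed.

Lemma bump_ge0 w r x : 0 <= ebump w r x. Proof. exact: flat_ge0. Qed.
Lemma bump_le1 w r x : ebump w r x <= 1. Proof. exact: flat_le1. Qed.

Lemma bump_gt0 w r x : 0 < r -> (0 < ebump w r x) = (enorm (x - w) < r).
Proof.
move=> r0; rewrite flat_gt0 subr_gt0 ltr_sqr// nnegrE ?enorm_ge0//.
exact: ltW.
Qed.

Lemma bump_eq0 w r x : 0 < r -> r <= enorm (x - w) -> ebump w r x = 0.
Proof.
move=> r0 h; apply/eqP; rewrite eq_le bump_ge0 andbT leNgt bump_gt0//.
by rewrite -leNgt.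
Qed.

Lemma bump_lip w r x y : 0 < r ->
  `|ebump w r x - ebump w r y| <= 4 * r * enorm (x - y).
Proof.
(* Truncating at 0 leaves [flat] unchanged and makes r^2 - s^2 Lipschitz with constant 2 r for s >=
   0; the constant 2 of [flat] does the rest. *)
move=> r0; pose c (s : R) := Num.max 0 (r ^+ 2 - s ^+ 2).
have bc z : ebump w r z = flat (c (enorm (z - w))).
  rewrite /ebump /c; case: (leP 0 (r ^+ 2 - enorm (z - w) ^+ 2)) => // /ltW h.
  by rewrite !flat0.
rewrite !bc; apply: (le_trans (flat_lip _ _)).
rewrite -[4]/(2 * 2)%:R natrM -!mulrA ler_pM2l//.
have : `|enorm (x - w) - enorm (y - w)| <= enorm (x - y).
  by apply: (le_trans (enormB_le _ _)); rewrite opprB addrA subrK.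
have := enorm_ge0 (x - w); have := enorm_ge0 (y - w).
move: (enorm (x - w)) (enorm (y - w)) (enorm (x - y)) => s t e t0 s0.
rewrite ler_norml => /andP[h1 h2].
have e0 : 0 <= e by lra.
rewrite /c ler_norml.
case: (leP 0 (r ^+ 2 - s ^+ 2)) => hs; case: (leP 0 (r ^+ 2 - t ^+ 2)) => ht.
- have sr : s <= r by rewrite leNgt; apply/negP => ?; nra.
  have tr_ : t <= r by rewrite leNgt; apply/negP => ?; nra.
  by apply/andP; split; nra.
- have sr : s <= r by rewrite leNgt; apply/negP => ?; nra.
  have tr_ : r < t by rewrite ltNge; apply/negP => ?; nra.
  by apply/andP; split; nra.
- have sr : r < s by rewrite ltNge; apply/negP => ?; nra.
  have tr_ : t <= r by rewrite leNgt; apply/negP => ?; nra.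
  by apply/andP; split; nra.
- by rewrite subrr; apply/andP; split; nra.
Qed.

End SmoothFunctions.

(** * Mass estimates for the fractional gradient *)

Section LayerCake.
Context d (T : measurableType d) (R : realType) (mu : {measure set T -> \bar R}).

Lemma count_lt (m : nat) (t : R) : 0 <= t <= m%:R ->
  t <= \sum_(k < m) ((k%:R < t)%R : bool)%:R <= t + 1.
Proof.
elim: m => [|m IH] /andP[t0 tm]; first by rewrite big_ord0; apply/andP; split; lra.
rewrite big_ord_recr/=; have [mt|tm'] := ltP m%:R t.
  rewrite (eq_bigr (fun=> 1)); last first.
    move=> k _; suff -> : (k%:R < t)%R by [].
    by apply: le_lt_trans mt; rewrite ler_nat ltnW.
  by move: tm; rewrite sumr_const card_ord -natr1 /= mulr1n => tm; apply/andP; split; lra.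
by rewrite addr0; apply: IH; rewrite t0.
Qed.

Context (eta : T -> R) (meta : measurable_fun setT eta)
  (eta01 : forall x, 0 <= eta x <= 1)
  (etafin : (mu [set x | (0 < eta x)%R] < +oo)%E).


Let S (t : R) : set T := [set x | t < eta x].

Let mS t : measurable (S t).
Proof.
rewrite /S (_ : [set x | _] = eta @^-1` `]t, +oo[%classic).
  by rewrite -[X in measurable X]setTI; exact: meta.
by apply/seteqP; split => x /=; rewrite in_itv/= andbT.
Qed.

Let Sfin t : 0 <= t -> (mu (S t) < +oo)%E.
Proof.
move=> t0; apply: le_lt_trans etafin; apply: le_measure; rewrite ?inE//.
  exact: (mS 0).
by move=> x /=; exact: le_lt_trans.
Qed.

Let iS t : 0 <= t -> mu.-integrable setT (EFin \o (\1_(S t) : T -> R)).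
Proof.
move=> t0; apply: integrable_ge0; first exact: measurable_indic.
  by move=> x; rewrite indicE ler0n.
by rewrite integral_indic ?setIT//; exact: Sfin.
Qed.

Let RS t : 0 <= t -> \int[mu]_x (\1_(S t) x : R) = fine (mu (S t)).
Proof. by move=> t0; rewrite /Rintegral integral_indic ?setIT. Qed.

Lemma sum_superlevel_integral (j : nat) (s : nat -> R) : (forall k, 0 <= s k) ->
  mu.-integrable setT (EFin \o (fun x => \sum_(k < j) (\1_(S (s k)) x : R))) /\
  \int[mu]_x (\sum_(k < j) (\1_(S (s k)) x : R)) = \sum_(k < j) fine (mu (S (s k))).
Proof.
move=> s0; elim: j => [|j [IH1 IH2]].
  have -> : (fun x => \sum_(k < 0) (\1_(S (s k)) x : R)) = fun=> 0.
    by apply/funext => x; rewrite big_ord0.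
  by split; [exact: integrable0|rewrite big_ord0 Rintegral_cst// mul0r].
have -> : (fun x => \sum_(k < j.+1) (\1_(S (s k)) x : R)) =
  fun x => (\sum_(k < j) (\1_(S (s k)) x : R)) + \1_(S (s j)) x.
  by apply/funext => x; rewrite big_ord_recr.
split; first exact: (integrableD measurableT IH1 (iS (s0 j))).
by rewrite big_ord_recr/= -IH2 -RS// -RintegralD//; exact: iS.
Qed.

(** Where [eta] is positive, the average of the m+1 superlevel indicators lies between [eta] and
    [eta] + 1/(m+1), by [count_lt]. Being a finite sum, it can be recombined over the Jordan parts
    of a vector measure. *)
Lemma layer_cake (m : nat) :
  mu.-integrable setT (EFin \o eta) /\
  `|\int[mu]_x eta x - m.+1%:R^-1 * \sum_(k < m.+1) fine (mu [set x | (k%:R / m.+1%:R < eta x)%R])|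
  <= m.+1%:R^-1 * fine (mu [set x | (0 < eta x)%R]).
Proof.
have m0 : (0 : R) < m.+1%:R by [].
have s0 (k : nat) : 0 <= (k%:R / m.+1%:R : R) by rewrite divr_ge0.
have [i1 e1] := sum_superlevel_integral m.+1 s0.
have ieta : mu.-integrable setT (EFin \o eta).
  apply: (dominated_integrableT meta (iS (lexx 0))) => x.
  have /andP[h0 h1] := eta01 x; rewrite ger0_norm// indicE.
  have [e0|e0] := ltP 0 (eta x); first by rewrite mem_set.
  by rewrite memNset //= /S/=; apply/negP; rewrite -leNgt.
split=> //.
have i2 := integrableZT m.+1%:R^-1 i1.
have -> : m.+1%:R^-1 * \sum_(k < m.+1) fine (mu [set x | (k%:R / m.+1%:R < eta x)%R]) =
   \int[mu]_x (m.+1%:R^-1 * \sum_(k < m.+1) (\1_(S (k%:R / m.+1%:R)) x : R)).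
  by rewrite RintegralZl// e1.
rewrite -RintegralB//.
have i3 := integrableZT m.+1%:R^-1 (iS (lexx 0)).
have md : measurable_fun setT (fun x => eta x - m.+1%:R^-1 * \sum_(k < m.+1) (\1_(S (k%:R / m.+1%:R)) x : R)).
  by apply: measurable_funB => //; case/integrableP : i2 => /measurable_EFinP.
have le x : `|eta x - m.+1%:R^-1 * \sum_(k < m.+1) (\1_(S (k%:R / m.+1%:R)) x : R)| <=
  m.+1%:R^-1 * \1_(S 0) x.
  have /andP[h0 h1] := eta01 x.
  have -> : \sum_(k < m.+1) (\1_(S (k%:R / m.+1%:R)) x : R) =
      \sum_(k < m.+1) ((k%:R < eta x * m.+1%:R)%R : bool)%:R.
    apply: eq_bigr => k _; rewrite indicE -ltr_pdivrMr//.
    by congr (_%:R); congr nat_of_bool; apply/idP/idP => [/set_mem//|h]; exact/mem_set.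
  have [e0|e0] := ltP 0 (eta x).
    have c : 0 <= eta x * m.+1%:R <= m.+1%:R by rewrite mulr_ge0//= ler_piMl.
    have /andP[c1 c2] := count_lt c.
    rewrite [\1_(S 0) x]indicE mem_set//= mulr1 -(ler_pM2l m0) -[X in X * `|_|]gtr0_norm//.
    rewrite -normrM mulrBr mulrA mulfV ?lt0r_neq0// mul1r.
    rewrite (mulrC m.+1%:R (eta x)) distrC ger0_norm; lra.
  have -> : eta x = 0 by apply/eqP; rewrite eq_le e0.
  rewrite big1 ?mulr0 ?subrr ?normr0; first by rewrite mulr_ge0 ?invr_ge0// indicE ler0n.
  by move=> k _; rewrite mul0r ltNge ler0n.
apply: (le_trans (Rintegral_dominated md i3 le)).
by rewrite RintegralZl// ?RS//; exact: iS.
Qed.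

End LayerCake.

Section VectorIntegral.
Context {R : realType} {n : nat}.
Local Notation V := 'rV[R]_n.+1.
Local Notation B := (borelType R n).
Context (D : set B -> V) (rD : vector_radon D).
Local Notation posm := (posm rD).
Local Notation negm := (negm rD).
Local Notation mvar := (mvar rD).

Lemma vintegralE (f : V -> V) : vintegral f D =
  \sum_i (\int[posm i]_x (f x 0 i) - \int[negm i]_x (f x 0 i)).
Proof. by []. Qed.

Lemma eball_borel x r : bounded_borel (eball x r : set B).
Proof. by split; [apply: open_borel; exact: eball_open|exact: eball_bounded]. Qed.

Lemma fine_mvar S : bounded_borel S ->
  fine (mvar S) = \sum_i (fine (posm i S) + fine (negm i S)).
Proof.
move=> bS; suff -> : mvar S = (\sum_i (fine (posm i S) + fine (negm i S)))%:E by [].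
rewrite mvarE -sumEFin; apply: eq_bigr => i _.
by rewrite EFinD !fineK// ?posm_fin// negm_fin.
Qed.

Lemma Rintegral_supp_bound (mu : {measure set B -> \bar R}) (S : set B) (g : V -> R) (M : R) :
  measurable S -> (mu S < +oo)%E -> continuous g -> (forall x, `|g x| <= M) ->
  (forall x, g x != 0 -> S x) -> `|\int[mu]_x g x| <= M * fine (mu S).
Proof.
move=> mS Sfin cg gM gS.
have iS : mu.-integrable setT (EFin \o (\1_S : B -> R)).
  apply: integrable_ge0; first exact: measurable_indic.
    by move=> x; rewrite indicE ler0n.
  by rewrite integral_indic ?setIT.
have le x : `|g x| <= M * \1_S x.
  have [->|gx] := eqVneq (g x) 0; last by rewrite indicE (mem_set (gS x gx)) mulr1.
  by rewrite normr0 mulr_ge0 ?indicE//; exact: le_trans (normr_ge0 _) (gM x).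
apply: (le_trans (Rintegral_dominated (continuous_borel cg) (integrableZT M iS) le)).
by rewrite RintegralZl// /Rintegral integral_indic ?setIT.
Qed.

Lemma vintegral_bound (f : V -> V) (S : set B) (M : R) :
  bounded_borel S -> (forall i, continuous (fun x => f x 0 i)) ->
  (forall x i, `|f x 0 i| <= M) -> (forall x, f x != 0 -> S x) ->
  `|vintegral f D| <= M * fine (mvar S).
Proof.
move=> bS cf fM fS; have mS : measurable S by case: bS.
rewrite vintegralE fine_mvar// mulr_sumr (le_trans (ler_norm_sum _ _ _))//.
apply: ler_sum => i _; rewrite mulrDr (le_trans (ler_normB _ _))//.
have fiS x : f x 0 i != 0 -> S x.
  by move=> h; apply: fS; apply: contraNneq h => ->; rewrite mxE.
by apply: lerD; apply: Rintegral_supp_bound => //;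
  rewrite -ge0_fin_numE ?posm_fin ?negm_fin.
Qed.

Lemma ler_norm_subB (a b a' b' p q : R) :
  `|a - a'| <= p -> `|b - b'| <= q -> `|(a - b) - (a' - b')| <= p + q.
Proof.
by rewrite !ler_norml => /andP[? ?] /andP[? ?]; apply/andP; split; lra.
Qed.

(* The superlevel sets of [eta] are small balls [eball x s], on which [D] points
   in the direction [v], so the layer-cake formula gives the lower bound. *)
Lemma vintegral_radial_ge (eta : V -> R) (v : V) (x : V) (r0 r1 k t : R) :
  continuous eta -> (forall z, 0 <= eta z <= 1) -> 0 <= k -> 0 <= t <= 1 ->
  (forall s, 0 <= s -> exists2 rs, rs <= r0 & [set z | s < eta z] = eball x rs) ->
  (forall z, eball x r1 z -> t <= eta z) ->
  (forall rs, rs <= r0 -> k * fine (mvar (eball x rs)) <= edot v (D (eball x rs))) ->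
  k * t * fine (mvar (eball x r1)) <= vintegral (fun z => eta z *: v) D.
Proof.
move=> ce e01 k0 /andP[t0 t1] lev in1 hD.
have [rs0 rs0r S0E] := lev 0 (lexx 0).
(* [C / m.+1] will bound the layer-cake errors of all Jordan parts together. *)
pose C := \sum_i `|v 0 i| * (fine (posm i (eball x rs0)) + fine (negm i (eball x rs0))).
apply/ler_addgt0Pr => e e0.
pose m := Num.truncn (C / e).
have m0 : (0 : R) < m.+1%:R by [].
have hm : m.+1%:R^-1 * C <= e.
  rewrite ler_pdivrMl// mulrC -ler_pdivrMl// mulrC ltW//; exact: truncnS_gt.
have layer (mu : {measure set B -> \bar R}) : (mu (eball x rs0) < +oo)%E ->
    `|\int[mu]_z eta z - m.+1%:R^-1 * \sum_(j < m.+1) fine (mu [set z | (j%:R / m.+1%:R < eta z)%R])|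
    <= m.+1%:R^-1 * fine (mu (eball x rs0)).
  rewrite -S0E => fin.
  by have [_] := layer_cake (continuous_borel ce) e01 fin m.
pose sl (j : 'I_m.+1) : set B := [set z : V | (j%:R / m.+1%:R < eta z)%R].
have slE j : exists2 rs, rs <= r0 & sl j = eball x rs by apply: lev; rewrite divr_ge0.
have bsl j : bounded_borel (sl j) by have [rs _ ->] := slE j; exact: eball_borel.
have P i : `|\int[posm i]_z eta z - m.+1%:R^-1 * \sum_(j < m.+1) fine (posm i (sl j))|
    <= m.+1%:R^-1 * fine (posm i (eball x rs0)).
  by apply: layer; rewrite -ge0_fin_numE ?posm_fin//; exact: eball_borel.
have Q i : `|\int[negm i]_z eta z - m.+1%:R^-1 * \sum_(j < m.+1) fine (negm i (sl j))|
    <= m.+1%:R^-1 * fine (negm i (eball x rs0)).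
  by apply: layer; rewrite -ge0_fin_numE ?negm_fin//; exact: eball_borel.
have vE : vintegral (fun z => eta z *: v) D =
  \sum_i v 0 i * (\int[posm i]_z eta z - \int[negm i]_z eta z).
  rewrite vintegralE; apply: eq_bigr => i _; rewrite mulrBr.
  have Z (mu : {measure set B -> \bar R}) : (mu (eball x rs0) < +oo)%E ->
      \int[mu]_z ((eta z *: v) 0 i) = v 0 i * \int[mu]_z eta z.
    rewrite -S0E => fin; have [ie _] := layer_cake (continuous_borel ce) e01 fin m.
    by rewrite -RintegralZl//; apply: eq_Rintegral => z _; rewrite mxE mulrC.
  by congr (_ - _); apply: Z; rewrite -ge0_fin_numE ?posm_fin ?negm_fin//; exact: eball_borel.
(* All summands are nonnegative by [hD], and at least t (m+1) of the levels lie below [t]; the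
   superlevel sets of these contain [eball x r1]. *)
have main : k * t * fine (mvar (eball x r1)) <=
    m.+1%:R^-1 * \sum_(j < m.+1) edot v (D (sl j)).
  have tm : 0 <= t * m.+1%:R <= m.+1%:R by rewrite mulr_ge0//= ler_piMl.
  have /andP[cl _] := count_lt tm.
  apply: (@le_trans _ _ (m.+1%:R^-1 * \sum_(j < m.+1) (((j%:R < t * m.+1%:R)%R : bool)%:R * (k * fine (mvar (eball x r1)))))).
    rewrite -mulr_suml; set X := fine _ ; set b := \sum_(j < _) _ in cl *.
    have Y0 : 0 <= k * X by rewrite mulr_ge0// fine_ge0.
    have h : t <= m.+1%:R^-1 * b by rewrite ler_pdivlMl// mulrC.
    have -> : k * t * X = t * (k * X) by ring.
    have -> : m.+1%:R^-1 * (b * (k * X)) = (m.+1%:R^-1 * b) * (k * X) by ring.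
    exact: ler_wpM2r.
  rewrite ler_pM2l ?invr_gt0//; apply: ler_sum => j _.
  have [rs rsr slj] := slE j; rewrite slj.
  apply: le_trans (hD _ rsr).
  case: (boolP (j%:R < t * m.+1%:R)) => [jt|_]; last by rewrite mul0r mulr_ge0// fine_ge0.
  rewrite /= mulr1n mul1r; apply: ler_wpM2l => //.
  apply: fine_le; [exact: mvar_fin (eball_borel _ _)|exact: mvar_fin (eball_borel _ _)|].
  have [m1 _] := eball_borel x r1; have [m2 _] := eball_borel x rs.
  apply: le_measure; rewrite ?inE//.
  rewrite -slj => z /in1 tz; rewrite /sl/= (lt_le_trans _ tz)//.
  by rewrite ltr_pdivrMr.
have sE : m.+1%:R^-1 * \sum_(j < m.+1) edot v (D (sl j)) =
  \sum_i v 0 i * (m.+1%:R^-1 * \sum_(j < m.+1) fine (posm i (sl j)) -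
                 m.+1%:R^-1 * \sum_(j < m.+1) fine (negm i (sl j))).
  rewrite /edot exchange_big/= mulr_sumr; apply: eq_bigr => i _.
  rewrite -mulrBr -sumrB [RHS]mulrCA; congr (_ * _); rewrite mulr_sumr; apply: eq_bigr => j _.
  by rewrite (jordan_coord rD i (bsl j)).
have diff : `|vintegral (fun z => eta z *: v) D - m.+1%:R^-1 * \sum_(j < m.+1) edot v (D (sl j))| <= m.+1%:R^-1 * C.
  rewrite vE sE -sumrB (le_trans (ler_norm_sum _ _ _))// /C mulr_sumr.
  apply: ler_sum => i _; rewrite -mulrBr normrM mulrCA ler_wpM2l//.
  by rewrite mulrDr; exact: ler_norm_subB (P i) (Q i).
move: diff; rewrite ler_norml => /andP[d1 _].
move: d1; rewrite lerNl opprB lerBlDl => d1.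
by apply: (le_trans main); apply: (le_trans d1); rewrite lerD2l.
Qed.

End VectorIntegral.

Section BumpFields.
Context {R : realType} {n : nat}.
Local Notation V := 'rV[R]_n.+1.
Implicit Types (x y z w v : V) (f : V -> R) (r : R).

Definition bumpy f (l : R) w r : Prop :=
  [/\ smooth f, 0 <= l, forall x, 0 <= f x <= 1,
    forall x y, `|f x - f y| <= l * enorm (x - y) &
    forall x, f x != 0 -> eball w r x].

Lemma bumpy_bump w r : 0 < r -> bumpy (ebump w r) (4 * r) w r.
Proof.
move=> r0; split.
- exact: smooth_bump.
- by rewrite mulr_ge0// ltW.
- by move=> x; rewrite bump_ge0 bump_le1.
- by move=> x y; exact: bump_lip.
- by move=> x; rewrite /eball/=; apply: contraNT; rewrite -leNgt => h; rewrite bump_eq0.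
Qed.

Lemma bumpy_lipf f l w r v : bumpy f l w r ->
  lipf (fun z => f z *: v) (l * enorm v) (enorm v) (enorm w + r).
Proof.
move=> [sf l0 f01 fl fs]; split; [by rewrite mulr_ge0 ?enorm_ge0|exact: enorm_ge0|].
move=> x y; split.
- by rewrite -scalerBl enormZ mulrAC ler_wpM2r ?enorm_ge0.
- have /andP[h0 h1] := f01 x.
  by rewrite enormZ ger0_norm// ler_piMl ?enorm_ge0.
- rewrite scaler_eq0 negb_or => /andP[/fs]; rewrite /eball/= => h _.
  have := enormD (x - w) w; rewrite subrK; lra.
Qed.

Lemma bumpy_test f l w r v x (s : R) : 0 < s -> bumpy f l w r ->
  test_field (fun z => f (affV x s z) *: v).
Proof.
move=> s0 bf; have [sf l0 f01 fl fs] := bf.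
apply: (@smooth_test_field _ _ _ _ (enorm x + s * (enorm w + r))).
  exact: smooth_aff.
move=> z fz; apply: (le_trans (norm_le_enorm _)).
have -> : z = x + s *: affV x s z by rewrite -[in LHS](aff_inv x z (lt0r_neq0 s0)).
apply: (le_trans (enormD _ _)); rewrite enormZ gtr0_norm// lerD2l ler_pM2l//.
have := fs _ fz; rewrite /eball/= => h.
have := enormD (affV x s z - w) w; rewrite subrK; lra.
Qed.

Lemma affVE x r z : affV x r z = r^-1 *: (z - x).
Proof. by rewrite /affV /aff scalerBr addrC. Qed.

(** The profile is nonincreasing in u, so its superlevel sets are intervals [0, t). For 0 < s < 1
    the bound [t] solves 4 - t^2 = -1/ln s; a negative radicand gives [t = 0], the empty set. *)
Lemma flat_superlevel (s : R) : 0 <= s -> exists t : R, [/\ 0 <= t, t <= 2 &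
  forall u, 0 <= u -> (s < flat (4 - u ^+ 2)) = (u < t)].
Proof.
rewrite le_eqVlt => /predU1P[<-|s0].
  exists 2; split=> // u u0; rewrite flat_gt0 subr_gt0.
  by apply/idP/idP => ?; rewrite ltNge; apply/negP => ?; nra.
have [s1|s1] := leP 1 s.
  exists 0; split=> // u u0; rewrite !ltNge u0 (le_trans (flat_le1 _))//.
have ls : 0 < - ln s by rewrite oppr_gt0 ln_lt0// s0.
pose w0 := (- ln s)^-1; have w00 : 0 < w0 by rewrite invr_gt0.
exists (Num.sqrt (4 - w0)); split; first exact: sqrtr_ge0.
  have -> : 2 = Num.sqrt (2 ^+ 2) :> R by rewrite sqrtr_sqr ger0_norm.
  by rewrite ler_wsqrtr//; lra.
move=> u u0; have -> : (s < flat (4 - u ^+ 2)) = (w0 < 4 - u ^+ 2).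
  rewrite flatE; case: ifP => [w|/negbT]; last first.
    by rewrite -leNgt => w; rewrite !ltNge (ltW s0) (le_trans w (ltW w00)).
  rewrite -{1}(lnK s0) ltr_expR ltrNr /w0 -[X in _ = (_ < X)]invrK.
  by rewrite ltf_pV2 ?posrE ?invr_gt0.
have [h|h] := leP (4 - w0) 0.
  rewrite ler0_sqrtr// [RHS]ltNge u0 ltNge /=; apply/negbF.
  have := sqr_ge0 u; lra.
rewrite -[u in RHS]ger0_norm// -sqrtr_sqr ltr_sqrt//.
by apply/idP/idP => ?; lra.
Qed.

End BumpFields.

Section UpperDensity.
Context {R : realType} {n : nat} (c alpha : R).
Context (halpha : 0 < alpha < 1) (hc : 0 < c).
Local Notation V := 'rV[R]_n.+1.
Local Notation B := (borelType R n).
Local Notation L := (lebesgueType R n).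
Local Notation leb := (@lebesgueN R n).
Context (E : set V) (mE : measurable (E : set L)).
Context (D : set B -> V) (rD : vector_radon D).
Context (gD : is_frac_grad c alpha \1_E D).
Local Notation mvar := (mvar rD).
Implicit Types (x y z w v : V) (r : R).

Lemma fd_pairing_grad (f : V -> V) : test_field f ->
  fd_pairing c alpha E f = - vintegral f D.
Proof. by move=> /gD.2 /(congr1 fine). Qed.

Definition rscale (r : R) : R := r ^+ n.+1 * r `^ (- alpha).

Lemma rscale_gt0 r : 0 < r -> 0 < rscale r.
Proof. by move=> r0; rewrite mulr_gt0 ?exprn_gt0// powR_gt0. Qed.

Lemma rscaleM r (s : R) : 0 <= r -> 0 <= s -> rscale (r * s) = rscale r * rscale s.
Proof. by move=> r0 s0; rewrite /rscale exprMn powRM//; ring. Qed.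

Lemma vintegral_bumpy_affV f l w rho v x r : 0 < r -> bumpy f l w rho ->
  vintegral (fun z => f (affV x r z) *: v) D =
  - (rscale r * fd_pairing c alpha (blow_up E x r) (fun z => f z *: v)).
Proof.
move=> r0 bf; have e := fd_pairing_grad (bumpy_test v x r0 bf).
have e2 := fd_pairing_affV halpha hc x r0 (bumpy_lipf v bf) mE.
have e3 : - vintegral (fun z => f (affV x r z) *: v) D = rscale r * fd_pairing c alpha (blow_up E x r) (fun z => f z *: v).
  exact: etrans (esym e) e2.
by rewrite -e3 opprK.
Qed.

(** The bound is the L^1 norm of the divergence, common to all sets and so to all blow-ups. *)
Lemma fd_pairing_bound f l M rho : lipf f l M rho -> exists2 C : R, 0 <= C &
  forall A, measurable (A : set L) -> `|fd_pairing c alpha A f| <= C.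
Proof.
move=> lf; have ig := integrable_frac_div halpha hc lf.
exists (\int[leb]_x `|frac_div c alpha f x|); first by apply: Rintegral_ge0.
move=> A mA; have m := measurable_pairing halpha hc lf mA.
have le x : `|\1_A x * frac_div c alpha f x| <= `|frac_div c alpha f x|.
  by rewrite normrM indicE ger0_norm ?ler0n// ler_piMl//; case: (_ \in _).
exact: (Rintegral_dominated m (integrable_abse ig) le).
Qed.

(** The quotient v . D(B) / |D|(B) tends to |v|^2 = 1, so it is eventually at least 1/2; replacing
    |D| by [mvar] costs the factor N. Radii r <= 0 are allowed because superlevel sets of bumps may
    be empty. *)
Lemma directed_balls x v : msupp (total_var D) x -> enorm v = 1 ->
  (fun r : R => (fine (total_var D (eball x r)))^-1 *: D (eball x r)) @ 0^'+ --> v ->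
  exists2 r0 : R, 0 < r0 & forall r, r < r0 ->
    (2 * n.+1%:R)^-1 * fine (mvar (eball x r)) <= edot v (D (eball x r)).
Proof.
move=> sx v1 cv.
have N0 : (0 : R) < n.+1%:R by [].
(* A maximum-norm distance below 1/(2N) gives a Euclidean distance below 1/2. *)
have d0 : 0 < (2 * n.+1%:R)^-1 :> R by rewrite invr_gt0 mulr_gt0.
have nb : nbhs v (ball v (2 * n.+1%:R)^-1) by apply: nbhsx_ballx.
have [r0 /= r00 hr] := cv _ nb.
exists r0 => // r rr0.
have [r0'|rp] := leP r 0.
  have -> : eball x r = set0.
    by apply/seteqP; split => // z; rewrite /eball/= ltNge (le_trans r0' (enorm_ge0 _)).
  rewrite (_ : D set0 = 0); last first.
    by apply/rowP => i; rewrite mxE; exact: (sradon0 (@comp_radon _ _ D rD i)).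
  by rewrite measure0 mulr0 edotC edot0l.
have bB := eball_borel x r.
have tvf := total_var_fin rD bB.
have tv0 : 0 < fine (total_var D (eball x r)).
  by rewrite fine_gt0// sx//= -ge0_fin_numE// ltW// sx.
have := hr r; rewrite /= sub0r normrN gtr0_norm// => /(_ rr0 rp).
set T := fine _ in tv0 *; set W := D _.
rewrite -ball_normE/= => h.
have hN : enorm (v - T^-1 *: W) < 2^-1.
  apply: (le_lt_trans (enorm_le_norm _)).
  by rewrite -ltr_pdivlMl// -invfM [n.+1%:R * 2]mulrC.
have h2 : 2^-1 <= edot v (T^-1 *: W).
  have -> : T^-1 *: W = v - (v - T^-1 *: W) by rewrite opprB addrCA subrr addr0.
  rewrite edotBr -enorm_sqr v1 expr1n.
  have := edot_le v (v - T^-1 *: W); rewrite v1 mul1r; lra.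
move: h2; rewrite edotZr ler_pdivlMl// => h2.
apply: le_trans h2.
have := mvar_le rD bB; rewrite -(fineK tvf) -(fineK (mvar_fin rD bB)) -EFinM lee_fin.
rewrite -/T => h3; rewrite invfM -mulrA [leRHS]mulrC ler_pM2l ?invr_gt0//.
by rewrite ler_pdivrMl.
Qed.

(** [D] is tested with a bump on [eball x (2 * r)] in the direction [v]. From below this gives a
    fixed fraction of the mass of [eball x r]; by scaling it is, up to sign, [rscale r] times a
    uniformly bounded pairing. *)
Lemma upper_density x v : msupp (total_var D) x -> enorm v = 1 ->
  (fun r : R => (fine (total_var D (eball x r)))^-1 *: D (eball x r)) @ 0^'+ --> v ->
  exists C r0 : R, [/\ 0 < C, 0 < r0 & forall r, 0 < r -> r < r0 ->
    fine (mvar (eball x r)) <= C * rscale r].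
Proof.
move=> sx v1 cv; have [r0 r00 hr] := directed_balls sx v1 cv.
have two : (0 : R) < 2 by [].
have bf := bumpy_bump (0 : V) two.
have [C0 C00 hC] := fd_pairing_bound (bumpy_lipf v bf).
pose k : R := (2 * n.+1%:R)^-1.
have k0 : 0 < k by rewrite invr_gt0 mulr_gt0.
(* The value of the unscaled bump of radius 2 at distance 1 from its centre, its minimum on the
   inner ball. *)
pose t : R := flat 3.
have t0 : 0 < t by rewrite flat_gt0.
have t1 : t <= 1 by exact: flat_le1.
(* Halving [r0] keeps the support of the bump, of radius 2 r, among the directed balls. *)
exists ((C0 + 1) / (k * t)), (r0 / 2); split.
- by rewrite divr_gt0 ?mulr_gt0//; lra.
- by rewrite divr_gt0.
move=> r rp rr.
have := @vintegral_radial_ge _ _ D rD (fun z => ebump 0 2 (affV x r z)) v x (2 * r) r k t.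
move=> /(_ _ _ (ltW k0) _ _ _ _) h.
have etaE z : ebump 0 2 (affV x r z) = flat (4 - (enorm (z - x) / r) ^+ 2).
  rewrite /ebump subr0 affVE enormZ gtr0_norm ?invr_gt0// mulrC.
  by rewrite [2 ^+ 2](_ : _ = 4)//; ring.
have main : k * t * fine (mvar (eball x r)) <= vintegral (fun z => ebump 0 2 (affV x r z) *: v) D.
  apply: h.
  - by apply: smooth_continuous; apply: smooth_aff; exact: smooth_bump.
  - by move=> z; rewrite bump_ge0 bump_le1.
  - by rewrite ltW.
  - move=> s s0; have [rs [rs0 rs2 hrs]] := flat_superlevel s0.
    exists (r * rs); first by rewrite mulrC ler_pM2r.
    apply/seteqP; split => z; rewrite /eball/= etaE hrs ?divr_ge0 ?enorm_ge0 ?(ltW rp)//;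
      by rewrite ltr_pdivrMr// mulrC.
  - move=> z; rewrite /eball/= etaE => h2; apply: flat_homo.
    have u1 : enorm (z - x) / r <= 1 by rewrite ler_pdivrMr// mul1r ltW.
    have u0 : 0 <= enorm (z - x) / r by rewrite divr_ge0 ?enorm_ge0// ltW.
    nra.
  - by move=> rs rsr; apply: hr; lra.
rewrite (vintegral_bumpy_affV v x rp bf) in main.
have hb := hC _ (measurable_blow_up x rp mE).
have S0 := rscale_gt0 rp.
rewrite mulrAC ler_pdivlMr ?mulr_gt0// mulrC.
apply: (le_trans main); rewrite -mulrN mulrC ler_pM2r//.
move: hb; rewrite ler_norml => /andP[hb _]; lra.
Qed.

End UpperDensity.

(** * Detection of the gradient by bump fields *)

Section Detection.
Context {R : realType} {n : nat}.
Local Notation V := 'rV[R]_n.+1.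
Local Notation B := (borelType R n).
Implicit Types (x y z w v : V) (f g : V -> R) (r : R).

(* A pi-system generating the Borel sets; the functions [flat (k * f)] increase to the
   indicator function of [[set x | 0 < f x]] as [k] grows. *)
Definition bumpy_open : set (set V) :=
  [set U | exists f l w r, bumpy f l w r /\ U = [set x | 0 < f x]].

Lemma bumpyM f l w r g l' w' r' : bumpy f l w r -> bumpy g l' w' r' ->
  bumpy (fun x => f x * g x) (l + l') w r.
Proof.
move=> [sf l0 f01 fl fs] [sg l0' g01 gl gs]; split.
- exact: smoothM.
- exact: addr_ge0.
- move=> x; have /andP[a1 a2] := f01 x; have /andP[b1 b2] := g01 x.
  by rewrite mulr_ge0//= mulr_ile1.
- move=> x y; have /andP[a1 a2] := f01 y; have /andP[b1 b2] := g01 x.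
  have -> : f x * g x - f y * g y = (f x - f y) * g x + f y * (g x - g y) by ring.
  apply: (le_trans (ler_normD _ _)); rewrite !normrM mulrDl; apply: lerD.
    by rewrite -[leRHS]mulr1 ler_pM// ger0_norm.
  by rewrite -[leRHS]mul1r ler_pM// ger0_norm.
- by move=> x; rewrite mulf_eq0 negb_or => /andP[/fs].
Qed.

Lemma bumpy_flat f l w r (k : nat) : bumpy f l w r ->
  bumpy (fun x => flat (k%:R * f x)) (2 * (k%:R * l)) w r.
Proof.
move=> [sf l0 f01 fl fs]; split.
- by apply: smooth_flat_exp; apply: smoothM => //; exact: smooth_cst.
- by rewrite !mulr_ge0.
- by move=> x; rewrite flat_ge0 flat_le1.
- move=> x y; apply: (le_trans (flat_lip _ _)); rewrite -[leRHS]mulrA ler_pM2l//.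
  by rewrite -mulrBr normrM ger0_norm// -mulrA ler_wpM2l.
- move=> x h; apply: fs; apply: contraNneq h => ->.
  by rewrite mulr0 flat0.
Qed.

Lemma bumpy_open_eball w r : 0 < r -> bumpy_open (eball w r).
Proof.
move=> r0; exists (ebump w r), (4 * r), w, r; split; first exact: bumpy_bump.
by apply/seteqP; split => z; rewrite /eball/= bump_gt0.
Qed.

Lemma bumpy_openI : setI_closed bumpy_open.
Proof.
move=> _ _ [f [l [w [r [bf ->]]]]] [g [l' [w' [r' [bg ->]]]]].
exists (fun x => f x * g x), (l + l'), w, r; split; first exact: bumpyM bg.
have [_ _ f01 _ _] := bf; have [_ _ g01 _ _] := bg.
apply/seteqP; split => x /=; first by move=> [? ?]; rewrite mulr_gt0.
have /andP[a1 a2] := f01 x; have /andP[b1 b2] := g01 x.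
move=> h; rewrite !lt_neqAle a1 b1 !andbT !(eq_sym 0).
by split; apply: contraTneq h => ->; rewrite ?mul0r ?mulr0 ltxx.
Qed.

Lemma bumpy_open_borel U : bumpy_open U -> measurable (U : set B).
Proof.
move=> [f [l [w [r [[sf _ _ _ _] ->]]]]]; apply: open_borel.
rewrite (_ : [set x | _] = f @^-1` [set t | 0 < t])//.
apply: open_comp; last exact: open_gt.
by move=> x _; exact: smooth_continuous.
Qed.

Lemma open_bumpy_sigma U : open U -> <<s bumpy_open >> U.
Proof.
move=> oU; pose GT : sigmaRingType bumpy_open.-sigma := g_sigma_algebraType bumpy_open.
have -> : U = \bigcup_(p : 'rV[rat]_n.+1 * nat)
    (if `[< eball (ratV p.1) p.2.+1%:R^-1 `<=` U >] then eball (ratV p.1) (p.2.+1%:R^-1 : R) else set0).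
  apply/seteqP; split => [x Ux|x [p _]]; last by case: asboolP => // h /h.
  have /nbhs_ballP[d /= d0 xd] := open_nbhs_nbhs (conj oU Ux).
  pose k := Num.truncn (2 / d).
  have k0 : (0 : R) < k.+1%:R^-1 by rewrite invr_gt0.
  have kd : (k.+1%:R^-1 : R) < d / 2.
    by rewrite -[ltRHS]invf_div ltf_pV2 ?posrE ?divr_gt0//; exact: truncnS_gt.
  have kN0 : (0 : R) < k.+1%:R^-1 / n.+1%:R by rewrite divr_gt0.
  have [q xq] := ratV_dense x kN0.
  have h1 : eball (ratV q) k.+1%:R^-1 x by apply: ball_sub_eball; exact: ball_sym.
  exists (q, k) => //=; case: asboolP => // nsub; exfalso; apply: nsub.
  move=> y yq; apply: xd; apply: eball_sub_ball; rewrite /eball/= in h1 yq *.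
  have := enormD (y - ratV q) (ratV q - x); rewrite addrA subrK (enorm_distC (ratV q) x) => h.
  by apply: (le_lt_trans h); rewrite [d]splitr ltrD//; exact: lt_trans kd.
apply: (@countable_bigcupT_measurable _ GT) => [|p]; first exact: countableP.
case: asboolP => _; last exact: (@measurable0 _ GT).
apply: (@sub_sigma_algebra _ setT bumpy_open); apply: bumpy_open_eball.
by rewrite invr_gt0.
Qed.

Lemma borel_bumpy (A : set B) : measurable A -> <<s bumpy_open >> A.
Proof.
move=> mA; apply: (@smallest_sub _ (sigma_algebra setT) open _ _ _ _ mA).
  exact: smallest_sigma_algebra.
exact: open_bumpy_sigma.
Qed.

(** The factor [ebump y d] confines the approximating functions to the ball, so that they are
    admissible in [detect], and the indicator of the ball dominates them. *)
Lemma superlevel_limit (mu : {measure set B -> \bar R}) f l w r y (d : R) :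
  0 < d -> (mu (eball y d) < +oo)%E -> bumpy f l w r ->
  (fun k : nat => \int[mu]_x flat (k%:R * (f x * ebump y d x))) @ \oo -->
  fine (mu ([set x | (0 < f x)%R] `&` eball y d)).
Proof.
move=> d0 fin bf; have bb := bumpyM bf (bumpy_bump y d0).
have [sf l0 f01 fl fs] := bf.
have mS : measurable ([set x | 0 < f x] `&` eball y d : set B).
  apply: measurableI; last exact: (eball_borel _ _).1.
  by apply: bumpy_open_borel; exists f, l, w, r.
have mE : measurable (eball y d : set B) by exact: (eball_borel _ _).1.
have -> : fine (mu ([set x | (0 < f x)%R] `&` eball y d)) =
   \int[mu]_x (\1_([set x | (0 < f x)%R] `&` eball y d) x : R).
  by rewrite /Rintegral integral_indic ?setIT.
have ii : mu.-integrable setT (EFin \o (\1_(eball y d) : B -> R)).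
  apply: integrable_ge0; first exact: measurable_indic.
    by move=> x; rewrite indicE ler0n.
  by rewrite integral_indic ?setIT.
apply: (dominated_cvg_Rintegral _ _ _ ii).
- move=> k; apply: continuous_borel; apply: smooth_continuous.
  by have [] := bumpy_flat k bb.
- exact: measurable_indic.
- move=> x; rewrite indicE.
  have [fx|fx] := ltP 0 (f x); last first.
    have -> : f x = 0 by have /andP[h _] := f01 x; apply/eqP; rewrite eq_le fx.
    rewrite memNset; last by move=> [/=]; rewrite ltNge fx.
    by apply: cvg_near_cst; apply: nearW => k; rewrite mul0r mulr0 flat0.
  have [dx|dx] := ltP (enorm (x - y)) d.
    rewrite mem_set//; apply: flat_cvg1; rewrite mulr_gt0// bump_gt0//.
  rewrite memNset; last by move=> [_]; rewrite /eball/= ltNge dx.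
  by apply: cvg_near_cst; apply: nearW => k; rewrite bump_eq0// !mulr0 flat0.
- move=> k x; rewrite ger0_norm ?flat_ge0// indicE.
  have [dx|dx] := ltP (enorm (x - y)) d; first by rewrite mem_set// flat_le1.
  by rewrite bump_eq0// !mulr0 flat0// ler0n.
Qed.

Section detect.
Context (c alpha : R) (F : set V) (D : set B -> V) (rD : vector_radon D).
Context (gD : is_frac_grad c alpha \1_F D).

Lemma vintegral_delta f (i : 'I_n.+1) :
  vintegral (fun z => f z *: delta_mx 0 i) D =
  \int[posm rD i]_x f x - \int[negm rD i]_x f x.
Proof.
rewrite (vintegralE rD) (bigD1 i)//= big1 ?addr0.
  by congr (_ - _); apply: eq_Rintegral => z _; rewrite !mxE !eqxx mulr1.
have Z (mu : {measure set B -> \bar R}) j : j != i ->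
    \int[mu]_x ((f x *: delta_mx 0 i) 0 j) = 0.
  move=> ji; rewrite -[RHS](mul0r (fine (mu setT))) -Rintegral_cst//.
  by apply: eq_Rintegral => z _; rewrite !mxE (negbTE ji) mulr0.
by move=> j ji; rewrite !Z// subrr.
Qed.

(** If all these pairings vanish, the two variations of each component have the same integrals of
    bumps in the ball, hence agree on the pi-system, hence on Borel subsets of the ball; by the
    Jordan decomposition [D] vanishes there. *)
Lemma detect y (d : R) : 0 < d -> (0 < total_var D (eball y d))%E ->
  exists f l w r (i : 'I_n.+1), [/\ bumpy f l w r, forall z, f z != 0 -> eball y d z &
    fd_pairing c alpha F (fun z => f z *: delta_mx 0 i) != 0].
Proof.
move=> d0; apply: contraPP => H; apply/negP; rewrite -leNgt.
have bB := eball_borel y d.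
have mB : measurable (eball y d : set B) by exact: bB.1.
have H0 f l w r i : bumpy f l w r -> (forall z, f z != 0 -> eball y d z) ->
    \int[posm rD i]_x f x = \int[negm rD i]_x f x.
  move=> bf fs; have : fd_pairing c alpha F (fun z => f z *: delta_mx 0 i) = 0.
    apply/eqP; apply: contrapT => /negP h.
    by apply: H; exists f, l, w, r, i.
  have tf : test_field (fun z => f z *: (delta_mx 0 i : V)).
    have := bumpy_test (delta_mx 0 i) 0 ltr01 bf.
    rewrite (_ : (fun z => _) = fun z => f z *: (delta_mx 0 i : V))//.
    by apply/funext => z; rewrite affVE invr1 scale1r subr0.
  rewrite (fd_pairing_grad gD tf) vintegral_delta => /eqP.
  by rewrite oppr_eq0 subr_eq0 => /eqP.
have pf i : (posm rD i (eball y d) < +oo)%E by rewrite -ge0_fin_numE// posm_fin.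
have nf i : (negm rD i (eball y d) < +oo)%E by rewrite -ge0_fin_numE// negm_fin.
have H1 i U : bumpy_open U -> posm rD i (U `&` eball y d) = negm rD i (U `&` eball y d).
  move=> oU; have mU := bumpy_open_borel oU.
  have [f [l [w [r [bf UE]]]]] := oU.
  have bUB : bounded_borel (U `&` eball y d).
    by apply: (bounded_borelS bB); [exact: measurableI|exact: subIsetr].
  have := superlevel_limit d0 (nf i) bf; have := superlevel_limit d0 (pf i) bf.
  rewrite -UE => c1 c2.
  have e : (fun k : nat => \int[posm rD i]_x flat (k%:R * (f x * ebump y d x))) =
      (fun k : nat => \int[negm rD i]_x flat (k%:R * (f x * ebump y d x))).
    apply/funext => k; have bb := bumpyM bf (bumpy_bump y d0).
    apply: (H0 _ _ _ _ _ (bumpy_flat k bb)) => z h.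
    have [_ _ _ _ hs] := bumpy_bump y d0; apply: hs.
    by apply: contraNneq h => ->; rewrite !mulr0 flat0.
  have fe : fine (posm rD i (U `&` eball y d)) = fine (negm rD i (U `&` eball y d)).
    rewrite e in c1; rewrite -(cvg_lim (@Rhausdorff R) c1).
    exact: (cvg_lim (@Rhausdorff R) c2).
  by rewrite -(fineK (posm_fin rD i bUB)) fe fineK// negm_fin.
have H2 i (A : set B) : measurable A -> posm rD i (A `&` eball y d) = negm rD i (A `&` eball y d).
  move=> mA.
  have gp (k : nat) : (0 : R) < k.+1%:R by [].
  (* Both measures are restricted to the ball, hence finite; the balls about 0 exhaust the space
     within the pi-system. *)
  have u := @g_sigma_algebra_measure_unique _ R B bumpy_open bumpy_open_borel
    (fun k : nat => eball (0 : V) (k.+1%:R : R)) (fun k => bumpy_open_eball 0 (gp k)) _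
    (mrestr (posm rD i) mB) (mrestr (negm rD i) mB) bumpy_openI (H1 i) _ A (borel_bumpy mA).
  apply: u.
  - apply/seteqP; split => // x _; exists (Num.truncn (enorm x)) => //.
    by rewrite /eball/= subr0 truncnS_gt.
  - move=> k; rewrite /mrestr/=; apply: le_lt_trans (pf i).
    have [mk _] := eball_borel (0 : V) (k.+1%:R : R).
    have mk2 : measurable (eball 0 k.+1%:R `&` eball y d : set B) by exact: measurableI.
    by apply: le_measure; rewrite ?inE//; exact: subIsetr.
apply: ge_ereal_sup => _ [G [bG tG GB] <-].
rewrite eseries0// => k _ _.
have bk := bG k.
have kB : G k `<=` eball y d by move=> x Gx; apply: GB; exists k.
suff -> : D (G k) = 0 by rewrite enorm0.
apply/rowP => i; rewrite mxE (jordan_coord rD i bk).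
have := H2 i (G k) bk.1; rewrite setIidl// => ->.
by rewrite subrr.
Qed.

End detect.
End Detection.

(** * Porous sets are null *)

Section Vitali.
Context {R : realType} {n : nat}.
Local Notation V := 'rV[R]_n.+1.
Local Notation B := (borelType R n).

Lemma balls_meet_radii (x y : V) (r s : R) :
  ball x r `&` ball y s !=set0 -> r <= 2 * s -> ball y (3 * s) x.
Proof.
move=> [z []]; rewrite -!ball_normE/= => xz yz rs.
have := ler_normD (y - z) (z - x).
by rewrite addrA subrK (distrC z x); lra.
Qed.

(** Only the centres have to be covered: if balls of radii r <= 2 s meet, their centres are closer
    than r + s <= 3 s. *)
Lemma vitali_cover (F : set (V * R)) : (forall i, F i -> 0 < i.2 <= 1) ->
  exists D : set (V * R), [/\ D `<=` F,
    trivIset D (fun i => ball i.1 i.2) &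
    forall i, F i -> exists2 j, D j & ball j.1 (3 * j.2) i.1].
Proof.
move=> F01.
pose meets (i j : V * R) := ball i.1 i.2 `&` ball j.1 j.2 !=set0.
(* Zorn's lemma is applied to disjoint families such that a ball of [F] meeting the family meets a
   member of at least half its radius. This property is kept under unions of chains, and maximality
   will make every ball of [F] meet the family. *)
pose good (D : set (V * R)) := [/\ D `<=` F, trivIset D (fun i => ball i.1 i.2) &
  forall i, F i -> (exists2 j, D j & meets i j) -> exists j, [/\ D j, meets i j & i.2 <= 2 * j.2]].
have [D [[DF tD hD] maxD]] : exists D, good D /\ forall D', D `<` D' -> ~ good D'.
  apply: Zorn_bigcup => C CG totC; split.
  - by move=> i [D CD Di]; have [DF _ _] := CG D CD; exact: DF.
  - move=> i j [D CD Di] [D' CD' Dj].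
    have [DD'|DD'] := totC _ _ CD CD'.
      by have [_ tD _] := CG D' CD'; apply: tD => //; exact: DD'.
    by have [_ tD _] := CG D CD; apply: tD => //; exact: DD'.
  - move=> i Fi [j [D CD Dj] ij]; have [_ _ h] := CG D CD.
    have [k [Dk ik le]] := h i Fi (ex_intro2 _ _ j Dj ij).
    by exists k; split=> //; exists D.
exists D; split=> // i Fi.
have [mi|nmi] := pselect (exists2 j, D j & meets i j).
  have [j [Dj ij le]] := hD i Fi mi.
  by exists j => //; exact: balls_meet_radii ij le.
exfalso.
(* Radii of the balls that miss the family. One of more than half their supremum can be added,
   against maximality. *)
pose S := [set j.2 | j in [set j | F j /\ ~ exists2 k, D k & meets j k]].
have Si : S i.2 by exists i.
have Sub : has_sup S.
  split; first by exists i.2.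
  by exists 1 => _ [j [Fj _] <-]; have /andP[] := F01 j Fj.
have supS0 : 0 < sup S.
  apply: (@lt_le_trans _ _ i.2); first by have /andP[] := F01 i Fi.
  by apply: sup_upper_bound.
have s20 : 0 < sup S / 2 by rewrite divr_gt0.
have [_ [j [Fj nj] <-] jS] := sup_adherent s20 Sub.
have {}jS : sup S < 2 * j.2 by lra.
have jj : meets j j.
  have /andP[j0 _] := F01 j Fj.
  by exists j.1; split; exact: ballxx.
apply: (maxD (D `|` [set j])).
  split; first by left.
  by move=> /(_ j); apply: contra_not nj => h; exists j => //; apply: h; right.
split.
- by move=> k [/DF//|->].
- move=> k l [Dk|->] [Dl|->] //=; first exact: tD.
    by move=> kl; exfalso; apply: nj; exists k => //; rewrite /meets setIC.
  by move=> jl; exfalso; apply: nj; exists l.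
move=> k Fk [l [Dl kl|->{l} kj]].
  have [m [Dm km le]] := hD k Fk (ex_intro2 _ _ l Dl kl).
  by exists m; split=> //; left.
have [mk|nmk] := pselect (exists2 j, D j & meets k j).
  have [m [Dm km le]] := hD k Fk mk.
  by exists m; split=> //; left.
exists j; split=> //; first by right.
apply: ltW; apply: le_lt_trans jS; apply: sup_upper_bound => //.
by exists k.
Qed.

(* Disjoint balls contain distinct rational points. *)
Lemma disjoint_balls_inj (D : set (V * R)) : (forall i, D i -> 0 < i.2) ->
  trivIset D (fun i => ball i.1 i.2) ->
  exists f : V * R -> nat, forall i j, D i -> D j -> f i = f j -> i = j.
Proof.
move=> D0 tD.
have h (i : V * R) : exists q : 'rV[rat]_n.+1, D i -> ball i.1 i.2 (ratV q).
  have [Di|] := pselect (D i); last by exists 0.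
  by have [q] := ratV_dense i.1 (D0 i Di); exists q.
have [q hq] := choice h.
exists (pickle \o q) => i j Di Dj /= /(pcan_inj pickleK) e.
apply: tD => //; exists (ratV (q i)); split; first exact: hq.
by rewrite e; exact: hq.
Qed.

Context (mu : {measure set B -> \bar R}).
Context (mu_fin : forall A : set B, bounded_borel A -> (mu A < +oo)%E).

(** [U] is an open superset of [A] whose mass is within [e] of the infimum. Without finitely many
    holes it is still a competitor, so the disjoint holes have total mass at most [e], and the
    tripled balls, which cover [A], at most [C * e]. *)
Lemma porous_small (A : set V) (C m e : R) : 0 <= C -> 0 < e -> A `<=` ball 0 m ->
  (forall x (r : R), A x -> 0 < r -> exists rho, exists H : set V,
    [/\ 0 < rho < r, closed H, H `<=` ball x rho, H `&` A = set0 &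
      (mu (ball x (3 * rho)) <= C%:E * mu H)%E]) ->
  exists W : set V, [/\ open W, A `<=` W & (mu W <= (C * e)%:E)%E].
Proof.
move=> C0 e0 Am hA.
pose opens := [set U : set V | [/\ open U, A `<=` U & U `<=` ball 0 m]].
have bo U : opens U -> bounded_borel (U : set B).
  move=> [oU _ Um]; split; first exact: open_borel.
  apply: bounded_setS Um _; apply/bounded_setE; exists m => x.
  by rewrite -ball_normE/= sub0r normrN => /ltW.
pose om := ereal_inf [set mu U | U in opens].
have om_fin : om \is a fin_num.
  have o0 : opens (ball 0 m) by split=> //; exact: ball_open.
  rewrite ge0_fin_numE; last by apply: le_ereal_inf_tmp => _ [U _ <-].
  by apply: le_lt_trans (mu_fin (bo _ o0)); apply: ereal_inf_lbound; exists (ball 0 m).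
have [_ [U oU <-] Ue] := lb_ereal_inf_adherent e0 om_fin.
have [oU1 AU Um] := oU.
pose isH (i : V * R) (H : set V) := [/\ closed H, H `<=` ball i.1 i.2, H `&` A = set0 &
      (mu (ball i.1 (3 * i.2)) <= C%:E * mu H)%E].
pose F := [set i : V * R | [/\ A i.1, 0 < i.2 <= 1, ball i.1 i.2 `<=` U & exists H, isH i H]].
have F01 i : F i -> 0 < i.2 <= 1 by case.
have [D [DF tD covD]] := vitali_cover F01.
have D0 i : D i -> 0 < i.2 by move=> /DF/F01/andP[].
have [f finj] := disjoint_balls_inj D0 tD.
have ch (i : V * R) : exists H, D i -> isH i H.
  have [Di|] := pselect (D i); last by exists set0.
  by have [_ _ _ [H hH]] := DF i Di; exists H.
have [hole holeP] := choice ch.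
have ex (k : nat) : exists o : option (V * R), (forall i, o = Some i -> D i /\ f i = k) /\
    (forall i, D i -> f i = k -> o = Some i).
  have [[i [Di fi]]|no] := pselect (exists i, D i /\ f i = k).
    exists (Some i); split; first by move=> _ [<-].
    by move=> j Dj fj; congr Some; apply: finj => //; rewrite fi.
  by exists None; split=> // i Di fi; exfalso; apply: no; exists i.
have [idx idxP] := choice ex.
pose G k : set V := if idx k is Some i then ball i.1 (3 * i.2) else set0.
pose H k : set V := if idx k is Some i then hole i else set0.
have oG k : open (G k) by rewrite /G; case: (idx k) => [i|]; [exact: ball_open|exact: open0].
have cH k : closed (H k).
  rewrite /H; case E : (idx k) => [i|]; last exact: closed0.
  by have [/(_ i E)[/holeP[]]] := idxP k.
have mG k : measurable (G k : set B) by exact: open_borel.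
have mH k : measurable (H k : set B) by exact: closed_borel.
have HU k : H k `<=` U.
  rewrite /H; case E : (idx k) => [i|]; last by [].
  have [/(_ i E)[Di _] _] := idxP k; have [_ hi _ _] := holeP i Di.
  by have [_ _ bU _] := DF i Di; exact: subset_trans bU.
have HA k : H k `&` A = set0.
  rewrite /H; case E : (idx k) => [i|]; last by rewrite set0I.
  have [/(_ i E)[Di _] _] := idxP k; by have [] := holeP i Di.
have GH k : (mu (G k) <= C%:E * mu (H k))%E.
  rewrite /G /H; case E : (idx k) => [i|]; last by rewrite measure0 mule0.
  have [/(_ i E)[Di _] _] := idxP k; by have [] := holeP i Di.
have tH : trivIset setT H.
  move=> k l _ _; rewrite /H; case Ek : (idx k) => [i|]; last by rewrite set0I => -[].
  case El : (idx l) => [j|]; last by rewrite setI0 => -[].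
  have [/(_ i Ek)[Di fi] _] := idxP k; have [/(_ j El)[Dj fj] _] := idxP l.
  move=> [z [zi zj]]; have [_ hi _ _] := holeP i Di; have [_ hj _ _] := holeP j Dj.
  have ij : i = j by apply: tD => //; exists z; split; [exact: hi|exact: hj].
  by rewrite -fi -fj ij.
exists (\bigcup_k G k); split.
- by apply: bigcup_open => k _; exact: oG.
- move=> x Ax.
  have /nbhs_ballP[d /= d0 xd] := open_nbhs_nbhs (conj oU1 (AU x Ax)).
  have d1 : 0 < Num.min d 1 by rewrite lt_min d0 ltr01.
  have [rho [K [/andP[r0 rr] cK Kb KA KC]]] := hA x _ Ax d1.
  have Fx : F (x, rho).
    split=> //=; last by exists K.
      by rewrite r0 ltW// (lt_le_trans rr)// ge_min lexx orbT.
    apply: subset_trans xd; apply: le_ball; apply/ltW/(lt_le_trans rr).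
    by rewrite ge_min lexx.
  have [j Dj xj] := covD _ Fx.
  exists (f j) => //; rewrite /G; have [_ /(_ j Dj erefl) ->] := idxP (f j).
  exact: xj.
(* Finite unions of holes are closed, so removing them leaves an open set; the bound then passes to
   the series. *)
have partial (k : nat) : (\sum_(0 <= i < k) mu (H i) <= e%:E)%E.
  rewrite big_mkord.
  have mHk : measurable (\big[setU/set0]_(i < k) H i : set B) by exact: bigsetU_measurable.
  have HkU : \big[setU/set0]_(i < k) H i `<=` U.
    by move=> z; rewrite -bigcup_mkord => -[i _ /HU].
  have o' : opens (U `\` \big[setU/set0]_(i < k) H i).
    split.
    - rewrite setDE; apply: openI => //; apply: closed_openC.
      by apply: closed_bigsetU.
    - move=> z Az; split; first exact: AU.
      rewrite -bigcup_mkord => -[i _ Hz].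
      by have : (H i `&` A) z by []; rewrite HA.
    - by move=> z [/Um].
  have le1 : (om <= mu (U `\` \big[setU/set0]_(i < k) H i))%E.
    by apply: ereal_inf_lbound; exists (U `\` \big[setU/set0]_(i < k) H i).
  have mU : measurable (U : set B) by exact: open_borel.
  have Ufin : (mu U < +oo)%E by apply: mu_fin; exact: bo.
  have Hfin : mu (\big[setU/set0]_(i < k) H i) \is a fin_num.
    rewrite ge0_fin_numE//; apply: le_lt_trans Ufin.
    by apply: le_measure; rewrite ?inE.
  have eD : mu (U `\` \big[setU/set0]_(i < k) H i) = (mu U - mu (\big[setU/set0]_(i < k) H i))%E.
    by rewrite measureD// setIidr.
  have sH : mu (\big[setU/set0]_(i < k) H i) = (\sum_(i < k) mu (H i))%E.
    apply: measure_bigsetU => //; exact: sub_trivIset tH.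
  rewrite -sH.
  have Uf : mu U \is a fin_num by rewrite ge0_fin_numE.
  rewrite eD in le1.
  have ar (o u h : \bar R) : o \is a fin_num -> u \is a fin_num -> h \is a fin_num ->
      (o <= u - h)%E -> (u < o + e%:E)%E -> (h <= e%:E)%E.
    case: o => [a| |] //; case: u => [b| |] //; case: h => [d| |] // _ _ _.
    by rewrite -EFinB -EFinD !lee_fin lte_fin; lra.
  exact: ar om_fin Uf Hfin le1 Ue.
apply: (@le_trans _ _ (\sum_(k <oo) mu (G k))%E).
  by apply: measure_sigma_subadditive => //; exact: bigcupT_measurable.
apply: (@le_trans _ _ (\sum_(k <oo) (C%:E * mu (H k)))%E).
  by apply: lee_nneseries => [k _ _|k _].
rewrite nneseriesZl// EFinM; apply: lee_wpmul2l; first by rewrite lee_fin.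
apply: lime_le; first exact: is_cvg_nneseries.
by apply: nearW => k; exact: partial.
Qed.

Lemma porous_null (A : set V) (C m : R) : 0 <= C -> A `<=` ball 0 m ->
  (forall x (r : R), A x -> 0 < r -> exists rho, exists H : set V,
    [/\ 0 < rho < r, closed H, H `<=` ball x rho, H `&` A = set0 &
      (mu (ball x (3 * rho)) <= C%:E * mu H)%E]) ->
  mu.-negligible (A : set B).
Proof.
move=> C0 Am hA.
have k0 (k : nat) : (0 : R) < k.+1%:R^-1 by rewrite invr_gt0.
have /choice[W hW] k := porous_small C0 (k0 k) Am hA.
exists (\bigcap_k W k); split.
- by apply: bigcap_measurable => [|k _]; [exists 0%N|apply: open_borel; have [] := hW k].
- apply/eqP; rewrite eq_le measure_ge0 andbT.
  apply/lee_addgt0Pr => e e0; rewrite add0e.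
  pose k := Num.truncn (C / e).
  have [oW _ hk] := hW k.
  apply: (@le_trans _ _ (mu (W k))).
    apply: le_measure; rewrite ?inE; last by move=> x; apply.
      by apply: bigcap_measurable => [|j _]; [exists 0%N|apply: open_borel; have [] := hW j].
    exact: open_borel.
  apply: (le_trans hk); rewrite lee_fin ler_pdivrMr// mulrC -ler_pdivrMr//.
  by apply: ltW; exact: truncnS_gt.
- by move=> x Ax k _; have [_ h _] := hW k; exact: h.
Qed.

End Vitali.

(** * Iterated tangent sets *)

Section TangentSets.
Context {R : realType} {n : nat}.
Local Notation V := 'rV[R]_n.+1.
Local Notation L := (lebesgueType R n).
Implicit Types (E F G A B : set V) (x y h w : V) (r : R).

Lemma dm_lt_trans (m : R) B A C (a b : R) : (dm m A B < a%:E)%E -> (dm m B C < b%:E)%E ->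
  (dm m A C < (a + b)%:E)%E.
Proof.
by move=> ab bc; apply: le_lt_trans (dm_triangle m A B C) _; rewrite EFinD; exact: lteD.
Qed.

Lemma blow_up_tr E x w r : 0 < r -> blow_up E (x + r *: w) r = tr w (blow_up E x r).
Proof.
by move=> r0; rewrite !blow_upE//; apply/seteqP; split => z;
  rewrite /tr/aff/= scalerDr addrA.
Qed.

Lemma blow_up_tr0 F y r : 0 < r -> blow_up F y r = blow_up (tr y F) 0 r.
Proof. by move=> r0; rewrite !blow_upE//; apply/seteqP; split => z; rewrite /tr/aff/= add0r. Qed.

Lemma blow_up0M E x r s : 0 < r -> 0 < s ->
  blow_up E x (r * s) = blow_up (blow_up E x r) 0 s.
Proof.
move=> r0 s0; rewrite !blow_upE ?mulr_gt0//; apply/seteqP; split => z;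
  by rewrite /aff/= add0r scalerA.
Qed.

(** The scale s <= 1 maps the window [cube m] into itself; s^-N is the magnification of volume. *)
Lemma dm_blow_up (m s : R) A B : 0 < s -> s <= 1 ->
  (dm m (blow_up A 0 s) (blow_up B 0 s) <= (s ^- n.+1)%:E * dm m A B)%E.
Proof.
move=> s0 s1; rewrite !blow_upE// /dm -(outer_aff 0)//; apply: le_lebesgue_outer.
move=> z [/= AB zm]; split => //; rewrite /cube/aff/= add0r normrZ gtr0_norm//.
by apply: le_trans zm; rewrite ler_piMl// normr_ge0.
Qed.

Lemma Tan_translate E x F y G : measurable (E : set L) -> measurable (F : set L) ->
  Tan E x (tr y F) -> Tan F y G -> Tan E x G.
Proof.
move=> mE mF tF tG.
have [_ [r [r0 rc hr]]] := Tan_dm mE tF.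
have [mG [s [s0 sc hs]]] := Tan_dm mF tG.
apply: TanP => // m; pose e : R := m.+1%:R^-1 / 2.
have e0 : 0 < e by rewrite divr_gt0// invr_gt0.
have [k [hk sk]] : exists k, (dm m%:R (blow_up F y (s k)) G < e%:E)%E /\ s k < 1.
  near \oo => k; exists k; split; near: k; first exact: hs.
  exact: (cvgr_lt _ sc).
(* Zooming in by [s k] magnifies errors by its power -N; so [j] is chosen after [k], with a
   tolerance reduced accordingly. *)
have d0 : 0 < s k ^+ n.+1 * e by rewrite mulr_gt0// exprn_gt0.
have [j [hj rj]] : exists j, (dm m%:R (blow_up E x (r j)) (tr y F) < (s k ^+ n.+1 * e)%:E)%E /\
    r j < m.+1%:R^-1.
  near \oo => j; exists j; split; near: j; first exact: hr.
  by apply: (cvgr_lt _ rc); rewrite invr_gt0.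
exists (r j * s k); split.
- by rewrite mulr_gt0.
- by apply: le_lt_trans rj; rewrite ler_piMr// ltW.
rewrite blow_up_tr0// in hk; rewrite blow_up0M// (splitr m.+1%:R^-1).
apply: dm_lt_trans hk.
apply: le_lt_trans (dm_blow_up _ _ _ (s0 k) (ltW sk)) _.
by rewrite lte_pdivrMl ?exprn_gt0// -EFinM.
Unshelve. all: by end_near. Qed.

(** One integer fixes the window, the range of scales and the distance, so countably many cases
    arise. *)
Definition far (m : nat) E x A := forall r, 0 < r -> r < m.+1%:R^-1 ->
  (m.+1%:R^-1%:E <= dm m%:R (blow_up E x r) A)%E.

Lemma far_Tan E x A : measurable (E : set L) -> measurable (A : set L) ->
  ~ Tan E x A -> exists m, far m E x A.
Proof.
move=> mE mA; apply: contra_notP => h; apply: TanP => // m.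
apply: contrapT => h2; apply: h; exists m => r r0 rm; rewrite leNgt; apply/negP => h3.
by apply: h2; exists r.
Qed.

Lemma separable_dm (m : nat) A (e : R) : 0 < e -> measurable (A : set L) ->
  exists s, (dm m%:R A (rat_ball_set s) < e%:E)%E.
Proof.
move=> e0 mA; have e20 : 0 < e / 2 by rewrite divr_gt0.
have mAm : measurable (A `&` cube m%:R : set L).
  by apply: measurableI => //; exact: measurable_cube.
have [s hs] := separable_sets e20 mAm (outer_cube_fin (@subIsetr _ A (cube m%:R))).
exists s; apply: (@le_lt_trans _ _ (e / 2)%:E); last by rewrite lte_fin; lra.
apply: le_trans hs; apply: le_lebesgue_outer => z [+ zm].
move=> [[Az nGz]|[Gz nAz]]; [by left|by right; split => // -[]].
Qed.

(* Near [x + r y] the blow-ups of [E] resemble [tr y F], whereas at a point far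
   from a set close to [tr y F] they do not. *)
Lemma far_hole (m : nat) E x F y G z (r d e : R) : measurable (E : set L) ->
  0 < r -> r < m.+1%:R^-1 -> e * 4 <= m.+1%:R^-1 ->
  (forall w, `|w - y| < d -> (dm m%:R (tr y F) (tr w F) <= e%:E)%E) ->
  (dm (m%:R + (`|y| + d)) (blow_up E x r) F < e%:E)%E ->
  (dm m%:R (tr y F) G < e%:E)%E -> `|z - (x + r *: y)| < r * d ->
  forall A, (dm m%:R A G < e%:E)%E -> ~ far m E z A.
Proof.
move=> mE r0 rm em hd hb hG hz A hA /(_ r r0 rm).
apply/negP; rewrite -ltNge.
pose w := r^-1 *: (z - x).
have zE : z = x + r *: w.
  by rewrite scalerA mulfV ?gt_eqF// scale1r addrC subrK.
have wy : `|w - y| < d.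
  move: hz; rewrite zE opprD addrACA subrr add0r -scalerBr normrZ gtr0_norm//.
  by rewrite ltr_pM2l.
have wn : `|w| <= `|y| + d.
  have := ler_normD (w - y) y; rewrite subrK; lra.
have {wn}h1 : (dm m%:R (blow_up E z r) (tr w F) < e%:E)%E.
  rewrite zE blow_up_tr//; apply: le_lt_trans (dm_tr _ _ _ _) _.
  by apply: le_lt_trans hb; apply: dm_le; rewrite lerD2l.
have h2 : (dm m%:R (blow_up E z r) (tr y F) < (e + e)%:E)%E.
  apply: le_lt_trans (dm_triangle _ _ (tr w F) _) _.
  have h2' : (dm m%:R (tr w F) (tr y F) <= e%:E)%E by rewrite dmC; exact: hd.
  by apply: le_lt_trans (leeD2l _ h2') _; rewrite EFinD lteD2rE.
have h3 : (dm m%:R G A < e%:E)%E by rewrite dmC.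
(* Four errors of at most [e]: the blow-up at [z] against F - w, F - w against F - y, F - y against
   [G], and [G] against [A]. This is the origin of the factor 4. *)
apply: lt_le_trans (dm_lt_trans (dm_lt_trans h2 hG) h3) _.
rewrite lee_fin; move: em; set q := _^-1; move: q => q; lra.
Qed.

End TangentSets.

Section TangentPorosity.
Context {R : realType} {n : nat} (c alpha : R).
Context (halpha : 0 < alpha < 1) (hc : 0 < c).
Local Notation V := 'rV[R]_n.+1.
Local Notation B := (borelType R n).
Local Notation L := (lebesgueType R n).

Lemma total_var_ge0 (D : set B -> V) A : (0 <= total_var D A)%E.
Proof.
apply: (@le_trans _ _ (\sum_(k <oo) (enorm (D set0))%:E)%E).
  by apply: nneseries_ge0 => k _ _; rewrite lee_fin enorm_ge0.
apply: ereal_sup_ubound; exists (fun=> set0) => //; split=> [k||].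
- exact: bounded_borel0.
- by apply/trivIsetP => i j _ _ _; rewrite set0I.
- by move=> x [].
Qed.

Lemma total_var_zero A : total_var (fun _ : set B => 0 : V) A = 0%E.
Proof.
apply/eqP; rewrite eq_le total_var_ge0 andbT.
by apply: ge_ereal_sup => _ [G _ <-]; rewrite eseries0// => k _ _; rewrite enorm0.
Qed.

Lemma frac_grad0 (u : V -> R) : ~ is_frac_grad c alpha u (frac_grad c alpha u) ->
  frac_grad c alpha u = fun=> 0.
Proof.
by move=> nu; apply: xgetPN => D hD; apply: nu; exact: xgetPex (ex_intro _ D hD).
Qed.

(** The default value 0 of [frac_grad] has empty support, so a support point certifies that the
    gradient exists. In this way the gradient of a tangent set becomes available at a point of its
    reduced boundary. *)
Lemma msupp_frac_grad (u : V -> R) y : msupp (total_var (frac_grad c alpha u)) y ->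
  is_frac_grad c alpha u (frac_grad c alpha u).
Proof.
apply: contraPP => /frac_grad0 -> /(_ 1 ltr01).
by rewrite total_var_zero ltxx.
Qed.

Context (E : set V) (mE : measurable (E : set L)).
Context (D : set B -> V) (rD : vector_radon D).
Context (gD : is_frac_grad c alpha \1_E D).
Local Notation mvar := (mvar rD).
Local Notation scl := (@rscale R n alpha).
Implicit Types (x y z w v : V) (r : R).

(** A field near [y] with nonzero pairing [p] against [F] has a pairing of at least |p|/2 against
    blow-ups close to [F]. Rescaled, it lives in the ball about x + r y and has components bounded
    by 1, so it bounds the mass from below. The constants do not depend on [x] and [r]. *)
Lemma tangent_mass (F : set V) y (d : R) : measurable (F : set L) ->
  frac_boundary c alpha F y -> 0 < d ->
  exists (m : nat) (e a : R), [/\ 0 < e, 0 < a & forall x r, 0 < r ->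
    (dm m%:R (blow_up E x r) F < e%:E)%E ->
    a * scl r <= fine (mvar (eball (x + r *: y) (r * d)))].
Proof.
move=> mF [sy _] d0; have gF := msupp_frac_grad sy.
have [f [l [w [s [i [bf fs fne]]]]]] := detect gF.1 gF d0 (sy d d0).
set p := fd_pairing _ _ _ _ in fne.
have a0 : 0 < `|p| / 2 by rewrite divr_gt0// normr_gt0.
have [m [e e0 he]] := fd_pairing_close halpha hc (bumpy_lipf (delta_mx 0 i) bf) mF a0.
exists m, e, (`|p| / 2); split=> // x r r0 hd.
have := he _ (measurable_blow_up x r0 mE) hd; rewrite -/p => hp.
set q := fd_pairing _ _ _ _ in hp.
have hq : `|p| / 2 <= `|q|.
  have := ler_distD q p 0; rewrite !subr0 distrC; lra.
have S0 : 0 < scl r by exact: rscale_gt0.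
have [sf l0 f01 _ _] := bf.
pose g z := f (affV x r z) *: (delta_mx 0 i : V).
have e1 : `|vintegral g D| = scl r * `|q|.
  by rewrite (vintegral_bumpy_affV halpha hc mE gD (delta_mx 0 i) x r0 bf) normrN normrM gtr0_norm.
have bB := eball_borel (x + r *: y) (r * d).
have h : `|vintegral g D| <= 1 * fine (mvar (eball (x + r *: y) (r * d))).
  apply: vintegral_bound => //.
  - move=> j z; rewrite (_ : (fun z => _) = fun z => f (affV x r z) * (delta_mx 0 i : V) 0 j).
      apply: continuousM; last exact: (@cst_continuous V R ((delta_mx 0 i : V) 0 j) z).
      exact: (smooth_continuous (smooth_aff _ _ sf)).
    by apply/funext => u; rewrite /g mxE.
  - move=> z j; rewrite /g !mxE eqxx/=.
    have /andP[h0 h1] := f01 (affV x r z).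
    by rewrite normrM ger0_norm//; case: (_ == _); rewrite ?normr1 ?normr0 ?mulr1 ?mulr0.
  - move=> z; rewrite /g scaler_eq0 negb_or => /andP[/fs + _].
    rewrite /eball/= affVE => hz.
    have -> : z - (x + r *: y) = r *: (r^-1 *: (z - x) - y).
      by rewrite scalerBr scalerA mulfV ?gt_eqF// scale1r opprD addrA.
    by rewrite enormZ gtr0_norm// ltr_pM2l.
rewrite mul1r e1 in h; apply: le_trans h.
by rewrite mulrC ler_pM2l.
Qed.

(** [F] and [y] vary with the point; the common [G] is what makes a hole found at one point avoid
    all the others. *)
Definition bad (m : nat) (G : set V) : set V :=
  [set x | frac_boundary c alpha E x /\ exists F y,
    [/\ Tan E x F, frac_boundary c alpha F y, far m E x (tr y F) &
        (dm m%:R (tr y F) G < (m.+1%:R^-1 / 4)%:E)%E]].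

Definition hole_at (A : set V) (C : R) x := forall r, 0 < r -> exists rho, exists H : set V,
  [/\ 0 < rho < r, closed H, H `<=` ball x rho, H `&` A = set0 &
      (mvar (ball x (3 * rho)) <= C%:E * mvar H)%E].

Lemma bad_porous (m : nat) (G : set V) x : frac_grad c alpha \1_E = D ->
  bad m G x -> exists C, hole_at (bad m G) C x.
Proof.
move=> DE [[]]; rewrite DE => sx [v [cv v1]] [F [y [tF yF farx hG]]].
have [C0 [r0 [C00 r00 hC0]]] := upper_density halpha hc mE rD gD sx v1 cv.
have [mF [rk [rk0 rkc hrk]]] := Tan_dm mE tF.
pose e : R := m.+1%:R^-1 / 4.
have e0 : 0 < e by rewrite divr_gt0// invr_gt0.
have em : e * 4 <= m.+1%:R^-1 by rewrite divfK.
have [d d0 hd] := dm_tr_cvg m%:R y e0 mF.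
have d20 : 0 < d / 2 by rewrite divr_gt0.
have [m1 [e1 [a [e10 a0 hmass]]]] := tangent_mass mF yF d20.
(* In units of the scale [s], the hole lies within [K] of [x], and [K3] is a Euclidean radius that
   contains the tripled cube. *)
pose K : R := enorm y + d.
have K0 : 0 < K by rewrite ltr_wpDl// enorm_ge0.
pose K3 : R := n.+1%:R * (3 * K).
have K30 : 0 < K3 by rewrite !mulr_gt0.
have S0 : 0 < scl K3 by exact: rscale_gt0.
(* Quotient of the upper bound for the large ball and the lower bound for the hole; the powers of
   [s] cancel. *)
exists (C0 * scl K3 / a) => r rp.
have small (t : R) : 0 < t -> \forall k \near \oo, rk k < t by move=> t0; exact: (cvgr_lt _ rkc).
have [k [km kr kr0 kF1 kF2]] : exists k, [/\ rk k < m.+1%:R^-1, rk k < r / K, rk k < r0 / K3,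
    (dm m1%:R (blow_up E x (rk k)) F < e1%:E)%E &
    (dm (m%:R + (`|y| + d)) (blow_up E x (rk k)) F < e%:E)%E].
  near \oo => k; exists k; split; near: k.
  - by apply: small; rewrite invr_gt0.
  - by apply: small; rewrite divr_gt0.
  - by apply: small; rewrite divr_gt0.
  - exact: hrk.
  - exact: hrk.
have s0 := rk0 k; set s := rk k in km kr kr0 kF1 kF2 s0.
(* The radius [d / 2] leaves the closed ball strictly inside the region of radius [s * d] where
   [far_hole] applies. *)
pose H : set V := [set z | enorm (z - (x + s *: y)) <= s * (d / 2)].
have cH : closed H.
  apply: (closed_comp (f := fun z => enorm (z - (x + s *: y))) (D := [set t | t <= s * (d / 2)])).
    move=> z _; apply: continuous_comp; last exact: enorm_continuous.
    by apply: continuousB; [exact: cvg_id|exact: cst_continuous].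
  exact: (closed_le (y := s * (d / 2))).
have sK0 : 0 < s * K by rewrite mulr_gt0.
have sd : s * (d / 2) < s * d by rewrite ltr_pM2l//; lra.
exists (s * K), H; split=> //.
- by rewrite sK0/= -ltr_pdivlMr.
- move=> z /= hz; apply: eball_sub_ball; rewrite /eball/=.
  have -> : z - x = (z - (x + s *: y)) + s *: y by rewrite opprD addrA subrK.
  apply: le_lt_trans (enormD _ _) _; rewrite enormZ gtr0_norm// /K mulrDr addrC ltrD2l; exact: le_lt_trans hz sd.
- apply/seteqP; split => // z [/= hz [_ [F' [y' [_ _ farz hG']]]]].
  apply: (far_hole mE s0 km em hd kF2 hG _ hG' farz).
  by apply: le_lt_trans (norm_le_enorm _) _; apply: le_lt_trans hz _.
have bB := eball_borel (x + s *: y) (s * (d / 2)).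
have hm := hmass x s s0 kF1.
have mB : measurable (ball x (3 * (s * K)) : set B) by apply: open_borel; exact: ball_open.
have e2 : n.+1%:R * (3 * (s * K)) = s * K3 by rewrite /K3; ring.
have le1 : (mvar (ball x (3 * (s * K))) <= mvar (eball x (s * K3)))%E.
  apply: le_measure; rewrite ?inE//; first exact: (eball_borel x (s * K3)).1.
  have := @ball_sub_eball R n x (s * K3); rewrite -e2.
  by rewrite mulrAC mulfV ?mul1r// pnatr_eq0.
apply: (le_trans le1).
have mH : measurable (H : set B) by exact: closed_borel.
have le2 : (mvar (eball (x + s *: y) (s * (d / 2))) <= mvar H)%E.
  apply: le_measure; rewrite ?inE//; first exact: bB.1.
  by move=> z /ltW.
have Ca0 : 0 <= C0 * scl K3 / a by rewrite ltW// divr_gt0// mulr_gt0.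
apply: le_trans (lee_wpmul2l _ le2); last by rewrite lee_fin.
rewrite -(fineK (mvar_fin rD bB)) -(fineK (mvar_fin rD (eball_borel x (s * K3)))) -EFinM lee_fin.
apply: le_trans (hC0 _ _ _) _; first by rewrite mulr_gt0.
  by rewrite -ltr_pdivlMr.
have sc : scl (s * K3) = scl s * scl K3 by apply: rscaleM; exact: ltW.
rewrite sc; apply: le_trans (ler_wpM2l Ca0 hm).
rewrite [leRHS](_ : _ = C0 * (scl s * scl K3))//.
by field; rewrite gt_eqF.
Unshelve. all: by end_near. Qed.

End TangentPorosity.

Section TangentNull.
Context {R : realType} {n : nat} (c alpha : R).
Context (halpha : 0 < alpha < 1) (hc : 0 < c).
Local Notation V := 'rV[R]_n.+1.
Local Notation B := (borelType R n).
Local Notation L := (lebesgueType R n).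
Context (E : set V) (mE : measurable (E : set L)).
Local Notation D := (frac_grad c alpha \1_E).
Local Notation bad := (bad c alpha E).

Lemma bad_null (m : nat) (G : set V) (rD : vector_radon D) :
  is_frac_grad c alpha \1_E D -> (mvar rD).-negligible (bad m G : set B).
Proof.
move=> gD.
(* On [P j] the porosity constant is at most [j], and holes of [bad m G] are holes of its subset
   [P j]. *)
pose P (j : nat) := [set x | [/\ bad m G x, hole_at rD (bad m G) j%:R x & `|x| < j%:R]].
have : (mvar rD).-negligible (\bigcup_j P j : set B).
  apply: negligible_bigcup => j.
  apply: (@porous_null _ _ (mvar rD) _ (P j) j%:R j%:R) => //.
  - by move=> A bA; rewrite -ge0_fin_numE// mvar_fin.
  - by move=> x [_ _ xj]; rewrite -ball_normE/= sub0r normrN.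
  - move=> x r [_ h _] r0; have [rho [H [rr cH Hx HA hH]]] := h r r0.
    exists rho, H; split=> //; apply/seteqP; split=> // z [Hz [bz _ _]].
    by rewrite -HA; split.
apply: negligibleS => x bx.
have [C hC] := bad_porous halpha hc mE rD gD erefl bx.
pose j := Num.truncn (Num.max C `|x|).
have jM : Num.max C `|x| < j.+1%:R by exact: truncnS_gt.
exists j.+1 => //; split=> //; last first.
  by apply: le_lt_trans jM; rewrite le_max lexx orbT.
move=> r r0; have [rho [H [rr cH Hx HA hH]]] := hC r r0.
exists rho, H; split=> //; apply: le_trans hH _; apply: lee_wpmul2r => //.
by rewrite lee_fin; apply/ltW/(le_lt_trans _ jM); rewrite le_max lexx.
Qed.

Definition saturated x := forall F y, Tan E x F -> frac_boundary c alpha F y ->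
  Tan E x (tr y F).

Lemma not_saturated_bad x : frac_boundary c alpha E x -> ~ saturated x ->
  exists m s, bad m (rat_ball_set s) x.
Proof.
move=> Ex; apply: contra_notP => h F y tF yF; apply: contrapT => nT.
have [mF _] := Tan_dm mE tF.
have mtF := measurable_tr y mF.
have [m hm] := far_Tan mE mtF nT.
have e0 : (0 : R) < m.+1%:R^-1 / 4 by rewrite divr_gt0// invr_gt0.
have [s hs] := separable_dm m e0 mtF.
by apply: h; exists m, s; split=> //; exists F, y.
Qed.

Lemma ae_saturated : {ae total_var D, forall x, frac_boundary c alpha E x -> saturated x}.
Proof.
(* Without a gradient [frac_grad] is 0, its support is empty, and so is the reduced boundary. *)
have [gD|ngD] := pselect (is_frac_grad c alpha (\1_E : V -> R) D); last first.
  exists set0; rewrite frac_grad0//; split=> [||x /not_implyP[[+ _] _]] //.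
    exact: total_var_zero.
  by move=> /(_ 1 ltr01); rewrite frac_grad0// total_var_zero ltxx.
have rD := gD.1.
pose P (k : nat) : set B := if unpickle k is Some (m, s) then bad m (rat_ball_set s) else set0.
have [A [mA A0 PA]] : (mvar rD).-negligible (\bigcup_k P k).
  apply: negligible_bigcup => k; rewrite /P.
  case: (unpickle k) => [[m s]|]; last exact: negligible_set0.
  exact: bad_null.
exists A; split => //.
  by apply/eqP; rewrite eq_le total_var_ge0 andbT -A0; exact: total_var_le.
move=> x /= /not_implyP[Ex nx]; apply: PA.
have [m [s bx]] := not_saturated_bad Ex nx.
by exists (pickle (m, s)) => //; rewrite /P pickleK.
Qed.

(** Saturation at [x] concerns all pairs (F, y) at once, so every step of the induction uses it
    again at the same [x]; the intermediate tangent sets bring no exceptional sets of their own. *)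
Lemma Tan_iter_sub x : saturated x -> forall k, Tan_iter c alpha k E x `<=` Tan E x.
Proof.
move=> sx; elim=> [|[|k] IH] //= G [F /IH tF [y yF tG]].
have [mF _] := Tan_dm mE tF.
exact: (Tan_translate mE mF (sx F y tF yF) tG).
Qed.

End TangentNull.

Theorem theorem3p3 (R : realType) (n : nat) (alpha c : R)
    (halpha : 0 < alpha < 1) (hc : 0 < c) (E : set 'rV[R]_n.+1)
    (mE : lebesgue_measurable E) (BVE : BV_loc c alpha \1_E) :
  {ae total_var (frac_grad c alpha \1_E), forall x,
    frac_boundary c alpha E x ->
    \bigcup_(k >= 2) Tan_iter c alpha k E x `<=` Tan E x}.
Proof.
have [A [mA A0 sA]] := ae_saturated halpha hc mE; exists A; split=> //.
move=> x hx; apply: sA; apply: contra_not hx => h Ex F [k _].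
exact: (Tan_iter_sub mE (h Ex)).
Qed.
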